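(* Let $k:\widehat{R}\to\mathbb{C}$ be a multiplicity function (a $\widehat{W}^Y$-invariant function) and let $M$ be a finite dimensional complex left $\widehat{W}^Y$-module. (1) The extended trigonometric Cherednik algebra $\widehat{H}^Y(k)$ is well defined; that is, there exists an associative unital $\mathbb{C}$-algebra $\widehat{H}^Y(k)$ which contains the symmetric algebra $S(\widehat{\mathfrak{h}})$ and the group algebra $\mathbb{C}[\widehat{W}^Y]$ as subalgebras, for which the multiplication map $S(\widehat{\mathfrak{h}})\otimes_{\mathbb{C}}\mathbb{C}[\widehat{W}^Y]\to\widehat{H}^Y(k)$ is a linear isomorphism, and in which the cross relations $$s_a\cdot\widehat{v}=s_a(\widehat{v})\cdot s_a-k_a(a,\widehat{v})\quad(a\in\widehat{F},\ \widehat{v}\in\widehat{\mathfrak{h}}),\qquad \omega\cdot\widehat{v}=\omega(\widehat{v})\cdot\omega\quad(\omega\in\Omega,\ \widehat{v}\in\widehat{\mathfrak{h}})$$ hold. (2) The assignments $\widehat{v}\mapsto\mathcal{D}^M_{\widehat{v}}$ ($\widehat{v}\in\widehat{V}$) and $w\mapsto w$ ($w\in\widehat{W}^Y$, acting on $\mathcal{F}_M$ by the action specified in the context) uniquely define an algebra morphism $\widehat{\pi}:\widehat{H}^Y(k)\to\mathrm{End}_{\mathbb{C}}(\mathcal{F}_M)$.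
   Context: Root data. Let $\mathfrak{g}$ be a complex finite dimensional reductive Lie algebra with $\mathfrak{g}_s=[\mathfrak{g},\mathfrak{g}]$ simple, and $\mathfrak{h}=\mathfrak{h}_s\oplus Z(\mathfrak{g})$ with $\mathfrak{h}_s$ a Cartan subalgebra of $\mathfrak{g}_s$ and $Z(\mathfrak{g})$ the center. Let $R\subset\mathfrak{h}_s$ be the root system of $(\mathfrak{g}_s,\mathfrak{h}_s)$, where $\mathfrak{h}_s^*$ is identified with $\mathfrak{h}_s$ via the Killing form, and let $V_s$ be the real span of $R$, with scalar product the restriction of the Killing form. Fix a real form $V=V_s\oplus V'$ of $\mathfrak{h}$ with $V'$ a real form of $Z(\mathfrak{g})$, extend the scalar product of $V_s$ to a scalar product $(\cdot,\cdot)$ on $V$ with $V'\perp V_s$, and extend it complex bilinearly to $\mathfrak{h}$. Put $\widetilde{\mathfrak{h}}=\mathfrak{h}\oplus\mathbb{C}c$ and $\widehat{\mathfrak{h}}=\mathfrak{h}\oplus\mathbb{C}c\oplus\mathbb{C}d$, and extend $(\cdot,\cdot)$ to a symmetric bilinear form on $\widehat{\mathfrak{h}}$ by $(c,d)=1$, $(c,c)=(d,d)=(c,v)=(d,v)=0$ for $v\in\mathfrak{h}$. For $a\in\widehat{\mathfrak{h}}$ with $(a,a)\neq0$ put $a^\vee=2a/(a,a)$ and $s_a(\widehat{v})=\widehat{v}-(\widehat{v},a^\vee)a$. For $u\in\mathfrak{h}$ let $t_u\in\mathrm{GL}(\widehat{\mathfrak{h}})$ be $t_u(v+\eta c+\xi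 d)=v+\xi u+\big(\eta-\tfrac{\xi}{2}(u,u)-(v,u)\big)c+\xi d$ ($v\in\mathfrak{h}$, $\eta,\xi\in\mathbb{C}$). Let $Q$ and $Q^\vee$ be the root and co-root lattices, i.e. the $\mathbb{Z}$-spans of $R$ and of $\{\alpha^\vee\}_{\alpha\in R}$. Let $W$ be the Weyl group generated by $s_\alpha$ ($\alpha\in R$), acting on $\widehat{\mathfrak{h}}$ (fixing $c$ and $d$). Let $\widehat{R}=\{\alpha+mc:\alpha\in R,\ m\in\mathbb{Z}\}$, and let $\widehat{W}$ be the affine Weyl group generated by $s_a$ ($a\in\widehat{R}$); then $\widehat{W}=W\ltimes Q^\vee$, with $y\in Q^\vee$ acting as $t_y$. Fix positive roots $R^+$ with simple roots $F=\{a_1,\dots,a_n\}$ and highest root $\theta$; put $a_0=-\theta+c$ and $\widehat{F}=\{a_0,\dots,a_n\}$. Every element of $\widehat{R}$ is a nonnegative or a nonpositive integral combination of $\widehat{F}$; this defines $\widehat{R}^+$ and $\widehat{R}^-$. Fix a lattice $Y\subset V$ with $Q^\vee\subseteq Y$ and $(Y,Q)\subseteq\mathbb{Z}$. The extended affine Weyl group is $\widehat{W}^Y=W\ltimes Y$, acting on $\widehat{\mathfrak{h}}$ with $y\in Y$ acting as $t_y$; it preserves $\widehat{R}$. Put $\Omega=\{\omega\in\widehat{W}^Y:\omega(\widehat{R}^+)\subseteq\widehat{R}^+\}$. The algebra in (1) is determined up to isomorphism by the listed properties; it is called the extended trigonometric Cherednik algebra. Function space and operators. $\widehat{V}=V\oplus\mathbb{R}c\oplus\mathbb{R}d$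 and $\widehat{V}^+=V\oplus\mathbb{R}c\oplus\mathbb{R}_{>0}d$ (both $\widehat{W}^Y$-stable). $\mathcal{C}$ is the set of connected components (chambers) of $\{\widehat{v}\in\widehat{V}^+:(a,\widehat{v})\neq0\ \forall a\in\widehat{R}^+\}$; $\widehat{W}^Y$ permutes $\mathcal{C}$. $C^\omega(\widehat{V}^+)$ is the space of complex valued real analytic functions on $\widehat{V}^+$. Put $\mathcal{F}_M=\prod_{\widehat{C}\in\mathcal{C}}\big(C^\omega(\widehat{V}^+)\otimes_{\mathbb{C}}M\big)$, with elements $f=(f_{\widehat{C}})_{\widehat{C}\in\mathcal{C}}$. With $\pi_M$ the representation map of $M$, $\widehat{W}^Y$ acts on $\mathcal{F}_M$ by $(wf)_{\widehat{C}}(\widehat{v})=\pi_M(w)\big(f_{w^{-1}\widehat{C}}(w^{-1}\widehat{v})\big)$. For $\widehat{v}\in\widehat{V}$, $\partial_{\widehat{v}}$ is the componentwise directional derivative on $\mathcal{F}_M$. For $a\in\widehat{R}^+$, $\chi_a$ is the characteristic function of $\{\widehat{v}\in\widehat{V}:(a,\widehat{v})<0\}$; it is constant on each chamber, with value $\chi_a(\widehat{C})\in\{0,1\}$, and it acts on $\mathcal{F}_M$ by $(\chi_af)_{\widehat{C}}=\chi_a(\widehat{C})f_{\widehat{C}}$. For fixed $\widehat{C}$ only finitely many $a\in\widehat{R}^+$ satisfy $\chi_a(\widehat{C})=1$. For $\widehat{v}\in\widehat{V}$ define $$\mathcal{D}^M_{\widehat{v}}f=\partial_{\widehat{v}}f-\sum_{a\in\widehat{R}^+}k_a(a,\widehat{v})\,\chi_a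 s_af .$$ *)

(* Defs.v *)
From HB Require Import structures.
From mathcomp Require Import all_boot all_order all_algebra.
From mathcomp Require Import finmap.
From mathcomp Require Import complex.
(* Its notations clash with those of mathcomp-analysis. *)
From mathcomp Require Import -(notations) mpoly.
From mathcomp Require Import all_classical all_reals all_analysis.

Set Implicit Arguments.
Unset Strict Implicit.
Unset Printing Implicit Defensive.

Import Order.TTheory GRing.Theory Num.Theory.
Import numFieldNormedType.Exports.

Local Open Scope classical_set_scope.
Local Open Scope complex_scope.
Local Open Scope ring_scope.

Section Spans.

Definition real_span (R : realType) (g : lmodType R[i]) (A : set g) : set g :=
  [set x | exists (n : nat) (r : 'I_n -> R) (y : 'I_n -> g),
     (forall i, A (y i)) /\ x = \sum_(i < n) (r i)%:C *: y i].

Definition int_span (V : zmodType) (A : set V) : set V :=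
  [set x | exists (n : nat) (m : 'I_n -> int) (y : 'I_n -> V),
     (forall i, A (y i)) /\ x = \sum_(i < n) y i *~ m i].

Definition nonneg_comb (V : zmodType) (s : seq V) : set V :=
  [set x | exists m : 'I_(size s) -> nat,
     x = \sum_(i < size s) nth 0 s i *+ m i].

End Spans.

Section Lie.

Variables (R : realType) (g : vectType R[i]) (br : g -> g -> g).

Definition lie_bracket : Prop :=
  [/\ forall c x y z, br (c *: x + y) z = c *: br x z + br y z,
      forall c x y z, br z (c *: x + y) = c *: br z x + br z y,
      forall x, br x x = 0 &
      forall x y z, br x (br y z) + br y (br z x) + br z (br x y) = 0].

Definition ideal_in (K I : {vspace g}) : Prop :=
  (I <= K)%VS /\ forall x y, x \in K -> y \in I -> br x y \in I.

Definition reductive : Prop :=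
  forall I, ideal_in fullv I ->
    exists2 J, ideal_in fullv J & (I + J)%VS = fullv /\ (I :&: J)%VS = 0%VS.

Definition simple_in (K : {vspace g}) : Prop :=
  (exists x y, [/\ x \in K, y \in K & br x y != 0]) /\
  (forall I, ideal_in K I -> I = 0%VS \/ I = K).

Definition derived : {vspace g} :=
  <<[seq br x y | x <- vbasis fullv, y <- vbasis fullv]>>%VS.

Definition center : {vspace g} :=
  (\bigcap_(x <- vbasis fullv) lker (linfun (br x)))%VS.

(* Cartan subalgebra of a semisimple algebra: abelian, equal to its own
   centralizer, and acting diagonalizably. *)
Definition cartan_in (K hs : {vspace g}) : Prop :=
  [/\ (hs <= K)%VS,
      forall x y, x \in hs -> y \in hs -> br x y = 0,
      forall x, x \in K -> (forall h, h \in hs -> br h x = 0) -> x \in hs &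
      forall h, h \in hs -> exists X : seq g, basis_of K X /\
        forall x, x \in X -> exists c : R[i], br h x = c *: x].

(* the trace of [ad x \o ad y] on [K], for [x] and [y] in the subalgebra [K] *)
Definition killing (K : {vspace g}) (x y : g) : R[i] :=
  \sum_(i < \dim K) coord (vbasis K) i (br x (br y (vbasis K)`_i)).

(* A root [h |-> killing K a h] is represented by the element [a] of [hs]. *)
Definition lie_root (K hs : {vspace g}) : set g :=
  [set a | [/\ a \in hs, a != 0 & exists x, [/\ x \in K, x != 0 &
     forall h, h \in hs -> br h x = killing K a h *: x]]].

Definition real_form (V : set g) (U : {vspace g}) : Prop :=
  exists2 X : seq g, basis_of U X & V = real_span [set` X].

End Lie.

(* [hat v eta xi] is [v + eta c + xi d]; [S] is the Gram matrix of the form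
   on [V] in the chosen real basis of [V], hence also that of its complex
   bilinear extension to [h]. *)
Section Hat.

Variables (K : fieldType) (l : nat) (S : 'M[K]_l).

Definition form (u v : 'cV[K]_l) : K := (u^T *m S *m v) 0 0.

Definition hat (v : 'cV[K]_l) (eta xi : K) : 'cV[K]_l.+2 :=
  col_mx (eta%:M : 'cV_1) (col_mx (xi%:M : 'cV_1) v : 'cV_(1 + l)).

Definition cpart (x : 'cV[K]_l.+2) : K := (usubmx (x : 'cV_(1 + l.+1))) 0 0.
Definition dpart (x : 'cV[K]_l.+2) : K :=
  (usubmx (dsubmx (x : 'cV_(1 + l.+1)) : 'cV_(1 + l))) 0 0.
Definition hpart (x : 'cV[K]_l.+2) : 'cV[K]_l :=
  dsubmx (dsubmx (x : 'cV_(1 + l.+1)) : 'cV_(1 + l)).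

Definition hform (x y : 'cV[K]_l.+2) : K :=
  form (hpart x) (hpart y) + cpart x * dpart y + dpart x * cpart y.

Definition refl (a x : 'cV[K]_l.+2) : 'cV[K]_l.+2 :=
  x - hform x ((2%:R / hform a a) *: a) *: a.

Definition transl (u : 'cV[K]_l) (x : 'cV[K]_l.+2) : 'cV[K]_l.+2 :=
  hat (hpart x + dpart x *: u)
      (cpart x - dpart x / 2%:R * form u u - form (hpart x) u) (dpart x).

End Hat.

Definition mx_of (K : fieldType) (n : nat) (f : 'cV[K]_n -> 'cV[K]_n) : 'M[K]_n :=
  \matrix_(i, j) f (delta_mx j 0) i 0.

Definition cplx (R : realType) (m n : nat) (A : 'M[R]_(m, n)) : 'M[R[i]]_(m, n) :=
  map_mx (real_complex R) A.

Section RootData.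

Variables (R : realType) (g : vectType R[i]) (br : g -> g -> g).
Variables (hs : {vspace g}) (V' : set g) (l : nat) (b : l.-tuple g).

Definition embed (x : 'cV[R]_l) : g := \sum_(i < l) (x i 0)%:C *: b`_i.

Definition finite_roots : set 'cV[R]_l :=
  [set a | lie_root br (derived br) hs (embed a)].

Definition Vs : set g := real_span (lie_root br (derived br) hs).

Definition scalar_product (S : 'M[R]_l) : Prop :=
  [/\ S^T = S, forall u, u != 0 -> 0 < form S u u,
      forall u v, Vs (embed u) -> Vs (embed v) ->
        (form S u v)%:C = killing br (derived br) (embed u) (embed v) &
      forall u v, Vs (embed u) -> V' (embed v) -> form S u v = 0].

(* [b] is an R-basis of V = Vs + V', and a C-basis of h = hs + Z(g). *)
Record root_datum (S : 'M[R]_l) : Prop := RootDatum {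
  rd_bracket : lie_bracket br;
  rd_reductive : reductive br;
  rd_simple : simple_in br (derived br);
  rd_cartan : cartan_in br (derived br) hs;
  rd_center : real_form V' (center br);
  rd_basis : basis_of (hs + center br)%VS b;
  rd_realform : real_span [set` b] = [set x + y | x in Vs & y in V'];
  rd_form : scalar_product S }.

End RootData.

Section Affine.

Variables (R : realType) (l : nat) (S : 'M[R]_l) (Phi : set 'cV[R]_l).

Definition coroot (a : 'cV[R]_l) : 'cV[R]_l := (2%:R / form S a a) *: a.

Definition simple_roots (F : seq 'cV[R]_l) : Prop :=
  [/\ free F, forall a, a \in F -> Phi a &
      forall a, Phi a -> nonneg_comb F a \/ nonneg_comb F (- a)].

Definition highest_root (F : seq 'cV[R]_l) (theta : 'cV[R]_l) : Prop :=
  Phi theta /\ forall a, Phi a -> nonneg_comb F (theta - a).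

(* A lattice is the Z-span of R-linearly independent vectors; it need not
   span V. *)
Definition translation_lattice (Y : set 'cV[R]_l) : Prop :=
  [/\ exists2 X : seq 'cV[R]_l, free X & Y = int_span [set` X],
      int_span (coroot @` Phi) `<=` Y &
      forall y q, Y y -> int_span Phi q -> form S y q \is a Num.int].

Definition affine_roots : set 'cV[R]_l.+2 :=
  [set hat a m%:~R 0 | a in Phi & m in [set: int]].

Definition affine_simple (F : seq 'cV[R]_l) (theta : 'cV[R]_l)
    : seq 'cV[R]_l.+2 :=
  hat (- theta) 1 0 :: [seq hat a 0 0 | a <- F].

Definition weyl : set 'M[R]_l.+2 :=
  [set w | exists2 s : seq 'cV[R]_l, (forall a, a \in s -> Phi a) &
     w = \prod_(a <- s) mx_of (refl S (hat a 0 0))].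

(* The semidirect product of W and Y, identified with its image in the
   general linear group (the action is faithful: look at the image of d). *)
Definition ext_weyl (Y : set 'cV[R]_l) : set 'M[R]_l.+2 :=
  [set w *m mx_of (transl S y) | w in weyl & y in Y].

Variables (F : seq 'cV[R]_l) (theta : 'cV[R]_l) (Y : set 'cV[R]_l).

Definition affine_pos : set 'cV[R]_l.+2 :=
  affine_roots `&` nonneg_comb (affine_simple F theta).

Definition Omega : set 'M[R]_l.+2 :=
  [set w | ext_weyl Y w /\ (fun a => w *m a) @` affine_pos `<=` affine_pos].

Definition multiplicity (k : 'cV[R]_l.+2 -> R[i]) : Prop :=
  forall w a, ext_weyl Y w -> affine_roots a -> k (w *m a) = k a.

(* S(h^) is the polynomial algebra on the coordinate basis of h^;
   [sym_vec] is the inclusion of h^ in it. *)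
Definition sym_vec (x : 'cV[R[i]]_l.+2) : mpoly l.+2 R[i] :=
  \sum_(i < l.+2) x i 0 *: mpolyX R[i] (mnm1 i).

(* The subalgebra inclusions are [iota : S(h^) -> H] and the linear extension
   of [delta] to C[W^Y]; [delta] is only constrained on the group.  Elements
   of C[W^Y], resp. of S(h^) (x) C[W^Y], are the finitely supported functions
   from the group to C, resp. S(h^). *)
Definition group_alg_map (H : algType R[i]) (delta : 'M[R]_l.+2 -> H)
    (x : {fsfun 'M[R]_l.+2 -> R[i] with 0}) : H :=
  \sum_(w <- finsupp x) x w *: delta w.

Definition mult_map (H : algType R[i]) (iota : mpoly l.+2 R[i] -> H)
    (delta : 'M[R]_l.+2 -> H)
    (p : {fsfun 'M[R]_l.+2 -> mpoly l.+2 R[i] with 0}) : H :=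
  \sum_(w <- finsupp p) iota (p w) * delta w.

Record cherednik_algebra (k : 'cV[R]_l.+2 -> R[i]) (H : algType R[i])
    (iota : {lrmorphism mpoly l.+2 R[i] -> H}) (delta : 'M[R]_l.+2 -> H)
    : Prop := CherednikAlgebra {
  ca_sym : injective iota;
  ca_one : delta 1%:M = 1;
  ca_mul : forall w w', ext_weyl Y w -> ext_weyl Y w' ->
    delta (w *m w') = delta w * delta w';
  ca_group : set_inj [set x | [set` finsupp x] `<=` ext_weyl Y]
    (group_alg_map delta);
  ca_pbw : set_bij [set p | [set` finsupp p] `<=` ext_weyl Y] [set: H]
    (mult_map iota delta);
  ca_refl : forall a x, a \in affine_simple F theta ->
    delta (mx_of (refl S a)) * iota (sym_vec x) =
      iota (sym_vec (refl (cplx S) (cplx a) x)) * delta (mx_of (refl S a))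
      - (k a * hform (cplx S) (cplx a) x)%:A;
  ca_omega : forall w x, Omega w ->
    delta w * iota (sym_vec x) = iota (sym_vec (cplx w *m x)) * delta w }.

End Affine.

Section Coordinates.

Variables (R : realType) (M : vectType R[i]).

Definition re_coord (i : 'I_(\dim {:M})) (u : M) : R :=
  complex.Re (coord (vbasis fullv) i u).

Definition im_coord (i : 'I_(\dim {:M})) (u : M) : R :=
  complex.Im (coord (vbasis fullv) i u).

Definition dir_derivative (n : nat) (v : 'cV[R]_n) (f : 'cV[R]_n -> M)
    (x : 'cV[R]_n) : M :=
  \sum_(i < \dim {:M})
     ('D_v (re_coord i \o f) x +i* 'D_v (im_coord i \o f) x) *:
       (vbasis {:M})`_i.

End Coordinates.

Section Analytic.

Variables (R : realType) (n : nat) (U : set 'cV[R]_n).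

Definition monomial (al : multinom n) (y : 'cV[R]_n) : R :=
  \prod_(i < n) y i 0 ^+ al i.

(* For U open: near each point of U, f is the sum of an absolutely
   convergent power series. *)
Definition real_analytic (f : U -> R) : Prop :=
  forall p : U, exists2 r : R, 0 < r &
  exists c : multinom n -> R, forall x : U, `|\val x - \val p| < r ->
    (exists B : R, forall m,
       \sum_(al : bmultinom n m)
          `|c al * monomial al (\val x - \val p)| <= B) /\
    (\sum_(al : bmultinom n m)
          c al * monomial al (\val x - \val p)) @[m --> \oo] --> f x.

Lemma real_analytic_lin (r s : R) (f h : U -> R) :
  real_analytic f -> real_analytic h ->
  real_analytic (fun x => r * f x + s * h x).
Proof.
move=> af ah p; have [rf rf0 [cf hf]] := af p; have [rh rh0 [ch hh]] := ah p.
exists (Num.min rf rh); first by rewrite lt_min rf0 rh0.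
exists (fun al => r * cf al + s * ch al) => x; rewrite lt_min => /andP[xf xh].
have [[Bf bf] lf] := hf x xf; have [[Bh bh] lh] := hh x xh; split.
  exists (`|r| * Bf + `|s| * Bh) => m.
  apply: (@le_trans _ _ (\sum_(al : bmultinom n m)
     (`|r| * `|cf al * monomial al (\val x - \val p)| +
      `|s| * `|ch al * monomial al (\val x - \val p)|))).
    by apply: ler_sum => al _; rewrite mulrDl -!mulrA -!normrM ler_normD.
  rewrite big_split /= -!mulr_sumr.
  by apply: lerD; apply: ler_wpM2l; rewrite ?bf ?bh.
rewrite [X in X @ _ --> _](_ : _ = fun m =>
   r * (\sum_(al : bmultinom n m) cf al * monomial al (\val x - \val p)) +
   s * (\sum_(al : bmultinom n m) ch al * monomial al (\val x - \val p))).
  by apply: cvgD; apply: cvgMr.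
apply/funext => m; rewrite !mulr_sumr -big_split /=; apply: eq_bigr => al _.
by rewrite mulrDl !mulrA.
Qed.

Lemma real_analytic0 : real_analytic (fun=> 0).
Proof.
move=> p; exists 1 => //; exists (fun=> 0) => x _; split.
  by exists 0 => m; rewrite big1 // => al _; rewrite mul0r normr0.
rewrite [X in X @ _ --> _](_ : _ = fun=> 0); first exact: cvg_cst.
by apply/funext => m; rewrite big1 // => al _; rewrite mul0r.
Qed.

Variable M : vectType R[i].

Definition analytic : {pred U -> M} := [pred f : U -> M |
  `[< forall i, real_analytic (fun x => re_coord i (f x)) /\
                real_analytic (fun x => im_coord i (f x))>]].

Lemma analytic_submod : submod_closed analytic.
Proof.
have ReM (x y : R[i]) : complex.Re (x * y) =
    complex.Re x * complex.Re y + (- complex.Im x) * complex.Im y.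
  by case: x y => [? ?] [? ?]; rewrite mulNr.
have ImM (x y : R[i]) : complex.Im (x * y) =
    complex.Re x * complex.Im y + complex.Im x * complex.Re y.
  by case: x y => [? ?] [? ?].
have ReD (x y : R[i]) : complex.Re (x + y) = complex.Re x + complex.Re y.
  by case: x y => [? ?] [? ?].
have ImD (x y : R[i]) : complex.Im (x + y) = complex.Im x + complex.Im y.
  by case: x y => [? ?] [? ?].
have addE (f h : U -> R) : real_analytic f -> real_analytic h ->
    real_analytic (fun x => f x + h x).
  move=> af ah; suff -> : (fun x => f x + h x) = (fun x => 1 * f x + 1 * h x).
    exact: real_analytic_lin.
  by apply/funext => x; rewrite !mul1r.
split.
  apply/asboolP => i; split.
    suff -> : (fun x : U => re_coord i ((0 : U -> M) x)) =
              (fun=> 0) by exact: real_analytic0.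
    by apply/funext => x; rewrite /re_coord linear0.
  suff -> : (fun x : U => im_coord i ((0 : U -> M) x)) =
            (fun=> 0) by exact: real_analytic0.
  by apply/funext => x; rewrite /im_coord linear0.
move=> c f h /asboolP af /asboolP ah; apply/asboolP => i.
have [fr fi] := af i; have [hr hi] := ah i; split.
  rewrite [X in real_analytic X](_ : _ = fun x : U =>
    (complex.Re c * re_coord i (f x) +
     (- complex.Im c) * im_coord i (f x)) +
    re_coord i (h x)); last first.
    apply/funext => x; rewrite /re_coord /im_coord -ReM -ReD.
    by rewrite linearD linearZ.
  by apply: addE => //; exact: real_analytic_lin.
rewrite [X in real_analytic X](_ : _ = fun x : U =>
  (complex.Re c * im_coord i (f x) +
   complex.Im c * re_coord i (f x)) +
  im_coord i (h x)); last first.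
  apply/funext => x; rewrite /re_coord /im_coord -ImM -ImD.
  by rewrite linearD linearZ.
by apply: addE => //; exact: real_analytic_lin.
Qed.

(* C^omega(U) (x) M: as M has finite dimension, these are the M-valued
   functions whose coordinates are analytic. *)
Record analytic_fun := AnalyticFun {
  analytic_val :> U -> M;
  _ : analytic_val \in analytic }.

HB.instance Definition _ := [isSub of analytic_fun for analytic_val].
HB.instance Definition _ := [Choice of analytic_fun by <:].
HB.instance Definition _ :=
  GRing.isSubmodClosed.Build R[i] (U -> M) analytic analytic_submod.
HB.instance Definition _ := [SubChoice_isSubLmodule of analytic_fun by <:].

End Analytic.

Section FunctionSpace.

Variables (R : realType) (l : nat) (S : 'M[R]_l) (Phi : set 'cV[R]_l).
Variables (F : seq 'cV[R]_l) (theta : 'cV[R]_l) (Y : set 'cV[R]_l).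
Variables (k : 'cV[R]_l.+2 -> R[i]).
Variables (M : vectType R[i]) (piM : 'M[R]_l.+2 -> 'End(M)).

Definition ext_weyl_module : Prop :=
  piM 1%:M = \1%VF /\
  forall w w', ext_weyl S Phi Y w -> ext_weyl S Phi Y w' ->
    piM (w *m w') = (piM w \o piM w')%VF.

Definition Vplus : set 'cV[R]_l.+2 := [set x | 0 < dpart x].

Definition regular : set 'cV[R]_l.+2 :=
  [set x | Vplus x /\ forall a, affine_pos Phi F theta a -> hform S a x != 0].

Definition chambers : set (set 'cV[R]_l.+2) :=
  [set connected_component regular x | x in regular].

Definition FM : lmodType R[i] := (chambers -> analytic_fun Vplus M)%type.

(* [f] extended by 0 to all sets and all vectors *)
Definition eval (f : FM) (C : set 'cV[R]_l.+2) (x : 'cV[R]_l.+2) : M :=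
  if insub C is Some C' then
    if insub x is Some x' then f C' x' else 0
  else 0.

Definition weyl_act (w : 'M[R]_l.+2) (f : FM) (C : set 'cV[R]_l.+2)
    (x : 'cV[R]_l.+2) : M :=
  piM w (eval f [set invmx w *m y | y in C] (invmx w *m x)).

(* The value on the chamber [C] of the characteristic function of
   [(a, x) < 0], which is constant there. *)
Definition chi (a : 'cV[R]_l.+2) (C : set 'cV[R]_l.+2) : R[i] :=
  if `[< C `<=` [set x | hform S a x < 0] >] then 1 else 0.

Definition dunkl (v : 'cV[R]_l.+2) (f : FM) (C : set 'cV[R]_l.+2)
    (x : 'cV[R]_l.+2) : M :=
  dir_derivative v (eval f C) x -
  \sum_(a \in affine_pos Phi F theta)
     (k a * (hform S a v)%:C * chi a C) *: weyl_act (mx_of (refl S a)) f C x.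

End FunctionSpace.

Arguments Vplus : clear implicits.

Definition algebra_morphism_to_End (K : comNzRingType) (H : algType K)
    (E : lmodType K) (pi : H -> E -> E) : Prop :=
  [/\ forall x, linear (pi x),
      forall c x y f, pi (c *: x + y) f = c *: pi x f + pi y f,
      forall f, pi 1 f = f &
      forall x y f, pi (x * y) f = pi x (pi y f)].

(* Main.v *)
(** Let the group act on a set [X] on which every affine root has a sign, and
    on a space [P] carrying compatible commuting operators [del_v]. On the
    functions [X -> P], the operators
    [del_v - sum_(a > 0) k_a (a, v) chi_a s_a] and the group satisfy the cross
    relations, because a simple reflection permutes the positive roots other
    than its own. These operators commute: at points where no positive root is
    negative they reduce to the [del_v], and the cross relations transport
    commutation along simple reflections, by induction on the number of
    negative positive roots.

    For [X] the group itself, signs given by inversions, [P = S(h^)] and [del_v]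
    the multiplication by [v], evaluation at [1] recovers the coefficients of
    an operator, so the operators generate a model of the algebra satisfying
    the PBW property; this is (1). For [X] the set of chambers and [P] the
    analytic functions with their derivatives, one obtains (2), the morphism
    being well defined and unique by the PBW property. *)
Require Import Defs.
From HB Require Import structures.
From mathcomp Require Import all_boot all_order all_algebra.
From mathcomp Require Import finmap.
From mathcomp Require Import complex.
From mathcomp Require Import -(notations) mpoly.
From mathcomp Require Import all_classical all_reals all_analysis.
From mathcomp Require Import zify ring lra.

Set Implicit Arguments.
Unset Strict Implicit.
Unset Printing Implicit Defensive.

Import Order.TTheory GRing.Theory Num.Theory.
Import numFieldNormedType.Exports.

Local Open Scope classical_set_scope.
Local Open Scope complex_scope.
Local Open Scope ring_scope.

Local Notation form := Defs.form.

(** The root system has to be extracted from the Lie algebra first. On the real span of the roots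
    the Killing form is a given scalar product, so it is positive on roots; being nonzero, it is
    nondegenerate by simplicity. The vanishing trace of a commutator on a root string then yields
    one-dimensional root spaces, reducedness and the Cartan integers. Cross relations are imposed
    for simple reflections and for [Omega] only. Statements about other group elements therefore go
    through generation by these, by induction on the number of inverted roots. Commutation can be
    transported because conjugating a product of two operators by a simple reflection produces
    correction terms that are symmetric in the two directions. For (2), analyticity has to survive
    differentiation, linear substitution and sums, and derivatives have to commute. Power series are
    grouped into homogeneous polynomials measured by the l1 norm of their coefficients; rules for
    derivatives then become identities between polynomials. *)

Section LinearMaps.

Variables (K : pzRingType) (U V : lmodType K) (f : U -> V).
Hypothesis linf : linear f.

Lemma linear_map0 : f 0 = 0.
Proof. by have := linf (- 1) 0 0; rewrite scaler0 addr0 scaleN1r addNr. Qed.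

Lemma linear_mapD u v : f (u + v) = f u + f v.
Proof. by have := linf 1 u v; rewrite !scale1r. Qed.

Lemma linear_mapZ c u : f (c *: u) = c *: f u.
Proof. by have := linf c u 0; rewrite !addr0 linear_map0 addr0. Qed.

End LinearMaps.

(** * Eigenvectors and traces of commutators *)

Section EigenFamilies.

Variables (F : fieldType) (V : vectType F).

Definition coord_mx n (X : n.-tuple V) (f : 'End(V)) : 'M[F]_n :=
  \matrix_(i, j) coord X j (f X`_i).

(** Rows record the images of the family, whence the reversed order of the product. Expanding the
    image of [f] in the family requires that [f] keep the span stable. *)
Lemma coord_mxM n (X : n.-tuple V) (f h : 'End(V)) :
  (forall i : 'I_n, f X`_i \in <<X>>%VS) ->
  coord_mx X (h \o f)%VF = coord_mx X f *m coord_mx X h.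
Proof.
move=> fX; apply/matrixP => i j; rewrite !mxE lfunE /= {1}(coord_span (fX i)).
rewrite !linear_sum; apply: eq_bigr => k _.
by rewrite !mxE !linearZ.
Qed.

(** The trace of a commutator vanishes. This stands in for the representation theory of sl2: below,
    [f] and [h] raise and lower along a root string, and their commutator acts by explicit
    scalars. *)
Lemma sum_commutator_eigenvalues n (X : n.-tuple V) (f h : 'End(V)) c :
  free X ->
  (forall i : 'I_n, f X`_i \in <<X>>%VS) ->
  (forall i : 'I_n, h X`_i \in <<X>>%VS) ->
  (forall i : 'I_n, f (h X`_i) - h (f X`_i) = c i *: X`_i) ->
  \sum_i c i = 0.
Proof.
move=> freeX fX hX fhX.
have : \tr (coord_mx X (f \o h)%VF) - \tr (coord_mx X (h \o f)%VF) = 0.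
  by rewrite !coord_mxM // mxtrace_mulC subrr.
rewrite -raddfB /= => tr0; rewrite -[RHS]tr0; apply: eq_bigr => i _.
rewrite !mxE !lfunE /= -linearB /= fhX linearZ /= coord_free // eqxx mulr1.
by [].
Qed.

(** Applying [T h - c n h] to a relation kills the last vector and multiplies the i-th coefficient
    by [c i h - c n h], where [h] may depend on [i]. Families are indexed by [nat] so that the
    induction can drop the last member. *)
Lemma weight_indep (I : Type) (D : I -> Prop) (T : I -> 'End(V)) n
    (x : nat -> V) (c : nat -> I -> F) :
  (forall i, (i < n)%N -> x i != 0) ->
  (forall i h, (i < n)%N -> D h -> T h (x i) = c i h *: x i) ->
  (forall i j, (i < j < n)%N -> exists2 h, D h & c i h != c j h) ->
  forall k : nat -> F, \sum_(i < n) k i *: x i = 0 ->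
    forall i, (i < n)%N -> k i = 0.
Proof.
elim: n => // n IHn x0 Tx cinj k; rewrite big_ord_recr /= => sum0.
have kn i : (i < n)%N -> k i = 0.
  move=> lt_in; have [|h Dh cne] := cinj i n; first by rewrite lt_in /=.
  suff /eqP : (c i h - c n h) * k i = 0.
    by rewrite mulf_eq0 subr_eq0 (negPf cne) => /eqP.
  apply: (IHn _ _ _ (fun i => (c i h - c n h) * k i)) lt_in => [j jn|j u jn|j u|].
  - exact/x0/ltnW.
  - exact/Tx/ltnW.
  - by move=> /andP[ju un]; apply: cinj; rewrite ju ltnW.
  have : T h (\sum_(i < n) k i *: x i + k n *: x n) -
         c n h *: (\sum_(i < n) k i *: x i + k n *: x n) = 0.
    by rewrite sum0 linear0 scaler0 subrr.
  rewrite linearD linear_sum scalerDr /= linearZ /= Tx // !scalerA.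
  rewrite [_ * c n h]mulrC opprD addrACA subrr addr0 scaler_sumr -sumrB => sum1.
  rewrite -[RHS]sum1; apply: eq_bigr => j _; rewrite linearZ /= Tx //.
    by rewrite !scalerA -scalerBl mulrBl [k j * _]mulrC.
  by apply: leq_trans (ltn_ord j) _.
move=> i; rewrite ltnS leq_eqVlt => /predU1P[->|/kn //].
have {}kn : \sum_(j < n) k j *: x j = 0.
  by apply: big1 => j _; rewrite kn ?scale0r.
by move/eqP: sum0; rewrite kn add0r scaler_eq0 (negPf (x0 n _)) // orbF => /eqP.
Qed.

Lemma weight_free (I : Type) (D : I -> Prop) (T : I -> 'End(V)) n
    (x : nat -> V) (c : nat -> I -> F) :
  (forall i, (i < n)%N -> x i != 0) ->
  (forall i h, (i < n)%N -> D h -> T h (x i) = c i h *: x i) ->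
  (forall i j, (i < j < n)%N -> exists2 h, D h & c i h != c j h) ->
  free (mktuple (fun i : 'I_n => x i)).
Proof.
move=> x0 Tx cinj; apply/freeP => k sum0 i.
pose k' j := if insub j is Some i' then k i' else 0.
have k'E (j : 'I_n) : k' j = k j by rewrite /k' valK.
rewrite -k'E; apply: (weight_indep x0 Tx cinj) (ltn_ord i).
rewrite -[RHS]sum0; apply: eq_bigr => j _.
by rewrite k'E -tnth_nth tnth_mktuple.
Qed.

Lemma free_size_bound n (X : n.-tuple V) : free X -> (n <= \dim {:V})%N.
Proof.
move=> freeX; have := dimvS (subvf <<X>>%VS).
by rewrite (eqP freeX) size_tuple.
Qed.

End EigenFamilies.

(** * Root spaces of a simple Lie algebra *)

Section LieRoots.

Variables (R : realType) (g : vectType R[i]) (br : g -> g -> g).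
Hypothesis lie_br : lie_bracket br.

Let brDl x y z : br (x + y) z = br x z + br y z.
Proof. by have [h _ _ _] := lie_br; have := h 1 x y z; rewrite !scale1r. Qed.

Let brDr x y z : br z (x + y) = br z x + br z y.
Proof. by have [_ h _ _] := lie_br; have := h 1 x y z; rewrite !scale1r. Qed.

Let br0l z : br 0 z = 0.
Proof. by apply: (addrI (br 0 z)); rewrite -brDl !addr0. Qed.

Let br0r z : br z 0 = 0.
Proof. by apply: (addrI (br z 0)); rewrite -brDr !addr0. Qed.

Let brZl c x z : br (c *: x) z = c *: br x z.
Proof. by have [h _ _ _] := lie_br; have := h c x 0 z; rewrite br0l !addr0. Qed.

Let brZr c x z : br z (c *: x) = c *: br z x.
Proof. by have [_ h _ _] := lie_br; have := h c x 0 z; rewrite br0r !addr0. Qed.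

Let brNr x z : br z (- x) = - br z x.
Proof. by rewrite -scaleN1r brZr scaleN1r. Qed.

Let brC x y : br x y = - br y x.
Proof.
have [_ _ h _] := lie_br; apply/eqP; rewrite -addr_eq0; apply/eqP.
by have := h (x + y); rewrite brDl !brDr !h addr0 add0r.
Qed.

Let jacobi x y z : br x (br y z) = br (br x y) z + br y (br x z).
Proof.
have [_ _ _ h] := lie_br; apply/eqP; rewrite -subr_eq0 -(h x y z).
by rewrite (brC z (br x y)) (brC z x) brNr opprD -!addrA [- br y _ + _]addrC.
Qed.

Let br_linear x : linear (br x).
Proof. by move=> c y z; rewrite brDr brZr. Qed.

Let ad x : 'End(g) := linfun (br x).

Let adE x y : ad x y = br x y.
Proof.
pose f : {linear g -> g} :=
  HB.pack (br x) (GRing.isLinear.Build _ _ _ _ (br x) (br_linear x)).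
exact: (lfunE f).
Qed.

Local Notation K := (derived br).

Let br_derived x y : br x y \in K.
Proof.
have brK j : br (vbasis {:g})`_j x \in K -> br x (vbasis {:g})`_j \in K.
  by rewrite [br x _]brC memvN.
rewrite -adE (coord_vbasis (memvf y)) linear_sum memv_suml // => j _.
rewrite linearZ memvZ //= adE; apply: brK.
rewrite -adE (coord_vbasis (memvf x)) linear_sum memv_suml // => i _.
rewrite linearZ memvZ //= adE memv_span //.
by apply/allpairsP; exists ((vbasis fullv)`_j, (vbasis fullv)`_i);
  rewrite !mem_nth ?size_tuple.
Qed.

Local Notation kap := (killing br K).

Let kapE x y : kap x y = \tr (coord_mx (vbasis K) (ad x \o ad y)%VF).
Proof. by apply: eq_bigr => i _; rewrite !mxE lfunE /= !adE. Qed.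

Let ad_stab x (i : 'I_(\dim K)) : ad x (vbasis K)`_i \in <<vbasis K>>%VS.
Proof. by rewrite adE (span_basis (vbasisP _)) br_derived. Qed.

Let kapC x y : kap x y = kap y x.
Proof.
rewrite !kapE (coord_mxM _ (ad_stab x)) (coord_mxM _ (ad_stab y)).
exact: mxtrace_mulC.
Qed.

Let ad_br x y : ad (br x y) = ((ad x \o ad y) - (ad y \o ad x))%VF.
Proof.
apply/lfunP => z; rewrite !(add_lfunE, opp_lfunE, comp_lfunE, adE).
by rewrite (jacobi x) addrK.
Qed.

Let coord_mxB n (X : n.-tuple g) (f h : 'End(g)) :
  coord_mx X (f - h) = coord_mx X f - coord_mx X h.
Proof. by apply/matrixP => i j; rewrite !mxE add_lfunE opp_lfunE linearB. Qed.

Let comp_stab x y (i : 'I_(\dim K)) :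
  (ad x \o ad y)%VF (vbasis K)`_i \in <<vbasis K>>%VS.
Proof. by rewrite lfunE /= !adE (span_basis (vbasisP _)) br_derived. Qed.

(** Since [ad] of a bracket is a commutator, this is cyclicity of the trace on the derived algebra,
    which every [ad] stabilizes. *)
Let kap_inv x y z : kap (br x y) z = kap x (br y z).
Proof.
rewrite !kapE !ad_br comp_lfunDl comp_lfunDr comp_lfunNl comp_lfunNr.
rewrite !coord_mxB !linearB /=; congr (_ - _).
  by rewrite comp_lfunA.
rewrite -comp_lfunA (coord_mxM _ (comp_stab x z)) mxtrace_mulC.
by rewrite -(coord_mxM _ (ad_stab y)) comp_lfunA.
Qed.

Let kap_linear x : linear (kap x).
Proof.
move=> c y z; rewrite /killing scaler_sumr -big_split; apply: eq_bigr => i _ /=.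
by rewrite brDl brZl !brDr !brZr linearP.
Qed.

Variable hs : {vspace g}.
Hypothesis simpleK : simple_in br K.
Hypothesis cartanK : cartan_in br K hs.

Let hsK h : h \in hs -> h \in K.
Proof. by have [/subvP hs_K _ _ _] := cartanK; apply: hs_K. Qed.

Let kapDr x y z : kap x (y + z) = kap x y + kap x z.
Proof. by have := kap_linear x 1 y z; rewrite scale1r [1 *: _]mul1r. Qed.

Let kap0r x : kap x 0 = 0.
Proof. by apply: (addrI (kap x 0)); rewrite -kapDr !addr0. Qed.

Let kapZr c x y : kap x (c *: y) = c * kap x y.
Proof. by have := kap_linear x c y 0; rewrite kap0r !addr0. Qed.

Let kapNr x y : kap x (- y) = - kap x y.
Proof. by rewrite -scaleN1r kapZr mulN1r. Qed.

Let kapDl x y z : kap (x + y) z = kap x z + kap y z.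
Proof. by rewrite kapC kapDr !(kapC z). Qed.

Let kapZl c x y : kap (c *: x) y = c * kap x y.
Proof. by rewrite kapC kapZr kapC. Qed.

Let kapNl x y : kap (- x) y = - kap x y.
Proof. by rewrite kapC kapNr kapC. Qed.

Let kap_sumr x (I : finType) (y : I -> g) : kap x (\sum_i y i) = \sum_i kap x (y i).
Proof.
by apply: (big_morph (kap x) (kapDr x) (kap0r x)).
Qed.

(** By invariance the radical of the Killing form is an ideal, hence zero or everything; the vector
    [th] excludes the latter. *)
Let kap_nondeg th x : kap th th != 0 -> th \in K -> x \in K -> x != 0 ->
  exists2 y, y \in K & kap x y != 0.
Proof.
move=> th0 thK xK x0.
pose kf (y : g) : {linear g -> R[i]^o} :=
  HB.pack (kap y : g -> R[i]^o) (GRing.isLinear.Build _ _ _ _ _ (kap_linear y)).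
pose rad := (K :&: \bigcap_(i < \dim K) lker (linfun (kf (vbasis K)`_i)))%VS.
have radP z : z \in rad <-> z \in K /\ forall y, y \in K -> kap z y = 0.
  split=> [/memv_capP[zK /subv_bigcapP zr]|[zK zr]].
    split=> // y yK; rewrite (coord_vbasis yK) kap_sumr big1 // => i _.
    rewrite kapZr; have := zr i isT; rewrite -memvE memv_ker lfunE => /eqP.
    by rewrite [kf _ _]kapC => ->; rewrite mulr0.
  apply/memv_capP; split=> //; rewrite memvE; apply/subv_bigcapP => i _.
  by rewrite -memvE memv_ker lfunE /= kapC zr // vbasis_mem ?mem_nth ?size_tuple.
have rad_ideal : ideal_in br K rad.
  split; first exact: capvSl.
  move=> z y zK /radP[yK yr]; apply/radP; split; first exact: br_derived.
  by move=> u uK; rewrite brC kapNl kap_inv yr ?br_derived ?oppr0.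
have [_ /(_ _ rad_ideal)[rad0|radK]] := simpleK.
  apply: contrapT => no_y; case/negP: x0; rewrite -memv0 -rad0; apply/radP; split=> //.
  by move=> y yK; apply: contrapT => /eqP ny; apply: no_y; exists y.
by have := thK; rewrite -radK => /radP[_ /(_ th thK)] th00; rewrite th00 eqxx in th0.
Qed.

(** Weight space of [a] in the derived algebra, zero vector included; the weight is the linear form
    that [a] represents through the Killing form. *)
Let rs a x := x \in K /\ forall h, h \in hs -> br h x = kap a h *: x.

Let rs_br a b x y : rs a x -> rs b y -> rs (a + b) (br x y).
Proof.
move=> [xK xa] [yK yb]; split=> [|h hh]; first exact: br_derived.
by rewrite jacobi (xa h hh) (yb h hh) brZl brZr kapDl scalerDl.
Qed.

Let rs0 x : rs 0 x -> x \in hs.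
Proof.
have [_ _ sc _] := cartanK => -[xK xa]; apply: sc => // h hh.
by rewrite xa // kapC kap0r scale0r.
Qed.

Let hs_rs0 x : x \in hs -> rs 0 x.
Proof.
have [_ ab _ _] := cartanK => xh; split=> [|h hh]; first exact: hsK.
by rewrite ab // kapC kap0r scale0r.
Qed.

(** The component of [y] of weight [-a] is extracted for one element [h] of a Cartan basis at a
    time. As [ad h] is diagonalizable, the product of the factors [ad h - c] over the unwanted
    eigenvalues does it; invariance keeps the pairing with [x] nonzero, and commutativity preserves
    what was achieved for earlier elements. *)
Let weight_pair a x y : rs a x -> y \in K -> kap x y != 0 ->
  exists2 z, rs (- a) z & kap x z != 0.
Proof.
move=> [xK xa] yK xy0.
suff H (s : seq g) : {subset s <= hs} -> exists2 z, z \in K /\ kap x z != 0 &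
    forall h, h \in s -> br h z = kap (- a) h *: z.
  have [z [zK xz0] zs] := H (vbasis hs) (fun h hh => vbasis_mem hh).
  exists z => //; split=> // h hh; rewrite (coord_vbasis hh) brC.
  rewrite -adE linear_sum /= -sumrN kap_sumr scaler_suml; apply: eq_bigr => i _.
  rewrite linearZ /= adE -scalerN -brC zs ?mem_nth ?size_tuple //.
  by rewrite kapZr scalerA.
elim: s => [_|h s IHs shs]; first by exists y.
have [|z [zK xz0] zs] := IHs; first by move=> u us; apply: shs; rewrite inE us orbT.
have hh : h \in hs by apply: shs; rewrite inE eqxx.
have [_ ab _ /(_ h hh)[X [basX Xeig]]] := cartanK.
pose mu := kap (- a) h.
(* Paired with [x], the factor [ad h - c] becomes the scalar [mu - c], nonzero for every eigenvalue
   that gets removed. *)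
have step c u : u \in K -> kap x (br h u - c *: u) = (mu - c) * kap x u.
  move=> uK; rewrite kapDr kapNr kapZr -kap_inv brC kapNl xa // kapZl.
  by rewrite /mu kapNl mulrBl mulNr.
pose proj cs u := foldr (fun c v => br h v - c *: v) u cs.
have projK cs u : u \in K -> proj cs u \in K.
  by move=> uK; elim: cs => //= c cs IH; rewrite rpredB ?br_derived ?rpredZ.
have projx cs u : u \in K -> all (fun c => c != mu) cs -> kap x u != 0 ->
    kap x (proj cs u) != 0.
  move=> uK; elim: cs => //= c cs IH /andP[cmu /IH{}IH] /IH{}IH.
  by rewrite step ?projK // mulf_neq0 // subr_eq0 eq_sym.
have projD cs c u v : proj cs (c *: u + v) = c *: proj cs u + proj cs v.
  elim: cs => //= d cs ->; rewrite brDr brZr scalerDr scalerBr !scalerA (mulrC d).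
  by rewrite opprD addrACA.
have proj0 cs : proj cs 0 = 0.
  by elim: cs => //= d cs ->; rewrite br0r scaler0 subrr.
have proj_s cs u h' : h' \in s -> br h' u = kap (- a) h' *: u ->
    br h' (proj cs u) = kap (- a) h' *: proj cs u.
  move=> h's uh'; elim: cs => //= d cs IH.
  have h'h : br h' h = 0 by apply: ab => //; apply: shs; rewrite inE h's orbT.
  rewrite brDr brNr brZr jacobi h'h br0l add0r IH brZr scalerBr !scalerA.
  by rewrite (mulrC d).
have proj_eig cs u c : br h u = c *: u -> exists d, proj cs u = d *: u /\
    (c \in cs -> d = 0).
  move=> hu; elim: cs => /= [|d cs [e [-> IH]]]; first by exists 1; rewrite scale1r.
  exists ((c - d) * e); split.
    by rewrite brZr hu !scalerA -scalerBl (mulrC e) mulrBl.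
  by rewrite inE => /predU1P[->|/IH->]; rewrite ?subrr ?mul0r ?mulr0.
have [eig eigP] : exists eig : g -> R[i], forall u, u \in X -> br h u = eig u *: u.
  have H u : exists c, u \in X -> br h u = c *: u.
    have [/Xeig[c]|] := boolP (u \in X); first by exists c.
    by exists 0.
  by have /choice[eig] := H; exists eig.
pose cs := [seq c <- [seq eig u | u <- X] | c != mu].
exists (proj cs z).
  split; first exact: projK.
  by apply: projx => //; apply: filter_all.
move=> h'; rewrite inE => /predU1P[->|h's]; last by apply: proj_s => //; exact: zs.
rewrite -/mu; apply/eqP; rewrite -subr_eq0; apply/eqP.
have zX : z \in <<in_tuple X>>%VS by rewrite (span_basis basX).
(* A vector of the eigenbasis either has eigenvalue [mu] or is killed by the projection. *)
have killed u : u \in X -> br h (proj cs u) - mu *: proj cs u = 0.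
  move=> uX; have [d [-> dP]] := proj_eig cs _ _ (eigP u uX).
  rewrite brZr (eigP u uX) !scalerA -scalerBl.
  have [->|ne] := eqVneq (eig u) mu; first by rewrite mulrC subrr scale0r.
  by rewrite dP ?mul0r ?mulr0 ?subrr ?scale0r // mem_filter ne map_f.
rewrite (coord_span zX).
have H : forall v (r : seq 'I_(size X)),
    v = \sum_(i <- r) coord (in_tuple X) i z *: (in_tuple X)`_i ->
    br h (proj cs v) - mu *: proj cs v = 0.
  move=> v r; elim: r v => [|i r IH] v ->.
    by rewrite big_nil proj0 br0r scaler0 subrr.
  rewrite big_cons projD brDr brZr scalerDr !scalerA (mulrC mu) -scalerA.
  rewrite opprD addrACA -scalerBr killed ?mem_nth // scaler0 add0r.
  exact: IH.
by apply: H.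
Qed.

(** Weight zero case of [weight_pair]: the zero weight space is the Cartan subalgebra, which is its
    own centralizer. *)
Let hs_nondeg th a : kap th th != 0 -> th \in K -> a \in hs -> a != 0 ->
  exists2 h, h \in hs & kap a h != 0.
Proof.
move=> th0 thK ah a0; have [y yK ay0] := kap_nondeg th0 thK (hsK ah) a0.
have [z] := weight_pair (hs_rs0 ah) yK ay0; rewrite oppr0 => /rs0 zh az.
by exists z.
Qed.

Local Notation roots := (lie_root br K hs).

Hypothesis roots_pos : forall a, roots a -> 0 < kap a a.

Let root_hs_nondeg r a : roots r -> a \in hs -> a != 0 ->
  exists2 h, h \in hs & kap a h != 0.
Proof.
move=> rr; apply: (@hs_nondeg r); first by rewrite gt_eqF ?roots_pos.
by case: rr => [/hsK].
Qed.

(** The difference of the two sides has weight zero, hence lies in the Cartan subalgebra; by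
    invariance it is orthogonal to that subalgebra, on which the form is nondegenerate. *)
Let br_opp a e f : roots a -> rs a e -> rs (- a) f -> br e f = kap e f *: a.
Proof.
move=> ra re rf; have [ah a0 _] := ra.
apply/eqP; rewrite -subr_eq0; apply: contrapT => /negP d0.
have efh : br e f \in hs by apply: rs0; rewrite -(subrr a); exact: rs_br.
have [|h hh] := root_hs_nondeg ra _ d0; first by rewrite rpredB ?rpredZ.
rewrite kapDl kapNl kapZl kap_inv brC (proj2 rf) // kapNl scaleNr opprK kapZr.
by rewrite mulrC subrr eqxx.
Qed.

(** With [br_opp] this normalization makes the bracket of [e] and [f] equal to [a]: a copy of sl2 up
    to rescaling. *)
Let sl2 a e : roots a -> rs a e -> e != 0 ->
  exists2 f, rs (- a) f & kap e f = 1.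
Proof.
move=> ra re e0; have [ah a0 _] := ra.
have [|y yK ey0] := kap_nondeg _ (hsK ah) (proj1 re) e0.
  by rewrite gt_eqF ?roots_pos.
have [z [zK za] ez] := weight_pair re yK ey0.
exists ((kap e z)^-1 *: z); last by rewrite kapZr mulVf.
split=> [|h hh]; first by rewrite rpredZ.
by rewrite brZr za // !scalerA mulrC.
Qed.

Let root_opp a : roots a -> roots (- a).
Proof.
move=> ra; have [ah a0 [e [eK e0 ea]]] := ra; split; rewrite ?rpredN ?oppr_eq0 //.
have [f [fK fa] ef] := sl2 ra (conj eK ea) e0; exists f; split=> //.
by apply: contra_eq_neq ef => ->; rewrite kap0r eq_sym oner_eq0.
Qed.

Let rs_neq0 a x : a \in hs -> a != 0 -> rs a x -> x != 0 -> roots a.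
Proof. by move=> ah a0 [xK xa] x0; split=> //; exists x. Qed.

Let rsD a x y c : rs a x -> rs a y -> rs a (c *: x + y).
Proof.
move=> [xK xa] [yK ya]; split=> [|h hh]; first by rewrite rpredD ?rpredZ.
by rewrite brDr brZr xa // ya // scalerDr !scalerA mulrC.
Qed.

Let rs_iter a b e x j : rs a e -> rs b x -> rs (b + a *+ j) (iter j (br e) x).
Proof.
move=> ea bx; elim: j => [|j IH]; first by rewrite addr0.
by rewrite mulrSr addrA addrC /=; exact: rs_br.
Qed.

Let kap_muln a b c j : kap (b + a *+ j) c = kap b c + kap a c *+ j.
Proof.
rewrite kapDl; congr (_ + _).
by elim: j => [|j IH]; [rewrite !mulr0n kapC kap0r|rewrite !mulrS kapDl IH].
Qed.

(** Nonzero members of the string are eigenvectors of [ad a] whose eigenvalues increase by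
    [kap a a > 0] at each step; a finite dimension has room for finitely many. *)
Let string_stops a b (x : nat -> g) : roots a ->
  (forall j, rs (b + a *+ j) (x j)) -> exists j, x j == 0.
Proof.
move=> ra rx; apply: contrapT => nx.
have {}nx j : x j != 0 by apply/negP => xj; apply: nx; exists j.
have freeX : free (mktuple (fun i : 'I_(\dim {:g}).+1 => x i)).
  apply: (@weight_free _ _ unit (fun=> True) (fun=> ad a) _ x
    (fun j _ => kap (b + a *+ j) a)) => [//|i [] _ _|i j /andP[ij _]].
    by rewrite adE (proj2 (rx i)) //; case: ra.
  exists tt => //; rewrite !kap_muln (inj_eq (addrI _)) -subr_eq0.
  rewrite -opprB oppr_eq0 -mulrnBr 1?ltnW // mulrn_eq0 subn_eq0 leqNgt ij /=.
  by rewrite gt_eqF ?roots_pos.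
by have := free_size_bound freeX; rewrite ltnn.
Qed.

(** Were [x] nonzero, the powers of [ad e] applied to it would span a finite dimensional space
    stable under [ad e] and [ad f]. On it the commutator acts as [ad a], with positive eigenvalues
    only, although its trace is zero. *)
Let lowest_weight a e f b x : roots a -> rs a e -> rs (- a) f -> kap e f = 1 ->
  rs b x -> 0 < kap b a -> br f x = 0 -> x = 0.
Proof.
move=> ra re rf ef rx ba fx; have [ah _ _] := ra.
pose X j := iter j (br e) x.
have rX j : rs (b + a *+ j) (X j) by exact: rs_iter.
have Xa j : br a (X j) = (kap b a + kap a a *+ j) *: X j.
  by rewrite (proj2 (rX j)) // kap_muln.
(* [q.+1] is the least exponent that kills [x]; the alternative [x = 0] absorbs the case where this
   exponent would be zero. *)
have [q [Xq Xq0]] : exists q, X q.+1 == 0 /\ forall i, (i < q.+1)%N -> X i != 0 \/ x = 0.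
  have exj := string_stops ra rX; case: (ex_minnP exj) => -[|q] Xq minq.
    exists 0%N; split; last by right; apply/eqP.
    by rewrite /X /= (eqP Xq : x = 0) br0r.
  exists q; split=> // i iq; left; apply/negP => /minq.
  by rewrite leqNgt iq.
apply: contrapT => x0.
have {}Xq0 i : (i < q.+1)%N -> X i != 0 by move=> /Xq0[].
have br_ef u : br e (br f u) - br f (br e u) = br a u.
  by rewrite jacobi (br_opp ra re rf) ef scale1r addrK.
have fX j : exists c, br f (X j.+1) = c *: X j.
  elim: j => [|j [c IH]].
    have := br_ef x; rewrite fx br0r add0r => /eqP; rewrite eqr_oppLR => /eqP ->.
    by rewrite (Xa 0%N) -scaleNr; exists (- (kap b a + kap a a *+ 0)).
  have /eqP := br_ef (X j.+1); rewrite IH brZr subr_eq addrC -subr_eq => /eqP <-.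
  by rewrite Xa -scalerBl; exists (c - (kap b a + kap a a *+ j.+1)).
pose T := mktuple (fun i : 'I_q.+1 => X i).
have TE (i : 'I_q.+1) : T`_i = X i by rewrite -tnth_nth tnth_mktuple.
have XT i : (i < q.+1)%N -> X i \in <<T>>%VS.
  by move=> iq; rewrite -(TE (Ordinal iq)) memv_span ?mem_nth ?size_tuple.
have freeT : free T.
  apply: (@weight_free _ _ g (fun h => h = a) ad _ _ (fun j h => kap (b + a *+ j) h)) => //.
    by move=> i h _ ->; rewrite adE Xa kap_muln.
  move=> i j /andP[ij _]; exists a => //.
  rewrite !kap_muln (inj_eq (addrI _)) -subr_eq0.
  rewrite -opprB oppr_eq0 -mulrnBr 1?ltnW // mulrn_eq0 subn_eq0 leqNgt ij /=.
  by rewrite gt_eqF ?roots_pos.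
have sum0 : \sum_(i < q.+1) (kap b a + kap a a *+ i) = 0.
  apply: (@sum_commutator_eigenvalues _ _ _ T (ad e) (ad f) _ freeT) => i.
- rewrite TE adE -[br e _]/(X i.+1); have := ltn_ord i; rewrite leq_eqVlt.
  move=> /predU1P[[->]|iq]; first by rewrite (eqP Xq) mem0v.
  exact: XT.
- rewrite TE adE; case: i => -[|i] iq /=; first by rewrite fx mem0v.
  by have [c ->] := fX i; rewrite rpredZ // XT // ltnW.
- by rewrite TE !adE br_ef Xa.
move/eqP: sum0; apply/negP; rewrite gt_eqF // big_ord_recl /= mulr0n addr0 ltr_wpDr //.
apply: sumr_ge0 => i _; rewrite addr_ge0 // ?ltW // pmulrn_lgt0 //.
exact: roots_pos.
Qed.

Let orth_lowest a f x : roots a -> rs (- a) f -> rs a x -> kap x f = 0 ->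
  br f x = 0.
Proof.
by move=> ra rf rx xf; rewrite brC (br_opp ra rx rf) xf scale0r oppr0.
Qed.

(** Subtracting the right multiple of [e] makes [x] orthogonal to [f], hence killed by [ad f], and
    [lowest_weight] applies. *)
Let root_space_line a e x : roots a -> rs a e -> e != 0 -> rs a x ->
  exists c, x = c *: e.
Proof.
move=> ra re e0 rx; have [f rf ef] := sl2 ra re e0.
exists (kap x f); apply/eqP; rewrite -subr_eq0; apply/eqP.
have rx' : rs a (x - kap x f *: e) by rewrite addrC -scaleNr; apply: rsD.
apply: (lowest_weight ra re rf ef rx'); first exact: roots_pos.
apply: (orth_lowest ra rf rx').
by rewrite kapDl kapNl kapZl ef mulr1 subrr.
Qed.

(** [ad f] lowers the multiple by one, so the case of [2a] starts an induction. There [br f x] has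
    weight [a] and pairs to zero with [f], because the bracket of [f] with itself vanishes;
    [lowest_weight] kills first [br f x], then [x]. *)
Let root_multiple_space a n x : roots a -> rs (a *+ n.+2) x -> x = 0.
Proof.
move=> ra; have [ah a0 [e [eK e0 ea]]] := ra.
have [f rf ef] := sl2 ra (conj eK ea) e0.
have br_sub b y : rs (b + a) y -> rs b (br f y).
  by move=> ry; rewrite -[b](addrK a) addrC; apply: rs_br.
have pos m : 0 < kap (a *+ m.+1) a.
  by have := kap_muln a 0 a m.+1; rewrite add0r => ->; rewrite kapC kap0r add0r pmulrn_lgt0 // roots_pos.
elim: n x => [|n IHn] x rx; apply: (lowest_weight ra (conj eK ea) rf ef rx (pos _)).
  have rfx : rs a (br f x) by apply: br_sub; rewrite -mulr2n.
  apply: (lowest_weight ra (conj eK ea) rf ef rfx (pos 0%N)).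
  apply: (orth_lowest ra rf rfx).
  by have [_ _ br_alt _] := lie_br; rewrite brC kapNl kap_inv br_alt kap0r oppr0.
by apply: IHn; apply: br_sub; rewrite -mulrSr.
Qed.

Lemma root_multiple a n : roots a -> roots (a *+ n.+2) -> False.
Proof.
move=> ra [_ _ [x [xK x0 xa]]]; case/eqP: x0.
exact: (root_multiple_space ra (conj xK xa)).
Qed.

Let string_end a b : roots a -> roots b -> exists q,
  (forall i, (i <= q)%N -> exists2 x, rs (b + a *+ i) x & x != 0) /\
  forall x, rs (b + a *+ q.+1) x -> x = 0.
Proof.
move=> ra [_ _ [x0 [x0K x00 x0b]]].
pose P i := `[< exists2 x, rs (b + a *+ i) x & x != 0 >].
have exn : exists i, ~~ P i.
  apply: contrapT => nP.
  have {}nP i : exists x, rs (b + a *+ i) x /\ x != 0.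
    have /asboolP[x] : P i by apply: contrapT => /negP ?; apply: nP; exists i.
    by exists x.
  have [x xP] := choice nP.
  have [j] := string_stops ra (fun j => (xP j).1).
  by apply/negP; case: (xP j).
case: (ex_minnP exn) => -[/asboolP[]|q nPq minq]; first by exists x0; rewrite ?addr0.
exists q; split=> [i iq|x rx].
  by apply/asboolP; apply: contraT => /minq; rewrite ltnNge iq.
by apply: contrapT => /eqP x00'; move/asboolP: nPq; apply; exists x.
Qed.

Let rs_eq a b x : a = b -> rs a x -> rs b x.
Proof. by move->. Qed.

(** The only obstruction is weight zero, which would make [b] an integral multiple of [a];
    [root_multiple] and the hypotheses on [b] exclude that. *)
Let weight_root a b x : roots a -> roots b -> b <> a -> b <> - a ->
  forall j : int, rs (b + a *~ j) x -> x != 0 -> roots (b + a *~ j).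
Proof.
move=> ra rb ba bNa j rx x0; have [ah _ _] := ra; have [bh b0 _] := rb.
apply: rs_neq0 rx x0; first by rewrite rpredD ?rpredMz.
apply/negP; rewrite addr_eq0 => /eqP bE; case: j bE => [[|[|n]]|[|n]].
- by rewrite mulr0z oppr0 => b00; rewrite b00 eqxx in b0.
- by move=> /bNa.
- by rewrite -pmulrn -mulNrn => bE; apply: (@root_multiple (- a) n);
    [exact: root_opp|rewrite -bE].
- by rewrite NegzE mulrNz opprK => /ba.
- by rewrite NegzE mulrNz opprK -pmulrn => bE; apply: (@root_multiple a n) => //; rewrite -bE.
Qed.

Let sum_arith (x y : R[i]) p n :
  2%:R * \sum_(i < n) (x + (i%:R - p) * y) = n%:R * (2%:R * x + (n%:R - 1 - 2%:R * p) * y).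
Proof.
elim: n => [|n IHn]; first by rewrite big_ord0 mulr0 mul0r.
rewrite big_ord_recr /= mulrDr IHn -natr1; ring.
Qed.

(** The weight spaces of the string from [b - p a] to [b + q a] are lines, and their sum is stable
    under [ad e] and [ad f]. The eigenvalues of [ad a] on it form an arithmetic progression of sum
    zero, which gives the Cartan integer [p - q]. The cases [b = a] and [b = -a], whose strings meet
    weight zero, are treated apart. *)
Lemma root_reflection a b : roots a -> roots b -> exists m : int,
  2%:R * kap b a = m%:~R * kap a a /\ roots (b - a *~ m).
Proof.
move=> ra rb; have [ba|/eqP ba] := eqVneq b a.
  exists 2%N; split; first by rewrite ba.
  by rewrite ba -pmulrn mulr2n opprD addrA subrr add0r; apply: root_opp.
have [bNa|/eqP bNa] := eqVneq b (- a).
  exists (- 2%N%:Z); rewrite bNa; split; first by rewrite kapNl mulrN mulrNz mulNr.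
  by rewrite mulrNz opprK -pmulrn mulr2n addrA addNr add0r.
have rNa := root_opp ra.
have [q [qP qend]] := string_end ra rb; have [p [pP pend]] := string_end rNa rb.
pose w (i : nat) := b + a *~ (i%:Z - p%:Z).
have wa i : kap (w i) a = kap b a + (i%:R - p%:R) * kap a a.
  rewrite /w kapDl; congr (_ + _); rewrite -scaler_int kapZl.
  by rewrite intrB.
have wS i : w i + a = w i.+1.
  by rewrite /w -addrA -[in X in _ + X](mulr1z a) -mulrzDr; congr (_ + _ *~ _); lia.
have wP i : (i < (p + q).+1)%N -> exists x, rs (w i) x /\ x != 0.
  move=> iN; case: (leqP i p) => ip.
    have [|x rx x0] := pP (p - i)%N; first by rewrite leq_subr.
    exists x; split=> //; apply: rs_eq rx; rewrite /w; congr (_ + _).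
    by rewrite mulNrn pmulrn -mulrNz; congr (_ *~ _); lia.
  have [|x rx x0] := qP (i - p)%N; first by lia.
  exists x; split=> //; apply: rs_eq rx; rewrite /w; congr (_ + _).
  by rewrite pmulrn; congr (_ *~ _); lia.
have wnz i : exists x, (i < (p + q).+1)%N -> rs (w i) x /\ x != 0.
  by case: (ltnP i (p + q).+1) => [/wP[x xP]|_]; [exists x|exists 0].
have [z zP] := choice wnz.
have rw i : (i < (p + q).+1)%N -> roots (w i).
  by move=> /zP[rz z0]; apply: weight_root rz z0.
have [_ _ [e [eK e0 ea]]] := ra; have re : rs a e by [].
have [f rf ef] := sl2 ra re e0.
have br_ef u : br e (br f u) - br f (br e u) = br a u.
  by rewrite jacobi (br_opp ra re rf) ef scale1r addrK.
have za i : (i < (p + q).+1)%N ->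
    br a (z i) = (kap b a + (i%:R - p%:R) * kap a a) *: z i.
  by move=> /zP[[_ ->]]; [rewrite wa|case: ra].
pose T := mktuple (fun i : 'I_(p + q).+1 => z i).
have TE (i : 'I_(p + q).+1) : T`_i = z i by rewrite -tnth_nth tnth_mktuple.
have zT i c : (i < (p + q).+1)%N -> c *: z i \in <<T>>%VS.
  move=> iq; rewrite rpredZ // -(TE (Ordinal iq)) memv_span //.
  by rewrite mem_nth ?size_tuple.
have line i x : (i < (p + q).+1)%N -> rs (w i) x -> x \in <<T>>%VS.
  move=> iN rx; have [rz z0] := zP i iN.
  by have [c ->] := root_space_line (rw i iN) rz z0 rx; exact: zT.
have freeT : free T.
  apply: (@weight_free _ _ unit (fun=> True) (fun=> ad a) _ z
    (fun j _ => kap b a + (j%:R - p%:R) * kap a a)) => [i iN|i [] iN _|i j /andP[ij _]].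
  - by have [] := zP i iN.
  - by rewrite adE za.
  exists tt => //; rewrite (inj_eq (addrI _)) (inj_eq (mulIf _)).
    by rewrite (inj_eq (addIr _)) eqr_nat neq_ltn ij.
  by rewrite gt_eqF ?roots_pos.
have sum0 : \sum_(i < (p + q).+1) (kap b a + (i%:R - p%:R) * kap a a) = 0.
  apply: (@sum_commutator_eigenvalues _ _ _ T (ad e) (ad f) _ freeT) => i.
  - rewrite TE adE; have [rz _] := zP i (ltn_ord i).
    have rez : rs (w i.+1) (br e (z i)) by rewrite -wS addrC; apply: rs_br.
    have := ltn_ord i; rewrite leq_eqVlt => /predU1P[[iN]|iN].
      rewrite (qend (br e (z i))) ?mem0v //; apply: rs_eq rez.
      by rewrite /w pmulrn; congr (_ + _ *~ _); lia.
    exact: line rez.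
  - rewrite TE adE; have [rz _] := zP i (ltn_ord i).
    have rfz : rs (w i - a) (br f (z i)) by rewrite addrC; apply: rs_br.
    case: i rz rfz => -[|i] iN /= rz rfz.
      rewrite (pend (br f (z 0%N))) ?mem0v //; apply: rs_eq rfz.
      by rewrite /w sub0r mulrNz mulNrn mulrSr opprD addrA.
    by apply: (@line i); [exact: ltnW|rewrite -(addrK a (w i)) wS].
  - by rewrite TE !adE br_ef za.
have Nba : 2%:R * kap b a = (p%:Z - q%:Z)%:~R * kap a a.
  have := sum_arith (kap b a) (kap a a) p%:R (p + q).+1.
  rewrite sum0 mulr0 => /esym/eqP; rewrite mulf_eq0 pnatr_eq0 /= => /eqP.
  rewrite -(natr1 (p + q)%N) natrD intrB => h; apply/eqP; rewrite -subr_eq0; apply/eqP.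
  by rewrite -[RHS]h; ring.
exists (p%:Z - q%:Z); split=> //.
(* [b] is the member of index [p] of the string, and its reflection is the member of index [q]. *)
have := rw q; rewrite /w -mulrNz opprB; apply.
by rewrite ltnS leq_addl.
Qed.

(** Distinct roots are separated by some element of the Cartan subalgebra, so their root vectors are
    independent and the dimension of [g] bounds their number. *)
Lemma finite_lie_roots : finite_set roots.
Proof.
apply: contrapT => /(infinite_set_fset (\dim {:g}).+1)[B Broots sB].
pose a i := nth 0 B i.
have ra i : (i < (\dim {:g}).+1)%N -> roots (a i).
  by move=> iN; apply: Broots; rewrite /= mem_nth // (leq_trans iN).
have wnz i : exists x, (i < (\dim {:g}).+1)%N -> rs (a i) x /\ x != 0.
  case: (ltnP i (\dim {:g}).+1) => [/ra[_ _ [x [xK x0 xa]]]|_]; last by exists 0.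
  by exists x.
have [z zP] := choice wnz.
suff /free_size_bound : free (mktuple (fun i : 'I_(\dim {:g}).+1 => z i)).
  by rewrite ltnn.
apply: (@weight_free _ _ g (fun h => h \in hs) ad _ z (fun j h => kap (a j) h)).
- by move=> i /zP[].
- by move=> i h /zP[[_ zi] _] hh; rewrite adE zi.
move=> i j /andP[ij jN]; have iN := ltn_trans ij jN.
have [aih _ _] := ra i iN; have [ajh _ _] := ra j jN.
have aij : a i - a j != 0.
  rewrite subr_eq0 /a nth_uniq ?fset_uniq ?(leq_trans iN) ?(leq_trans jN) //.
  by rewrite neq_ltn ij.
have [|h hh] := root_hs_nondeg (ra i iN) _ aij; first by rewrite rpredB.
by rewrite kapDl kapNl subr_eq0; exists h.
Qed.

End LieRoots.

(** * Bilinear forms and abstract root systems *)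

Section FormTheory.

Variables (K : fieldType) (l : nat) (S : 'M[K]_l).

Lemma formDl u v w : form S (u + v) w = form S u w + form S v w.
Proof. by rewrite /Defs.form linearD /= !mulmxDl mxE. Qed.

Lemma formDr u v w : form S w (u + v) = form S w u + form S w v.
Proof. by rewrite /Defs.form !mulmxDr mxE. Qed.

Lemma formZl c u w : form S (c *: u) w = c * form S u w.
Proof. by rewrite /Defs.form linearZ /= -!scalemxAl mxE. Qed.

Lemma formZr c u w : form S w (c *: u) = c * form S w u.
Proof. by rewrite /Defs.form -!scalemxAr mxE. Qed.

Lemma formNl u w : form S (- u) w = - form S u w.
Proof. by rewrite -scaleN1r formZl mulN1r. Qed.

Lemma formNr u w : form S w (- u) = - form S w u.
Proof. by rewrite -scaleN1r formZr mulN1r. Qed.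

Lemma formC u v : S^T = S -> form S u v = form S v u.
Proof.
move=> symS; rewrite /Defs.form -[LHS]trace_mx11 -mxtrace_tr !trmx_mul symS trmxK.
by rewrite trace_mx11 mulmxA.
Qed.

End FormTheory.

(** All that the affine part of the proof retains of the Lie algebra. The Cartan integer is a
    witness, so that integrality and stability under reflections come together without division; the
    last field is reducedness. *)
Record root_system (R : realType) (l : nat) (S : 'M[R]_l)
    (Phi : set 'cV[R]_l) : Prop := RootSystem {
  rs_sym : S^T = S;
  rs_pos : forall u, u != 0 -> 0 < form S u u;
  rs_finite : finite_set Phi;
  rs_neq0 : forall a, Phi a -> a != 0;
  rs_refl : forall a b, Phi a -> Phi b -> exists m : int,
    2%:R * form S b a = m%:~R * form S a a /\ Phi (b - a *~ m);
  rs_multiple : forall a n, Phi a -> ~ Phi (a *+ n.+2) }.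

(** * The roots of a root datum in real coordinates *)

Section FiniteRoots.

Variables (R : realType) (g : vectType R[i]) (br : g -> g -> g).
Variables (hs : {vspace g}) (V' : set g) (l : nat) (b : l.-tuple g).
Variable (S : 'M[R]_l).
Hypothesis rd : root_datum br hs V' b S.

Let embedD u v : embed b (u + v) = embed b u + embed b v.
Proof.
rewrite /embed -big_split; apply: eq_bigr => i _ /=.
by rewrite mxE raddfD scalerDl.
Qed.

Let embed0 : embed b 0 = 0.
Proof. by apply: (addrI (embed b 0)); rewrite -embedD !addr0. Qed.

Let embedN u : embed b (- u) = - embed b u.
Proof. by apply/eqP; rewrite -addr_eq0 -embedD addNr embed0. Qed.

Let embedMn u n : embed b (u *+ n) = embed b u *+ n.
Proof. by elim: n => [|n IHn]; rewrite ?mulr0n // !mulrS embedD IHn. Qed.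

Let embedMz u m : embed b (u *~ m) = embed b u *~ m.
Proof. by case: m => n; rewrite ?NegzE ?mulrNz ?embedN -!pmulrn embedMn. Qed.

Let embed_inj : injective (embed b).
Proof.
have freeb : free b by have /basis_free := rd_basis rd.
move=> u v; move/eqP; rewrite -subr_eq0 -embedN -embedD => /eqP uv0.
apply/eqP; rewrite -subr_eq0; apply/eqP/colP => i; rewrite mxE.
have /freeP/(_ (fun i => ((u - v) i 0)%:C) uv0 i) := freeb.
by rewrite !mxE => /complexI.
Qed.

Local Notation kap := (killing br (derived br)).
Local Notation roots := (lie_root br (derived br) hs).
Local Notation Phi := (finite_roots br hs b).

Let Vs_root a : roots a -> Vs br hs a.
Proof.
move=> ra; exists 1%N, (fun=> 1), (fun=> a); split=> //.
by rewrite big_ord1 scale1r.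
Qed.

Let root_embed a : roots a -> exists u, a = embed b u.
Proof.
move=> ra; have : real_span [set` b] a.
  rewrite (rd_realform rd); exists a; first exact: Vs_root.
  exists 0; last by rewrite addr0.
  have [X _ ->] := rd_center rd.
  by exists 0%N, (fun=> 0), (fun=> 0); rewrite big_ord0; split=> // -[].
case=> n [r [y [yb ->]]]; elim: n r y yb => [|n IHn] r y yb.
  by exists 0; rewrite big_ord0 embed0.
rewrite big_ord_recl; have [|u ->] := IHn (fun i => r (lift ord0 i)) (fun i => y (lift ord0 i)).
  by move=> i; apply: yb.
have /(nthP 0)[j jb <-] : y ord0 \in b by apply: yb.
rewrite size_tuple in jb.
exists (r ord0 *: delta_mx (Ordinal jb) 0 + u); rewrite embedD; congr (_ + _).
rewrite /embed (bigD1 (Ordinal jb)) //= big1 => [|i /negPf ij].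
  by rewrite !mxE !eqxx mulr1 addr0.
by rewrite !mxE ij mulr0 scale0r.
Qed.

Let killing_form u v : roots (embed b u) -> roots (embed b v) ->
  kap (embed b u) (embed b v) = (form S u v)%:C.
Proof. by move=> ru rv; have [_ _ -> //] := rd_form rd; exact: Vs_root. Qed.

(** Positivity is transferred from the scalar product to the Killing form; it is the hypothesis
    under which the root spaces were studied. *)
Let roots_pos a : roots a -> 0 < kap a a.
Proof.
move=> ra; have [u aE] := root_embed ra; rewrite aE in ra *.
rewrite killing_form // ltcR; have [_ + _ _] := rd_form rd; apply.
by case: ra => _ + _; apply: contra_neq => ->; rewrite embed0.
Qed.

Lemma finite_roots_system : root_system S Phi.
Proof.
have lie := rd_bracket rd; have simp := rd_simple rd; have cart := rd_cartan rd.
have [symS posS _ _] := rd_form rd.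
split=> //.
- apply: (@finite_preimage _ _ roots (embed b)).
    by move=> u v _ _; apply: embed_inj.
  exact: (finite_lie_roots lie simp cart roots_pos).
- by move=> a [_ a0 _]; apply: contra_neq a0 => ->; rewrite embed0.
- move=> u v ru rv; have [m [E rm]] := root_reflection lie simp cart roots_pos ru rv.
  exists m; split; last by rewrite /finite_roots /= embedD embedN embedMz.
  move: E; rewrite !killing_form // => E; apply: complexI.
  by rewrite !rmorphM /= rmorph_int rmorph_nat.
- move=> u n ru; rewrite /finite_roots /= embedMn.
  exact: (root_multiple lie simp cart roots_pos ru).
Qed.

End FiniteRoots.

(** * The affine extension: coordinates, reflections and translations *)

Section HatTheory.

Variables (K : fieldType) (l : nat) (S : 'M[K]_l).
Implicit Types (x y a : 'cV[K]_l.+2).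

Lemma cpart_hat v e t : cpart (hat v e t : 'cV[K]_l.+2) = e.
Proof. by rewrite /cpart /hat col_mxKu mxE eqxx mulr1n. Qed.

Lemma dpart_hat v e t : dpart (hat v e t : 'cV[K]_l.+2) = t.
Proof. by rewrite /dpart /hat col_mxKd col_mxKu mxE eqxx mulr1n. Qed.

Lemma hpart_hat v e t : hpart (hat v e t : 'cV[K]_l.+2) = v.
Proof. by rewrite /hpart /hat !col_mxKd. Qed.

Lemma hatK x : hat (hpart x) (cpart x) (dpart x) = x.
Proof.
rewrite /hat /hpart /cpart /dpart -!mx11_scalar.
by rewrite (vsubmxK (dsubmx (x : 'cV_(1 + l.+1)) : 'cV_(1 + l))) vsubmxK.
Qed.

Lemma hat_inj v e t v' e' t' :
  hat v e t = hat v' e' t' :> 'cV[K]_l.+2 -> [/\ v = v', e = e' & t = t'].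
Proof.
move=> E; split.
- by rewrite -(hpart_hat v e t) E hpart_hat.
- by rewrite -(cpart_hat v e t) E cpart_hat.
- by rewrite -(dpart_hat v e t) E dpart_hat.
Qed.

Lemma cpartP c x y : cpart (c *: x + y) = c * cpart x + cpart y.
Proof. by rewrite /cpart !mxE. Qed.

Lemma cpartN x : cpart (- x) = - cpart x.
Proof. by rewrite /cpart !mxE. Qed.

Lemma dpartP c x y : dpart (c *: x + y) = c * dpart x + dpart y.
Proof. by rewrite /dpart !mxE. Qed.

Lemma hpartP c x y : hpart (c *: x + y) = c *: hpart x + hpart y.
Proof. by rewrite /hpart !linearP. Qed.

Lemma hatP c v e t v' e' t' :
  hat (c *: v + v') (c * e + e') (c * t + t') =
  c *: hat v e t + hat v' e' t' :> 'cV[K]_l.+2.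
Proof.
by rewrite -[RHS]hatK hpartP cpartP dpartP !hpart_hat !cpart_hat !dpart_hat.
Qed.

Lemma hatD v e t v' e' t' :
  hat v e t + hat v' e' t' = hat (v + v') (e + e') (t + t') :> 'cV[K]_l.+2.
Proof. by rewrite -[hat v e t]scale1r -hatP scale1r !mul1r. Qed.

Lemma hat0 : hat 0 0 0 = 0 :> 'cV[K]_l.+2.
Proof. by apply: (addrI (hat 0 0 0)); rewrite hatD !addr0. Qed.

Lemma hatZ c v e t : c *: hat v e t = hat (c *: v) (c * e) (c * t) :> 'cV[K]_l.+2.
Proof. by rewrite -[LHS]addr0 -{1}hat0 -hatP !addr0. Qed.

Lemma hatN v e t : - hat v e t = hat (- v) (- e) (- t) :> 'cV[K]_l.+2.
Proof. by rewrite -!scaleN1r hatZ !mulN1r. Qed.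

Lemma hat_muln v e t n : hat v e t *+ n = hat (v *+ n) (e *+ n) (t *+ n) :> 'cV[K]_l.+2.
Proof. by rewrite -!scaler_nat hatZ !mulr_natl. Qed.

Lemma hformPl c x y z : hform S (c *: x + y) z = c * hform S x z + hform S y z.
Proof. by rewrite /hform hpartP cpartP dpartP formDl formZl; ring. Qed.

Lemma hformPr c x y z : hform S z (c *: x + y) = c * hform S z x + hform S z y.
Proof. by rewrite /hform hpartP cpartP dpartP formDr formZr; ring. Qed.

Lemma hformDl x y z : hform S (x + y) z = hform S x z + hform S y z.
Proof. by have := hformPl 1 x y z; rewrite scale1r mul1r. Qed.

Lemma hformDr x y z : hform S z (x + y) = hform S z x + hform S z y.
Proof. by have := hformPr 1 x y z; rewrite scale1r mul1r. Qed.

Lemma hform0l z : hform S 0 z = 0.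
Proof. by apply: (addrI (hform S 0 z)); rewrite -hformDl !addr0. Qed.

Lemma hform0r z : hform S z 0 = 0.
Proof. by apply: (addrI (hform S z 0)); rewrite -hformDr !addr0. Qed.

Lemma hformZl c x z : hform S (c *: x) z = c * hform S x z.
Proof. by have := hformPl c x 0 z; rewrite hform0l !addr0. Qed.

Lemma hformZr c x z : hform S z (c *: x) = c * hform S z x.
Proof. by have := hformPr c x 0 z; rewrite hform0r !addr0. Qed.

Lemma hformNl x z : hform S (- x) z = - hform S x z.
Proof. by rewrite -scaleN1r hformZl mulN1r. Qed.

Lemma hformNr x z : hform S z (- x) = - hform S z x.
Proof. by rewrite -scaleN1r hformZr mulN1r. Qed.

Lemma hformC x y : S^T = S -> hform S x y = hform S y x.
Proof. by move=> symS; rewrite /hform (formC _ _ symS); ring. Qed.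

Lemma hform_hat v e t v' e' t' :
  hform S (hat v e t) (hat v' e' t') = form S v v' + e * t' + t * e'.
Proof. by rewrite /hform !hpart_hat !cpart_hat !dpart_hat. Qed.

Lemma refl_linear a : linear (refl S a).
Proof.
move=> c x y; rewrite /refl hformPl scalerDl scalerBr -scalerA opprD.
by rewrite addrACA.
Qed.

Lemma reflE a x : refl S a x = x - (2%:R / hform S a a * hform S x a) *: a.
Proof. by rewrite /refl hformZr. Qed.

Lemma refl_hform a x y : S^T = S -> hform S a a != 0 ->
  hform S (refl S a x) (refl S a y) = hform S x y.
Proof.
move=> symS a0; rewrite !reflE !(hformDl, hformDr, hformNl, hformNr, hformZl, hformZr).
by rewrite (hformC a y symS); field.
Qed.

Lemma reflK a x : hform S a a != 0 -> refl S a (refl S a x) = x.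
Proof.
move=> a0; rewrite [in LHS]reflE [in LHS](reflE a x).
rewrite hformDl hformNl hformZl -addrA -opprD -scalerDl.
rewrite [X in X *: a](_ : _ = 0) ?scale0r ?subr0 //.
by field.
Qed.

Lemma reflN a x : refl S (- a) x = refl S a x.
Proof. by rewrite !reflE !(hformNl, hformNr) opprK mulrN scaleNr scalerN opprK. Qed.

Lemma refl_self a : hform S a a != 0 -> refl S a a = - a.
Proof.
move=> a0; rewrite reflE mulfVK // scalerDl scale1r opprD addrA subrr sub0r.
by [].
Qed.

Lemma mx_ofE n (f : 'cV[K]_n -> 'cV[K]_n) (x : 'cV[K]_n) : linear f -> mx_of f *m x = f x.
Proof.
move=> linf; pose L : {linear _ -> _} := HB.pack f (GRing.isLinear.Build _ _ _ _ f linf).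
have -> : f x = \sum_j x j 0 *: L (delta_mx j 0).
  rewrite [in LHS](matrix_sum_delta x) -[f]/(L : _ -> _) linear_sum.
  by apply: eq_bigr => i _; rewrite big_ord1 linearZ.
apply/colP => i; rewrite mxE summxE; apply: eq_bigr => j _.
by rewrite !mxE mulrC.
Qed.

Lemma mul_mx_of_refl a x : mx_of (refl S a) *m x = refl S a x.
Proof. exact/mx_ofE/refl_linear. Qed.

Lemma transl_linear u : linear (transl S u).
Proof.
move=> c x y; rewrite /transl -hatP hpartP cpartP dpartP formDl formZl.
by congr hat; [rewrite scalerDr scalerDl scalerA addrACA|ring].
Qed.

Lemma mul_mx_of_transl u x : mx_of (transl S u) *m x = transl S u x.
Proof. exact/mx_ofE/transl_linear. Qed.

Lemma mulmx_inj n (A B : 'M[K]_n) : (forall x : 'cV[K]_n, A *m x = B *m x) -> A = B.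
Proof.
move=> AB; apply/matrixP => i j.
by have /colP/(_ i) := AB (delta_mx j 0); rewrite -!colE !mxE.
Qed.

End HatTheory.

(** * Nonnegative and integral combinations *)

Section NonnegComb.

Variable V : zmodType.
Implicit Types (s : seq V) (x y : V).

Lemma nonneg_comb0 s : nonneg_comb s 0.
Proof. by exists (fun=> 0%N); rewrite big1. Qed.

Lemma nonneg_combD s x y : nonneg_comb s x -> nonneg_comb s y -> nonneg_comb s (x + y).
Proof.
move=> [m ->] [n ->]; exists (fun i => m i + n i)%N; rewrite -big_split.
by apply: eq_bigr => i _; rewrite mulrnDr.
Qed.

Lemma nonneg_combMn s x n : nonneg_comb s x -> nonneg_comb s (x *+ n).
Proof.
move=> sx; elim: n => [|n IHn]; first exact: nonneg_comb0.
by rewrite mulrS; apply: nonneg_combD.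
Qed.

Lemma nonneg_comb_mem s x : x \in s -> nonneg_comb s x.
Proof.
move=> /(nthP 0)[i im <-]; exists (fun j => (j == Ordinal im) : nat).
rewrite (bigD1 (Ordinal im)) //= big1 ?addr0 ?eqxx //.
by move=> j /negPf->.
Qed.

Lemma nonneg_comb_ind s (P : V -> Prop) :
  P 0 -> (forall x y, P x -> P y -> P (x + y)) -> (forall x, x \in s -> P x) ->
  forall x, nonneg_comb s x -> P x.
Proof.
move=> P0 PD Ps x [m ->]; apply: (big_ind P) => // i _.
by elim: (m i) => [//|n IHn]; rewrite mulrS; apply: PD => //; apply/Ps/mem_nth.
Qed.

Lemma int_span0 (A : set V) : int_span A 0.
Proof. by exists 0%N, (fun=> 0), (fun=> 0); rewrite big_ord0; split=> // -[]. Qed.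

Lemma int_spanD (A : set V) x y : int_span A x -> int_span A y -> int_span A (x + y).
Proof.
move=> [p [m [u [Au ->]]]] [q [n [v [Av ->]]]].
exists (p + q)%N, (fun i => match fintype.split i with inl j => m j | inr j => n j end).
exists (fun i => match fintype.split i with inl j => u j | inr j => v j end).
split=> [i|]; first by case: (fintype.split i).
rewrite big_split_ord; congr (_ + _); apply: eq_bigr => i _ /=.
  by case: (split_ordP (lshift q i)) => j /eqP; rewrite ?eq_lshift ?eq_lrshift // => /eqP ->.
by case: (split_ordP (rshift p i)) => j /eqP; rewrite ?eq_rshift ?eq_rlshift // => /eqP ->.
Qed.

Lemma int_spanMz (A : set V) x k : int_span A x -> int_span A (x *~ k).
Proof.
move=> [p [m [u [Au ->]]]]; exists p, (fun i => m i * k), u; split=> //.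
by rewrite mulrz_suml; apply: eq_bigr => i _; rewrite mulrzA.
Qed.

Lemma int_span_mem (A : set V) x : A x -> int_span A x.
Proof. by move=> Ax; exists 1%N, (fun=> 1), (fun=> x); rewrite big_ord1. Qed.

End NonnegComb.

(** * The extended affine Weyl group and its inversions *)

Section AffineWeyl.

Variables (R : realType) (l : nat) (S : 'M[R]_l) (Phi : set 'cV[R]_l).
Variables (F : seq 'cV[R]_l) (theta : 'cV[R]_l) (Y : set 'cV[R]_l).
Hypothesis rsP : root_system S Phi.
Hypothesis simpleF : simple_roots Phi F.
Hypothesis highest : highest_root Phi F theta.
Hypothesis latY : translation_lattice S Phi Y.

Local Notation G := (ext_weyl S Phi Y).
Local Notation AR := (affine_roots Phi).
Local Notation AP := (affine_pos Phi F theta).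
Local Notation AS := (affine_simple F theta).
Local Notation s_ a := (mx_of (refl S a)).
Local Notation t_ u := (mx_of (transl S u)).

Lemma root_form_pos a : Phi a -> 0 < form S a a.
Proof. by move=> /(rs_neq0 rsP) /(rs_pos rsP). Qed.

Lemma root_opp a : Phi a -> Phi (- a).
Proof.
move=> ra; have [m [E rm]] := rs_refl rsP ra ra.
have m2 : m = 2%N :> int.
  by apply/eqP; rewrite -(eqr_int R) -(inj_eq (mulIf (lt0r_neq0 (root_form_pos ra)))) -E.
by move: rm; rewrite m2 -pmulrn mulr2n opprD addrA subrr sub0r.
Qed.

Lemma affine_form a : AR a -> 0 < hform S a a.
Proof.
move=> [al ral [m _ <-]]; rewrite hform_hat mulr0 mul0r !addr0.
exact: root_form_pos.
Qed.

Lemma affine_form_neq0 a : AR a -> hform S a a != 0.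
Proof. by move=> /affine_form /lt0r_neq0. Qed.

Lemma affine_opp a : AR a -> AR (- a).
Proof.
move=> [al ral [m _ <-]]; exists (- al); first exact: root_opp.
by exists (- m) => //; rewrite hatN rmorphN /= oppr0.
Qed.

Lemma lattice0 : Y 0.
Proof. by have [[X _ ->] _ _] := latY; exact: int_span0. Qed.

Lemma latticeD u v : Y u -> Y v -> Y (u + v).
Proof. by have [[X _ ->] _ _] := latY; exact: int_spanD. Qed.

Lemma latticeMz u m : Y u -> Y (u *~ m).
Proof. by have [[X _ ->] _ _] := latY; exact: int_spanMz. Qed.

Lemma latticeN u : Y u -> Y (- u).
Proof. by move=> /latticeMz - /(_ (- 1)); rewrite mulrNz. Qed.

Lemma lattice_coroot a : Phi a -> Y (coroot S a).
Proof.
by move=> ra; have [_ + _] := latY; apply; apply: int_span_mem; exists a.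
Qed.

Lemma lattice_int y a : Y y -> Phi a -> exists m : int, form S y a = m%:~R.
Proof.
move=> yY ra; have [_ _ h] := latY; have /intrP := h y a yY (int_span_mem ra).
by [].
Qed.

(** As [Y] pairs integrally with roots, the correction is an integral multiple of a coroot, and
    coroots lie in [Y]. *)
Lemma lattice_refl y a : Y y -> Phi a ->
  Y (y - (2%:R / form S a a * form S y a) *: a).
Proof.
move=> yY ra; have [m mE] := lattice_int yY ra; apply: latticeD => //.
by rewrite mE mulrC -scalerA scaler_int -mulrNz; apply/latticeMz/lattice_coroot.
Qed.

Let hat_form al m : hform S (hat al m 0) (hat al m 0) = form S al al.
Proof. by rewrite hform_hat mulr0 mul0r !addr0. Qed.

Let refl_hat al m v e t : refl S (hat al m 0) (hat v e t) =
  hat (v - (2%:R / form S al al * (form S v al + m * t)) *: al)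
      (e - 2%:R / form S al al * (form S v al + m * t) * m) t.
Proof.
rewrite reflE hat_form hform_hat mulr0 addr0 (mulrC t) hatZ hatN hatD mulr0 oppr0.
by rewrite addr0.
Qed.

Let transl_hat u v e t : transl S u (hat v e t) =
  hat (v + t *: u) (e - t / 2%:R * form S u u - form S v u) t.
Proof. by rewrite /transl hpart_hat cpart_hat dpart_hat. Qed.

Let mulmx_hat_inj (A B : 'M[R]_l.+2) :
  (forall v e t, A *m hat v e t = B *m hat v e t) -> A = B.
Proof. by move=> AB; apply: mulmx_inj => x; rewrite -(hatK x). Qed.

Lemma transl_mul u v : t_ u *m t_ v = t_ (u + v).
Proof.
apply: mulmx_hat_inj => w e t; rewrite -mulmxA !mul_mx_of_transl !transl_hat.
have symS := rs_sym rsP.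
congr hat; first by rewrite -addrA -scalerDr (addrC v).
by rewrite !(formDl, formDr, formZl) (formC u v symS); field.
Qed.

Lemma transl0 : t_ 0 = 1%:M.
Proof.
apply: mulmx_hat_inj => w e t; rewrite mul_mx_of_transl transl_hat mul1mx.
by rewrite scaler0 addr0 -(scale0r (0 : 'cV[R]_l)) !formZr !mul0r mulr0 !subr0.
Qed.

Lemma refl_transl al u : Phi al -> t_ u *m s_ (hat al 0 0) =
  s_ (hat al 0 0) *m t_ (u - (2%:R / form S al al * form S u al) *: al).
Proof.
move=> ral; have := lt0r_neq0 (root_form_pos ral) => al0.
apply: mulmx_hat_inj => w e t; rewrite -!mulmxA.
rewrite !(mul_mx_of_transl, mul_mx_of_refl, transl_hat, refl_hat).
rewrite !(formDl, formDr, formNl, formNr, formZl, formZr) !mul0r !mulr0.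
rewrite (formC al u (rs_sym rsP)).
congr hat; last by field.
by apply/colP => i; rewrite !mxE; field.
Qed.

(** For integral [m] the translation vector lies in [Y]; this places all affine reflections in the
    extended group. *)
Lemma affine_refl_transl al (m : R) : Phi al ->
  s_ (hat al m 0) = s_ (hat al 0 0) *m t_ (m *: coroot S al).
Proof.
move=> ral; have := lt0r_neq0 (root_form_pos ral) => al0.
apply: mulmx_hat_inj => w e t; rewrite -!mulmxA.
rewrite !(mul_mx_of_transl, mul_mx_of_refl, transl_hat, refl_hat).
rewrite /coroot !(formDl, formDr, formNl, formNr, formZl, formZr) !mul0r !mulr0.
congr hat; last by field.
by apply/colP => i; rewrite !mxE; field.
Qed.

Lemma weyl_refl al : Phi al -> weyl S Phi (s_ (hat al 0 0)).
Proof.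
by move=> ral; exists [:: al]; [move=> a; rewrite inE => /eqP ->|rewrite big_seq1].
Qed.

Lemma weyl1 : weyl S Phi 1%:M.
Proof. by exists [::] => //; rewrite big_nil. Qed.

Lemma weyl_mul u v : weyl S Phi u -> weyl S Phi v -> weyl S Phi (u *m v).
Proof.
move=> [s sPhi ->] [r rPhi ->]; exists (s ++ r); last by rewrite big_cat.
by move=> a; rewrite mem_cat => /orP[/sPhi|/rPhi].
Qed.

Lemma weyl_ind (P : 'M[R]_l.+2 -> Prop) : P 1%:M ->
  (forall al u, Phi al -> weyl S Phi u -> P u -> P (s_ (hat al 0 0) *m u)) ->
  forall u, weyl S Phi u -> P u.
Proof.
move=> P1 Ps u [s sPhi ->]; elim: s sPhi => [|al s IHs] sPhi; first by rewrite big_nil.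
have sPhi' a : a \in s -> Phi a by move=> sa; apply: sPhi; rewrite inE sa orbT.
rewrite big_cons; apply: Ps; [by apply: sPhi; rewrite inE eqxx|by exists s|exact: IHs].
Qed.

Lemma transl_weyl u y : weyl S Phi u -> Y y ->
  exists2 y', Y y' & t_ y *m u = u *m t_ y'.
Proof.
move=> wu; elim/weyl_ind: wu y => [y yY|al u' ral _ IH y yY].
  by exists y => //; rewrite mul1mx mulmx1.
have [y' y'Y E] := IH _ (lattice_refl yY ral).
by exists y' => //; rewrite mulmxA refl_transl // -!mulmxA E.
Qed.

Lemma ext_weyl_mul w w' : G w -> G w' -> G (w *m w').
Proof.
move=> [u wu [y yY <-]] [u' wu' [y' y'Y <-]].
have [y'' y''Y E] := transl_weyl wu' yY.
exists (u *m u'); first exact: weyl_mul.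
exists (y'' + y'); first exact: latticeD.
by rewrite -transl_mul -!mulmxA (mulmxA (t_ y)) E -!mulmxA.
Qed.

Lemma ext_weyl_weyl u : weyl S Phi u -> G u.
Proof. by move=> wu; exists u => //; exists 0; [exact: lattice0|rewrite transl0 mulmx1]. Qed.

Lemma ext_weyl_transl y : Y y -> G (t_ y).
Proof. by move=> yY; exists 1%:M; [exact: weyl1|exists y => //; rewrite mul1mx]. Qed.

Lemma ext_weyl1 : G 1%:M.
Proof. exact/ext_weyl_weyl/weyl1. Qed.

Lemma ext_weyl_refl a : AR a -> G (s_ a).
Proof.
move=> [al ral [m _ <-]]; rewrite affine_refl_transl //.
apply: ext_weyl_mul; first exact/ext_weyl_weyl/weyl_refl.
by apply: ext_weyl_transl; rewrite scaler_int; apply/latticeMz/lattice_coroot.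
Qed.

Lemma affine_reflK a : AR a -> s_ a *m s_ a = 1%:M.
Proof.
move=> ra; apply: mulmx_inj => x; rewrite -mulmxA !mul_mx_of_refl mul1mx.
by rewrite reflK // affine_form_neq0.
Qed.

Lemma ext_weyl_inverse w : G w -> exists2 w', G w' & w *m w' = 1%:M.
Proof.
move=> [u wu [y yY <-]].
have [u' wu' uu'] : exists2 u', weyl S Phi u' & u *m u' = 1%:M.
  elim/weyl_ind: wu => [|al v ral wv [v' wv' vv']].
    by exists 1%:M; [exact: weyl1|rewrite mulmx1].
  exists (v' *m s_ (hat al 0 0)); first exact/weyl_mul/weyl_refl.
  rewrite mulmxA -(mulmxA _ v) vv' mulmx1 affine_reflK //.
  by exists al => //; exists 0.
exists (t_ (- y) *m u').
  by apply: ext_weyl_mul; [exact/ext_weyl_transl/latticeN|exact: ext_weyl_weyl].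
by rewrite mulmxA -(mulmxA u) transl_mul subrr transl0 mulmx1.
Qed.

Lemma ext_weyl_unit w : G w -> w \in unitmx.
Proof. by move=> /ext_weyl_inverse[w' _ /mulmx1_unit[]]. Qed.

Lemma ext_weyl_inv w : G w -> G (invmx w).
Proof.
move=> wG; have [w' w'G E] := ext_weyl_inverse wG.
by rewrite -[invmx w]mulmx1 -E mulmxA mulVmx ?ext_weyl_unit // mul1mx.
Qed.

Lemma ext_weyl_invM w w' : G w -> G w' -> invmx (w *m w') = invmx w' *m invmx w.
Proof.
move=> wG w'G; have u := ext_weyl_unit (ext_weyl_mul wG w'G).
rewrite -[RHS](mulKmx u) -(mulmxA w) (mulKVmx (ext_weyl_unit w'G)).
by rewrite (mulmxV (ext_weyl_unit wG)) mulmx1.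
Qed.

Lemma ext_weyl_ind (P : 'M[R]_l.+2 -> Prop) :
  (forall al, Phi al -> P (s_ (hat al 0 0))) -> (forall y, Y y -> P (t_ y)) ->
  (forall w w', G w -> G w' -> P w -> P w' -> P (w *m w')) ->
  forall w, G w -> P w.
Proof.
move=> Ps Pt PM w [u wu [y yY <-]]; apply: (PM _ _ _ _ _ (Pt y yY)).
- exact: ext_weyl_weyl.
- exact: ext_weyl_transl.
elim/weyl_ind: wu => [|al v ral wv Pv]; first by rewrite -transl0; exact/Pt/lattice0.
apply: (PM _ _ _ _ _ Pv); [exact/ext_weyl_weyl/weyl_refl|exact: ext_weyl_weyl|exact: Ps].
Qed.

Lemma ext_weyl_dpart w x : G w -> dpart (w *m x) = dpart x.
Proof.
move=> wG; elim/ext_weyl_ind: wG x => [al ral x|y yY x|w1 w2 _ _ IH1 IH2 x].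
- by rewrite -(hatK x) mul_mx_of_refl refl_hat !dpart_hat.
- by rewrite mul_mx_of_transl /transl dpart_hat.
- by rewrite -mulmxA IH1 IH2.
Qed.

Lemma ext_weyl_hform w x y : G w -> hform S (w *m x) (w *m y) = hform S x y.
Proof.
have symS := rs_sym rsP.
move=> wG; elim/ext_weyl_ind: wG x y => [al ral x y|u _ x y|w1 w2 _ _ IH1 IH2 x y].
- rewrite !mul_mx_of_refl refl_hform // affine_form_neq0 //.
  by exists al => //; exists 0.
- rewrite !mul_mx_of_transl -(hatK x) -(hatK y) !transl_hat !hform_hat.
  by rewrite !(formDl, formDr, formZl, formZr) (formC u _ symS); field.
- by rewrite -!mulmxA IH1 IH2.
Qed.

Lemma ext_weyl_root w al m : G w -> Phi al -> exists2 be, Phi be &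
  exists n : int, w *m hat al m%:~R 0 = hat be n%:~R 0.
Proof.
move=> wG; elim/ext_weyl_ind: wG al m => [be rbe al m ral|u uY al m ral|].
- have [n [E rn]] := rs_refl rsP rbe ral.
  exists (al - be *~ n) => //; exists m; rewrite mul_mx_of_refl refl_hat.
  rewrite mul0r !addr0 mulr0 subr0; congr (hat (_ - _) _ _).
  by rewrite mulrAC E mulfK ?scaler_int // lt0r_neq0 // root_form_pos.
- exists al => //; rewrite mul_mx_of_transl transl_hat scale0r addr0 mul0r mul0r subr0.
  have [n nE] := lattice_int uY ral; exists (m - n).
  by rewrite (formC al u (rs_sym rsP)) nE intrB.
- move=> w1 w2 _ _ IH1 IH2 al m ral; rewrite -mulmxA.
  by have [be rbe [n ->]] := IH2 al m ral; apply: IH1.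
Qed.

Lemma ext_weyl_affine w a : G w -> AR a -> AR (w *m a).
Proof.
move=> wG [al ral [m _ <-]]; have [be rbe [n ->]] := ext_weyl_root m wG ral.
by exists be => //; exists n.
Qed.

Lemma refl_conj w a : G w -> AR a -> w *m s_ a = s_ (w *m a) *m w.
Proof.
move=> wG ra; apply: mulmx_inj => x; rewrite -!mulmxA !mul_mx_of_refl !reflE.
by rewrite !ext_weyl_hform // mulmxBr -scalemxAr.
Qed.

(** The coefficient of [c] is the multiplicity of the affine simple root [-theta + c]; what remains
    is a combination of finite simple roots. *)
Lemma affine_simple_nneg n v : nonneg_comb F v ->
  nonneg_comb AS (hat (v - theta *+ n) n%:R 0).
Proof.
move=> Fv; have -> : hat (v - theta *+ n) n%:R 0 = hat v 0 0 + hat (- theta) 1 0 *+ n.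
  by rewrite hat_muln hatD mul0rn addr0 add0r mulNrn.
apply: nonneg_combD; last by apply/nonneg_combMn/nonneg_comb_mem/mem_head.
elim/nonneg_comb_ind: Fv => [|x y IHx IHy|x xF].
- by rewrite hat0; exact: nonneg_comb0.
- by rewrite -[0]addr0 -hatD; exact: nonneg_combD.
- by apply: nonneg_comb_mem; rewrite inE; apply/orP; right; apply/mapP; exists x.
Qed.

Lemma affine_simple_nnegP x : nonneg_comb AS x ->
  exists n v, nonneg_comb F v /\ x = hat (v - theta *+ n) n%:R 0.
Proof.
elim/nonneg_comb_ind => [|x1 x2 [n1 [v1 [F1 ->]]] [n2 [v2 [F2 ->]]]|y].
- by exists 0%N, 0; rewrite subr0 hat0; split=> //; exact: nonneg_comb0.
- exists (n1 + n2)%N, (v1 + v2); split; first exact: nonneg_combD.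
  by rewrite hatD natrD addr0 mulrnDr opprD addrACA.
rewrite inE => /predU1P[->|/mapP[v vF ->]].
  by exists 1%N, 0; rewrite sub0r; split=> //; exact: nonneg_comb0.
by exists 0%N, v; rewrite subr0; split=> //; exact: nonneg_comb_mem.
Qed.

Let freeF (k : 'I_(size F) -> R) :
  \sum_i k i *: F`_i = 0 -> forall i, k i = 0.
Proof.
have [freeF _ _] := simpleF; move: k.
by have /freeP : free (in_tuple F) by [].
Qed.

(** The coordinate along [c] isolates the coefficient of the affine simple root; the others vanish
    because [F] is free. *)
Lemma affine_simple_indep (k : 'I_(size AS) -> R) :
  \sum_i k i *: AS`_i = 0 -> forall i, k i = 0.
Proof.
rewrite big_ord_recl /= => sum0.
have E (v : seq 'cV[R]_l) (c : nat -> R) :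
    \sum_(i < size [seq hat a 0 0 | a <- v]) c i *: [seq hat a 0 0 | a <- v]`_i =
    hat (\sum_(i < size v) c i *: v`_i) 0 0 :> 'cV[R]_l.+2.
  elim: v c => [|a v IH] c; first by rewrite !big_ord0 hat0.
  rewrite !big_ord_recl /= (IH (fun i => c i.+1)) hatZ hatD !mulr0 !addr0.
  by congr (hat (_ + _) _ _); apply: eq_bigr.
pose c j := if insub j is Some i then k i else 0.
have cE (i : 'I_(size AS)) : c i = k i by rewrite /c valK.
have /hat_inj[] : hat (\sum_(i < size F) c i.+1 *: F`_i - k ord0 *: theta) (k ord0) 0 = hat 0 0 0.
  rewrite hat0 -[RHS]sum0 hatZ mulr1 mulr0.
  under [in RHS]eq_bigr => i _ do rewrite -cE lift0.
  by rewrite (E F (fun i => c i.+1)) hatD addr0 addr0 scalerN addrC.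
move=> + k0 _; rewrite k0 scale0r subr0 => sumF i.
have kF := freeF sumF.
rewrite -cE; case: i => -[|i] iS /=; first by rewrite -k0 -cE.
have iF : (i < size F)%N by move: iS; rewrite /= size_map.
exact: (kF (Ordinal iF)).
Qed.

Lemma nonneg_comb_pointed x : nonneg_comb AS x -> nonneg_comb AS (- x) -> x = 0.
Proof.
move=> [m xE] [n xE'].
have sum0 : \sum_i ((m i + n i)%:R : R) *: AS`_i = 0.
  rewrite -[RHS](subrr x) {1}xE xE' -big_split; apply: eq_bigr => i _ /=.
  by rewrite natrD scalerDl !scaler_nat.
rewrite xE big1 // => i _; have /eqP := affine_simple_indep sum0 i.
by rewrite pnatr_eq0 addn_eq0 => /andP[/eqP-> _].
Qed.

Lemma affine_neq0 a : AR a -> a != 0.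
Proof. by move=> /affine_form; apply: contra_ltN => /eqP ->; rewrite hform0l. Qed.

Lemma affine_posW a : AP a -> AR a.
Proof. by case. Qed.

Lemma affine_pos_opp a : AP a -> ~ AP (- a).
Proof.
move=> [ra pa] [_ na]; have := affine_neq0 ra.
by rewrite (nonneg_comb_pointed pa na) eqxx.
Qed.

Let theta_nneg : nonneg_comb F theta.
Proof.
have [rt ht] := highest; have [_ _ Fpm] := simpleF.
have [//|tN] := Fpm theta rt.
have t2 : nonneg_comb F (theta - - theta) by apply: ht; exact: root_opp.
by have := nonneg_combD tN t2; rewrite opprK addKr.
Qed.

(** At level [n.+1], removing [n.+1] copies of [-theta + c] from the root leaves
    [theta + al + n theta], which is nonnegative because [-al] is a root below [theta]. Level zero
    is the finite dichotomy, and negative levels are opposites of positive ones. *)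
Lemma affine_pos_or_neg a : AR a -> AP a \/ AP (- a).
Proof.
have [rt ht] := highest; have [_ _ Fpm] := simpleF.
have pos al n : Phi al -> nonneg_comb AS (hat al n.+1%:R 0).
  move=> ral; have -> : al = (theta - - al + theta *+ n) - theta *+ n.+1.
    by apply/esym/eqP; rewrite subr_eq opprK mulrS addrA (addrC al).
  by apply/affine_simple_nneg/nonneg_combD; [apply/ht/root_opp|exact: nonneg_combMn].
move=> ra; have rNa := affine_opp ra; move: ra rNa.
move=> [al ral [m _ <-]]; rewrite hatN -rmorphN oppr0 => rNa.
have ra : AR (hat al m%:~R 0) by exists al => //; exists m.
have rNal := root_opp ral.
case: m ra rNa => [[|n]|n] ra rNa.
- have [Fa|Fa] := Fpm al ral; have := affine_simple_nneg 0 Fa; rewrite subr0 => h.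
    by left; split.
  by right; split=> //; rewrite oppr0.
- by left; split=> //; exact: pos.
- by right; split=> //; rewrite NegzE opprK; exact: pos.
Qed.

Lemma affine_neg_pos a : AR a -> ~ AP a -> AP (- a).
Proof. by move=> /affine_pos_or_neg[]. Qed.

Lemma affine_simple_pos b : b \in AS -> AP b.
Proof.
move=> bS; split; last exact: nonneg_comb_mem.
move: bS; rewrite inE => /predU1P[->|/mapP[v vF ->]].
  by exists (- theta); [apply: root_opp; case: highest|exists 1].
by exists v; [have [_ + _] := simpleF; apply|exists 0].
Qed.

Lemma affine_simple_root b : b \in AS -> AR b.
Proof. by move=> /affine_simple_pos[]. Qed.

(** The reflection alters the coefficient of [b] only. If the result were negative, all other
    coefficients of [a] would vanish, and [a] would be a multiple of [b], hence [b] itself in a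
    reduced system. *)
Lemma affine_simple_refl b a : b \in AS -> AP a -> a <> b -> AP (refl S b a).
Proof.
move=> bS [ra [n aE]] ab; have rb := affine_simple_root bS.
have rsa : AR (refl S b a).
  by rewrite -mul_mx_of_refl; apply: ext_weyl_affine => //; exact: ext_weyl_refl.
have [//|[_ [n' saE]]] := affine_pos_or_neg rsa; exfalso.
have /(nthP 0)[i0 i0S bE] := bS; pose i := Ordinal i0S.
have others j : j != i -> n j = 0%N.
  move: saE; rewrite reflE; set c := _ * _ => saE ji.
  have sum0 : \sum_(j < size AS) ((n j + n' j)%:R - (j == i)%:R * c) *: AS`_j = 0.
    have -> : \sum_(j < size AS) ((n j + n' j)%:R - (j == i)%:R * c) *: AS`_j =
        \sum_(j < size AS) AS`_j *+ n j + \sum_(j < size AS) AS`_j *+ n' j - \sum_(j < size AS) ((j == i)%:R * c) *: AS`_j.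
      rewrite -big_split -sumrB; apply: eq_bigr => j' _ /=.
      by rewrite scalerBl natrD scalerDl !scaler_nat.
    rewrite -aE -saE (bigD1 i) //= eqxx mul1r big1 => [|j' /negPf ->]; last first.
      by rewrite mul0r scale0r.
    by rewrite bE addr0 opprB addrCA subrr addr0 subrr.
  have /eqP := affine_simple_indep sum0 j; rewrite (negPf ji) mul0r subr0 pnatr_eq0.
  by rewrite addn_eq0 => /andP[/eqP].
have {}aE : a = b *+ n i.
  by rewrite aE (bigD1 i) //= big1 ?addr0 ?bE // => j /others ->.
case: (n i) aE => [|[|m]] aE; [|by []|].
  by have := affine_neq0 ra; rewrite aE eqxx.
move: ra rb; rewrite aE => -[al ral [p _ E]] [be rbe [q _ E']].
move: E; rewrite -E' hat_muln => /hat_inj[aE' _ _].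
by apply: (rs_multiple rsP rbe (n := m)); rewrite -aE'.
Qed.

Lemma pos_on_simple w : G w -> (forall b, b \in AS -> AP (w *m b)) ->
  forall a, AP a -> AP (w *m a).
Proof.
move=> wG wS a [ra pa]; split; first exact: ext_weyl_affine.
elim/nonneg_comb_ind: pa => [|x y IHx IHy|x /wS[]//].
- by rewrite mulmx0; exact: nonneg_comb0.
- by rewrite mulmxDr; exact: nonneg_combD.
Qed.

Let finite_affine_le (f : 'cV[R]_l -> R) :
  finite_set [set a | exists2 al, Phi al & exists2 n : nat, n%:R <= f al & a = hat al n%:R 0].
Proof.
apply: (@sub_finite_set _ _
  (\bigcup_(al in Phi) [set hat al n%:R 0 | n in `I_(Num.truncn (f al)).+1])).
  move=> a [al ral [n nle ->]]; exists al => //; exists n => //=.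
  by rewrite -(ltr_nat R) (le_lt_trans nle) ?truncnS_gt.
apply: bigcup_finite; first exact: (rs_finite rsP).
by move=> al _; exact/finite_image/finite_II.
Qed.

Let affine_pos_hat a : AP a -> exists2 al, Phi al & exists n : nat, a = hat al n%:R 0.
Proof.
move=> [[al ral [m _ E]] /affine_simple_nnegP[n [v [_ E']]]].
exists al => //; exists n; rewrite E' in E *; case/hat_inj: E => -> _ _.
by [].
Qed.

(** The finite Weyl group fixes the coefficient of [c], and translation by [y] lowers the level of a
    root by the pairing of its finite part with [y]; an inverted root therefore has level at most
    this pairing. *)
Lemma finite_inversions w : G w -> finite_set [set a | AP a /\ AP (- (w *m a))].
Proof.
move=> [u wu [y yY <-]].
apply: sub_finite_set (finite_affine_le (form S ^~ y)) => a [pa na] /=.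
have [al ral [n aE]] := affine_pos_hat pa; exists al => //; exists n => //.
have [[be _ [k _ E]] /affine_simple_nnegP[p [v [_ E']]]] := na.
have : - cpart (u *m t_ y *m a) = p%:R.
  by rewrite -[RHS](cpart_hat (v - theta *+ p) p%:R 0) -E' cpartN.
have cu x : cpart (u *m x) = cpart x.
  elim/weyl_ind: wu x => [x|be' u' rbe' _ IH x]; first by rewrite mul1mx.
  rewrite -mulmxA mul_mx_of_refl -(hatK (u' *m x)) refl_hat cpart_hat mulr0 subr0.
  exact: IH.
rewrite -mulmxA cu mul_mx_of_transl aE transl_hat cpart_hat !mul0r subr0 opprB.
by move=> h; rewrite -subr_ge0 h.
Qed.

(** The value of [al + n c] at [x] grows in [n] with slope [dpart x], so each of the finitely many
    [al] gives negative values at finitely many levels. *)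
Lemma finite_negative x : 0 < dpart x ->
  finite_set [set a | AP a /\ hform S a x < 0].
Proof.
move=> x0.
apply: sub_finite_set (finite_affine_le (fun al => - form S al (hpart x) / dpart x)).
move=> a [/affine_pos_hat[al ral [n ->]]].
rewrite -{1}(hatK x) hform_hat mul0r addr0 => /ltW le0.
exists al => //; exists n => //; rewrite ler_pdivlMr //; lra.
Qed.

(** An element that inverts no simple root is in [Omega]. Otherwise, right multiplication by the
    reflection in an inverted simple root removes that root from the inversions and moves the others
    by the reflection. *)
Lemma ext_weyl_generated (P : 'M[R]_l.+2 -> Prop) :
  (forall b, b \in AS -> P (s_ b)) -> (forall w, Omega S Phi F theta Y w -> P w) ->
  (forall w w', G w -> G w' -> P w -> P w' -> P (w *m w')) ->
  forall w, G w -> P w.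
Proof.
move=> Ps PO PM w wG.
have /finite_seqP[s sE] := finite_inversions wG.
(* The induction runs over lists that contain the inversions rather than over an exact count. *)
have {sE} : [set a | AP a /\ AP (- (w *m a))] `<=` [set` s] by rewrite sE.
have [n ns] := ubnP (size s).
elim: n w s ns wG => // n IHn w s; rewrite ltnS => sn wG Ns.
have [wO|] := pselect (forall b, b \in AS -> AP (w *m b)).
  by apply: PO; split=> // _ [a pa <-]; exact: pos_on_simple.
move=> /existsNP[b /not_implyP[bS wb]].
have rb := affine_simple_root bS; have sG := ext_weyl_refl rb.
have wNb : AP (- (w *m b)) by apply: affine_neg_pos => //; exact: ext_weyl_affine.
have bs : b \in s by apply: Ns; split=> //; exact: affine_simple_pos.
have -> : w = (w *m s_ b) *m s_ b by rewrite -mulmxA affine_reflK // mulmx1.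
have wsG : G (w *m s_ b) by exact: ext_weyl_mul.
apply: PM => //; last exact: Ps.
apply: (IHn _ [seq s_ b *m a | a <- s & a != b]) => //.
  rewrite size_map size_filter; apply: leq_trans sn.
  rewrite -(count_predC (pred1 b) s) -[X in (X < _)%N]add0n ltn_add2r.
  by rewrite -has_count has_pred1.
move=> a [pa na]; have ab : a <> b.
  move=> ab; move: na; rewrite ab -mulmxA mul_mx_of_refl.
  rewrite refl_self ?affine_form_neq0 // mulmxN opprK => pwb.
  exact: (affine_pos_opp pwb).
apply/mapP; exists (s_ b *m a); last first.
  by rewrite mulmxA affine_reflK // mul1mx.
rewrite mem_filter; apply/andP; split.
  apply: contra_not_neq ab => sab.
  have : a = - b.
    rewrite -[a]mul1mx -(affine_reflK rb) -mulmxA sab mul_mx_of_refl refl_self //.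
    exact: affine_form_neq0.
  by move=> aNb; move: pa; rewrite aNb => pNb; case: (affine_pos_opp (affine_simple_pos bS)).
apply: Ns; split; first by rewrite mul_mx_of_refl; exact: affine_simple_refl.
by rewrite mulmxA.
Qed.

Lemma Omega_inv w : Omega S Phi F theta Y w -> Omega S Phi F theta Y (invmx w).
Proof.
move=> [wG wpos]; have wVG := ext_weyl_inv wG; split=> // _ [a pa <-].
have ra := affine_posW pa.
have [//|na] := affine_pos_or_neg (ext_weyl_affine wVG ra).
have : AP (w *m - (invmx w *m a)) by apply: wpos; exists (- (invmx w *m a)).
rewrite mulmxN mulmxA mulmxV ?ext_weyl_unit // mul1mx => /affine_pos_opp.
by rewrite opprK.
Qed.

End AffineWeyl.

(** * Passage to complex scalars *)

Section Complexification.

Variables (R : realType) (l : nat) (S : 'M[R]_l).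

Lemma cplxM m n p (A : 'M[R]_(m, n)) (B : 'M[R]_(n, p)) :
  cplx (A *m B) = cplx A *m cplx B.
Proof. exact: map_mxM. Qed.

Lemma cplxD m n (A B : 'M[R]_(m, n)) : cplx (A + B) = cplx A + cplx B.
Proof. exact: map_mxD. Qed.

Lemma cplxN m n (A : 'M[R]_(m, n)) : cplx (- A) = - cplx A.
Proof. exact: map_mxN. Qed.

Lemma cplxZ m n c (A : 'M[R]_(m, n)) : cplx (c *: A) = c%:C *: cplx A.
Proof. exact: map_mxZ. Qed.

Lemma cplx1 n : cplx 1%:M = 1%:M :> 'M[R[i]]_n.
Proof. exact: map_mx1. Qed.

Lemma cplx_delta m n i j : cplx (delta_mx i j) = delta_mx i j :> 'M[R[i]]_(m, n).
Proof. exact: map_delta_mx. Qed.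

Lemma cplx_hpart (x : 'cV[R]_l.+2) : hpart (cplx x) = cplx (hpart x).
Proof. by apply/colP => i; rewrite !mxE. Qed.

Lemma cplx_cpart (x : 'cV[R]_l.+2) : cpart (cplx x) = (cpart x)%:C.
Proof. by rewrite /cpart !mxE. Qed.

Lemma cplx_dpart (x : 'cV[R]_l.+2) : dpart (cplx x) = (dpart x)%:C.
Proof. by rewrite /dpart !mxE. Qed.

Lemma cplx_form (u v : 'cV[R]_l) : form (cplx S) (cplx u) (cplx v) = (form S u v)%:C.
Proof.
have -> : form (cplx S) (cplx u) (cplx v) = cplx (u^T *m S *m v) 0 0.
  have trE : (cplx u)^T = cplx u^T by apply/matrixP => i j; rewrite !mxE.
  by rewrite /Defs.form trE (cplxM (u^T *m S)) (cplxM u^T).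
by rewrite mxE.
Qed.

Lemma cplx_hform (x y : 'cV[R]_l.+2) :
  hform (cplx S) (cplx x) (cplx y) = (hform S x y)%:C.
Proof.
by rewrite /hform !cplx_hpart !cplx_cpart !cplx_dpart cplx_form !rmorphD !rmorphM.
Qed.

Lemma cplx_refl (a x : 'cV[R]_l.+2) :
  refl (cplx S) (cplx a) (cplx x) = cplx (refl S a x).
Proof.
rewrite !reflE !cplx_hform cplxD cplxN cplxZ; congr (_ - _ *: _).
by rewrite !rmorphM fmorphV rmorph_nat.
Qed.

Lemma cplx_mx_of_refl (a : 'cV[R]_l.+2) :
  cplx (mx_of (refl S a)) = mx_of (refl (cplx S) (cplx a)).
Proof.
apply/matrixP => i j; rewrite [RHS]mxE -cplx_delta cplx_refl [LHS]mxE [RHS]mxE.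
by rewrite [X in X%:C]mxE.
Qed.

Lemma col_sum_delta (K : pzRingType) n (v : 'cV[K]_n) :
  v = \sum_j v j 0 *: delta_mx j 0.
Proof. by rewrite [LHS]matrix_sum_delta; apply: eq_bigr => j _; rewrite big_ord1. Qed.

Lemma hform_cplx_invariant (w : 'M[R]_l.+2) a v :
  (forall x y, hform S (w *m x) (w *m y) = hform S x y) ->
  hform (cplx S) (cplx (w *m a)) (cplx w *m v) = hform (cplx S) (cplx a) v.
Proof.
move=> winv; rewrite (col_sum_delta v).
elim/big_ind: _ => [|x y IHx IHy|j _]; first by rewrite mulmx0 !hform0r.
  by rewrite mulmxDr !hformDr IHx IHy.
by rewrite -scalemxAr !hformZr -cplx_delta -cplxM !cplx_hform winv.
Qed.

End Complexification.

(** * Dunkl operators on functions over a space with signs *)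

Section DunklOperators.

Variables (R : realType) (l : nat) (S : 'M[R]_l) (Phi : set 'cV[R]_l).
Variables (F : seq 'cV[R]_l) (theta : 'cV[R]_l) (Y : set 'cV[R]_l).
Hypothesis rsP : root_system S Phi.
Hypothesis simpleF : simple_roots Phi F.
Hypothesis highest : highest_root Phi F theta.
Hypothesis latY : translation_lattice S Phi Y.
Variable (k : 'cV[R]_l.+2 -> R[i]).
Hypothesis kinv : multiplicity S Phi Y k.

Local Notation G := (ext_weyl S Phi Y).
Local Notation AR := (affine_roots Phi).
Local Notation AP := (affine_pos Phi F theta).
Local Notation AS := (affine_simple F theta).
Local Notation Om := (Omega S Phi F theta Y).
Local Notation s_ a := (mx_of (refl S a)).
Local Notation cform a v := (hform (cplx S) (cplx a) v).

(** A module over the algebra, described by generators and relations without mentioning the algebra.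
    The notion serves both to build the algebra and to define its representations afterwards. *)
Record cherednik_module (E : lmodType R[i])
    (D : 'cV[R[i]]_l.+2 -> E -> E) (W : 'M[R]_l.+2 -> E -> E) : Prop :=
  CherednikModule {
    cm_Dlin : forall v, linear (D v);
    cm_Dvec : forall c u v f, D (c *: u + v) f = c *: D u f + D v f;
    cm_DC : forall u v f, D u (D v f) = D v (D u f);
    cm_Wlin : forall w, G w -> linear (W w);
    cm_W1 : forall f, W 1%:M f = f;
    cm_WM : forall w w' f, G w -> G w' -> W (w *m w') f = W w (W w' f);
    cm_refl : forall b v f, b \in AS ->
      W (s_ b) (D v f) = D (cplx (s_ b) *m v) (W (s_ b) f) - (k b * cform b v) *: f;
    cm_omega : forall w v f, Om w -> W w (D v f) = D (cplx w *m v) (W w f) }.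

(* [neg a x] says that the root [a] takes negative values at the point or
   chamber [x]. *)
Record sign_space (X : Type) (act : 'M[R]_l.+2 -> X -> X)
    (neg : 'cV[R]_l.+2 -> X -> bool) : Prop := SignSpace {
  ss_act1 : forall x, act 1%:M x = x;
  ss_actM : forall w w' x, G w -> G w' -> act (w *m w') x = act w (act w' x);
  ss_neg : forall w a x, G w -> AR a -> neg (w *m a) (act w x) = neg a x;
  ss_negN : forall a x, AR a -> neg (- a) x = ~~ neg a x;
  ss_fin : forall x, finite_set [set a | AP a /\ neg a x];
  ss_simple : forall x, (forall b, b \in AS -> ~~ neg b x) ->
    forall a, AP a -> ~~ neg a x }.

(** Common features of polynomials under multiplication and of analytic functions under
    differentiation. Only coordinate directions are given: [del_vec] extends them to complex
    vectors, whereas directional derivatives are taken along real ones. *)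
Record coefficient_space (P : lmodType R[i]) (rho : 'M[R]_l.+2 -> P -> P)
    (del : 'I_l.+2 -> P -> P) : Prop := CoefficientSpace {
  cs_rholin : forall w, G w -> linear (rho w);
  cs_rho1 : forall p, rho 1%:M p = p;
  cs_rhoM : forall w w' p, G w -> G w' -> rho (w *m w') p = rho w (rho w' p);
  cs_dellin : forall j, linear (del j);
  cs_delC : forall i j p, del i (del j p) = del j (del i p);
  cs_rho_del : forall w j p, G w ->
    rho w (del j p) = \sum_i (w i j)%:C *: del i (rho w p) }.

Variables (X : Type) (act : 'M[R]_l.+2 -> X -> X) (neg : 'cV[R]_l.+2 -> X -> bool).
Hypothesis ssX : sign_space act neg.
Variables (P : lmodType R[i]) (rho : 'M[R]_l.+2 -> P -> P) (del : 'I_l.+2 -> P -> P).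
Hypothesis csP : coefficient_space rho del.

Definition neg_roots x : set 'cV[R]_l.+2 := [set a | AP a /\ neg a x].

Definition group_op (w : 'M[R]_l.+2) (f : X -> P) : X -> P :=
  fun x => rho w (f (act (invmx w) x)).

Definition del_vec (v : 'cV[R[i]]_l.+2) (p : P) : P := \sum_i v i 0 *: del i p.

Definition dunkl_op (v : 'cV[R[i]]_l.+2) (f : X -> P) : X -> P :=
  fun x => del_vec v (f x) -
    \sum_(a <- fset_set (neg_roots x)) (k a * cform a v) *: group_op (s_ a) f x.

Let s_inv b : AR b -> invmx (s_ b) = s_ b.
Proof.
move=> rb; have sG := ext_weyl_refl rsP latY rb.
rewrite -[LHS]mulmx1 -(affine_reflK rsP rb) mulmxA mulVmx ?mul1mx //.
exact: (ext_weyl_unit rsP latY).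
Qed.

Let G1 : G 1%:M := ext_weyl1 latY.
Let GM w w' : G w -> G w' -> G (w *m w') := @ext_weyl_mul _ _ _ _ _ rsP latY w w'.
Let GV w : G w -> G (invmx w) := @ext_weyl_inv _ _ _ _ _ rsP latY w.
Let Gu w : G w -> w \in unitmx := @ext_weyl_unit _ _ _ _ _ rsP latY w.
Let Gs a : AR a -> G (s_ a) := @ext_weyl_refl _ _ _ _ _ rsP latY a.
Let GA w a : G w -> AR a -> AR (w *m a) := @ext_weyl_affine _ _ _ _ _ rsP latY w a.

Lemma cform_inv w a v : G w -> cform (w *m a) (cplx w *m v) = cform a v.
Proof. by move=> wG; apply: hform_cplx_invariant => x y; exact: (ext_weyl_hform rsP latY). Qed.

Lemma act_inv w x : G w -> act w (act (invmx w) x) = x.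
Proof.
move=> wG; rewrite -(ss_actM ssX x wG (GV wG)) (mulmxV (Gu wG)).
exact: (ss_act1 ssX).
Qed.

Lemma group_op_linear w : G w -> linear (group_op w).
Proof. by move=> wG c f h; apply/funext => x; rewrite /group_op (cs_rholin csP). Qed.

Lemma group_op1 f : group_op 1%:M f = f.
Proof. by apply/funext => x; rewrite /group_op (cs_rho1 csP) invmx1 (ss_act1 ssX). Qed.

Lemma group_opM w w' f : G w -> G w' ->
  group_op (w *m w') f = group_op w (group_op w' f).
Proof.
move=> wG w'G; apply/funext => x; rewrite /group_op (cs_rhoM csP) // (ext_weyl_invM rsP latY) //.
by rewrite (ss_actM ssX) //; exact: GV.
Qed.

Let del0 j : del j 0 = 0.
Proof. exact/linear_map0/(cs_dellin csP). Qed.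

Let delD j p q : del j (p + q) = del j p + del j q.
Proof. exact: (linear_mapD (cs_dellin csP j)). Qed.

Let delZ j c p : del j (c *: p) = c *: del j p.
Proof. exact: (linear_mapZ (cs_dellin csP j)). Qed.

Let rho0 w : G w -> rho w 0 = 0.
Proof. by move=> wG; exact/linear_map0/(cs_rholin csP). Qed.

Let rhoD w p q : G w -> rho w (p + q) = rho w p + rho w q.
Proof. by move=> wG; exact: (linear_mapD (cs_rholin csP wG)). Qed.

Let rhoZ w c p : G w -> rho w (c *: p) = c *: rho w p.
Proof. by move=> wG; exact: (linear_mapZ (cs_rholin csP wG)). Qed.

Lemma del_vec_linear v : linear (del_vec v).
Proof.
move=> c p q; rewrite /del_vec scaler_sumr -big_split; apply: eq_bigr => i _ /=.
by rewrite delD delZ scalerDr !scalerA mulrC.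
Qed.

Lemma del_vecPl c u v p : del_vec (c *: u + v) p = c *: del_vec u p + del_vec v p.
Proof.
rewrite /del_vec scaler_sumr -big_split; apply: eq_bigr => i _ /=.
by rewrite !mxE scalerDl scalerA.
Qed.

Lemma del_vecC u v p : del_vec u (del_vec v p) = del_vec v (del_vec u p).
Proof.
have E x y : del_vec x (del_vec y p) =
    \sum_i \sum_j (x i 0 * y j 0) *: del i (del j p).
  apply: eq_bigr => i _; rewrite /del_vec.
  rewrite (big_morph (del i) (delD i) (del0 i)) scaler_sumr.
  by apply: eq_bigr => j _; rewrite delZ scalerA.
rewrite !E exchange_big; apply: eq_bigr => i _; apply: eq_bigr => j _ /=.
by rewrite mulrC (cs_delC csP).
Qed.

Lemma rho_del_vec w v p : G w ->
  rho w (del_vec v p) = del_vec (cplx w *m v) (rho w p).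
Proof.
move=> wG; rewrite /del_vec.
rewrite (big_morph (rho w) (fun x y => rhoD x y wG) (rho0 wG)).
under eq_bigr => j _ do rewrite rhoZ // (cs_rho_del csP) // scaler_sumr.
rewrite exchange_big; apply: eq_bigr => i _ /=.
rewrite mxE scaler_suml; apply: eq_bigr => j _.
by rewrite !mxE scalerA mulrC.
Qed.

Lemma dunkl_op_linear v : linear (dunkl_op v).
Proof.
move=> c f h; apply/funext => x; rewrite /dunkl_op.
have -> : (c *: f + h) x = c *: f x + h x by [].
have -> : (c *: (fun x => del_vec v (f x) -
    \sum_(a <- fset_set (neg_roots x)) (k a * cform a v) *: group_op (s_ a) f x) +
    (fun x => del_vec v (h x) -
    \sum_(a <- fset_set (neg_roots x)) (k a * cform a v) *: group_op (s_ a) h x)) x =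
   c *: (del_vec v (f x) -
    \sum_(a <- fset_set (neg_roots x)) (k a * cform a v) *: group_op (s_ a) f x) +
   (del_vec v (h x) -
    \sum_(a <- fset_set (neg_roots x)) (k a * cform a v) *: group_op (s_ a) h x) by [].
rewrite del_vec_linear scalerBr addrACA -opprD; congr (_ - _).
rewrite scaler_sumr -big_split /= big_seq [RHS]big_seq; apply: eq_bigr => a.
rewrite in_fset_set; last exact: (ss_fin ssX).
rewrite inE => -[[ra _] _]; rewrite (group_op_linear (Gs ra)).
have -> : (c *: group_op (s_ a) f + group_op (s_ a) h) x =
  c *: group_op (s_ a) f x + group_op (s_ a) h x by [].
by rewrite scalerDr !scalerA mulrC.
Qed.

Lemma dunkl_opPl c u v f : dunkl_op (c *: u + v) f = c *: dunkl_op u f + dunkl_op v f.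
Proof.
apply/funext => x.
have -> : (c *: dunkl_op u f + dunkl_op v f) x = c *: dunkl_op u f x + dunkl_op v f x by [].
rewrite /dunkl_op del_vecPl scalerBr addrACA -opprD; congr (_ - _).
rewrite scaler_sumr -big_split /=; apply: eq_bigr => a _.
by rewrite hformPr mulrDr scalerDl scalerA mulrCA.
Qed.

(** The substitution [c = w a] turns the roots negative at the preimage of [x] into those negative
    at [x] whose preimage is positive. The cross relations compare this set with [neg_roots x]. *)
Lemma group_op_dunkl w v f x : G w -> group_op w (dunkl_op v f) x =
  del_vec (cplx w *m v) (group_op w f x) -
  \sum_(c \in [set c | AP (invmx w *m c) /\ neg c x])
     (k c * cform c (cplx w *m v)) *: group_op (s_ c) (group_op w f) x.
Proof.
move=> wG; rewrite /group_op -/(group_op _) /dunkl_op.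
set y := act (invmx w) x.
rewrite -scaleN1r addrC rhoD // rhoZ // rho_del_vec // addrC scaleN1r; congr (_ - _).
rewrite (reindex_fsbig (fun a => w *m a) (neg_roots y)).
  rewrite (fsbig_finite _ _ (ss_fin ssX y)).
  rewrite (big_morph (rho w) (fun p q => rhoD p q wG) (rho0 wG)).
  rewrite big_seq [RHS]big_seq; apply: eq_bigr => a.
  rewrite in_fset_set ?inE => [[[ra _] _]|]; last exact: (ss_fin ssX).
  have sG := Gs ra; rewrite rhoZ // kinv // cform_inv //; congr (_ *: _).
  rewrite -[LHS]/(group_op w (group_op (s_ a) f) x) -group_opM //.
  by rewrite (refl_conj rsP latY) // group_opM //; apply/Gs/GA.
split=> [a [pa na]|a b _ _|c [pc nc]].
- split; first by rewrite mulKmx ?Gu.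
  by rewrite -(act_inv x wG) (ss_neg ssX) //; case: pa.
- exact: (can_inj (mulKmx (Gu wG))).
have rc : AR c by rewrite -(mulKVmx (Gu wG) c); apply: GA => //; case: pc.
exists (invmx w *m c); last by rewrite mulKVmx ?Gu.
by split=> //; rewrite /y (ss_neg ssX x (GV wG) rc).
Qed.

Let kN a : AR a -> k (- a) = k a.
Proof.
move=> ra; rewrite -(refl_self (affine_form_neq0 rsP ra)) -mul_mx_of_refl kinv //.
exact: Gs.
Qed.

Lemma group_op_dunkl_Omega w v f : Om w ->
  group_op w (dunkl_op v f) = dunkl_op (cplx w *m v) (group_op w f).
Proof.
move=> wO; have wG : G w by case: wO.
apply/funext => x; rewrite group_op_dunkl // /dunkl_op; congr (_ - _).
rewrite -(fsbig_finite _ _ (ss_fin ssX x : finite_set (neg_roots x))); apply: eq_fsbigl.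
apply/seteqP; split=> c [pc nc]; split=> //.
  rewrite -(mulKVmx (Gu wG) c); case: wO => _; apply.
  by exists (invmx w *m c).
by case: (Omega_inv rsP simpleF highest latY wO) => _; apply; exists c.
Qed.

(** The two index sets share the roots of [A] below, and exactly one of them has a further member,
    [b] or [-b], whichever is negative at [x]. In its term the reflection in [b] acts twice, so a
    multiple of [f] is left over. *)
Lemma group_op_dunkl_simple b v f : b \in AS ->
  group_op (s_ b) (dunkl_op v f) =
  dunkl_op (cplx (s_ b) *m v) (group_op (s_ b) f) - (k b * cform b v) *: f.
Proof.
move=> bS; have pb : AP b := affine_simple_pos rsP simpleF highest bS.
have rb := affine_posW pb; have sG := Gs rb.
apply/funext => x; rewrite group_op_dunkl // s_inv //.
have -> (h1 h2 : X -> P) : (h1 - h2) x = h1 x - h2 x by [].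
have -> (c : R[i]) (h1 : X -> P) : (c *: h1) x = c *: h1 x by [].
rewrite /dunkl_op -addrA -opprD; congr (_ - _).
rewrite -(fsbig_finite _ _ (ss_fin ssX x : finite_set (neg_roots x))).
have sbb : s_ b *m b = - b by rewrite mul_mx_of_refl refl_self // (affine_form_neq0 rsP).
have ssf : group_op (s_ b) (group_op (s_ b) f) = f.
  by rewrite -group_opM // (affine_reflK rsP) // group_op1.
have cb : cform b (cplx (s_ b) *m v) = - cform b v.
  by rewrite -(cform_inv b v sG) sbb cplxN hformNl opprK.
pose A := [set c | [/\ AP (s_ b *m c), AP c & neg c x]].
have finA : finite_set A by apply: sub_finite_set (ss_fin ssX x) => c [].
have AE c : AP c -> c <> b -> AP (s_ b *m c).
  by rewrite mul_mx_of_refl; apply: (affine_simple_refl rsP simpleF highest latY).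
have Nb : ~ AP (- b) := affine_pos_opp rsP simpleF pb.
pose T c := (k c * cform c (cplx (s_ b) *m v)) *: group_op (s_ c) (group_op (s_ b) f) x.
have Tb : T b = - ((k b * cform b v) *: f x).
  by rewrite /T cb mulrN scaleNr ssf.
have TNb : T (- b) = (k b * cform b v) *: f x.
  rewrite /T kN // cplxN hformNl cb opprK.
  have -> : s_ (- b) = s_ b by apply: mulmx_inj => z; rewrite !mul_mx_of_refl reflN.
  by rewrite ssf.
(* If [b] is negative at [x], it occurs in the operator on the right side only; otherwise [-b]
   occurs on the left side only. *)
rewrite -/(T _); have [nb|nb] := boolP (neg b x).
  have E1 : [set c | AP (s_ b *m c) /\ neg c x] = A.
    apply/seteqP; split=> c; last by case.
    move=> [psc nc]; split=> //; have rc : AR c.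
      by rewrite -[c]mul1mx -(affine_reflK rsP rb) -mulmxA; apply: GA => //; case: psc.
    have [//|pNc] := affine_pos_or_neg rsP simpleF highest rc.
    have cNb : - c = b.
      apply: contrapT => /(AE _ pNc); rewrite mulmxN => pNsc.
      exact: (affine_pos_opp rsP simpleF psc).
    by move: nc; rewrite -[c]opprK cNb (ss_negN ssX) // nb.
  have E2 : neg_roots x = b |` A.
    apply/seteqP; split=> c.
      move=> [pc nc]; have [->|/eqP cb'] := eqVneq c b; first by left.
      by right; split=> //; exact: AE.
    by case=> [->|[]].
  rewrite E1 E2 fsbigU0 ?fsbig_set1 //; last first.
    by move=> c [-> [+ _ _]]; rewrite sbb.
  by rewrite [X in X + _ + _]Tb addrAC addNr add0r.
have E2 : neg_roots x = A.
  apply/seteqP; split=> c; last by case.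
  move=> [pc nc]; split=> //; apply: AE => // cb'.
  by move: nb; rewrite -cb' nc.
have E1 : [set c | AP (s_ b *m c) /\ neg c x] = (- b) |` A.
  apply/seteqP; split=> c.
    move=> [psc nc]; have rc : AR c.
      by rewrite -[c]mul1mx -(affine_reflK rsP rb) -mulmxA; apply: GA => //; case: psc.
    have [pc|pNc] := affine_pos_or_neg rsP simpleF highest rc; first by right.
    left; rewrite /= -[c]opprK; congr (- _); apply: contrapT => /(AE _ pNc).
    rewrite mulmxN => pNsc; exact: (affine_pos_opp rsP simpleF psc).
  case=> [->|[? ? ?]]; last by [].
  by split; rewrite ?mulmxN ?sbb ?opprK // (ss_negN ssX).
rewrite E1 E2 fsbigU0 ?fsbig_set1 //; last first.
  by move=> c [-> [_ + _]].
by rewrite [LHS]addrC; congr (_ + _); exact: TNb.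
Qed.

Let dunklD v f h : dunkl_op v (f + h) = dunkl_op v f + dunkl_op v h.
Proof. exact: (linear_mapD (dunkl_op_linear v)). Qed.

Let dunklZ v c f : dunkl_op v (c *: f) = c *: dunkl_op v f.
Proof. exact: (linear_mapZ (dunkl_op_linear v)). Qed.

Let dunkl_op0 v f x : neg_roots x = set0 -> dunkl_op v f x = del_vec v (f x).
Proof. by move=> N0; rewrite /dunkl_op N0 fset_set0 big_seq_fset0 subr0. Qed.

Let group_op_congr w f h x y : act (invmx w) x = y -> f y = h y ->
  group_op w f x = group_op w h x.
Proof. by rewrite /group_op => -> ->. Qed.

Let combine_cross (h1 h2 h3 h4 : X -> P) c1 c2 c d : c2 * c = d ->
  h1 + c1 *: h2 + c2 *: (h3 - c *: h4) = h1 + c1 *: h2 + c2 *: h3 - d *: h4.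
Proof. by move=> <-; rewrite scalerBr scalerA addrA. Qed.

Let combine_swap (h1 h1' h2 h3 h4 : X -> P) c1 c2 d d' x : h1 x = h1' x -> d = d' ->
  (h1 + c1 *: h2 + c2 *: h3 - d *: h4) x = (h1' + c2 *: h3 + c1 *: h2 - d' *: h4) x.
Proof.
move=> h1x ->; transitivity (h1 x + c1 *: h2 x + c2 *: h3 x - d' *: h4 x); first by [].
by rewrite h1x; congr (_ - _); rewrite addrAC.
Qed.

#[local] Opaque dunkl_op group_op del_vec.

(* At a point where no positive root is negative the operators are plain
   derivatives, which commute; conjugating the commutator of [u] and [v] by a
   simple reflection [s] gives that of [s u] and [s v], which carries the claim
   to all other points. *)
Lemma dunkl_opC u v f : dunkl_op u (dunkl_op v f) = dunkl_op v (dunkl_op u f).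
Proof.
apply/funext => x; have /finite_seqP[s sE] := ss_fin ssX x.
have {sE} : neg_roots x `<=` [set` s] by rewrite /neg_roots sE.
have [n ns] := ubnP (size s).
elim: n s ns x u v f => [|n IHn] s; first by move=> s0; exfalso.
rewrite ltnS => sn x u v f Ns; have [nonneg|] := pselect (forall b, b \in AS -> ~~ neg b x).
  have N0 : neg_roots x = set0.
    apply/seteqP; split=> a // [pa na]; have := ss_simple ssX nonneg pa.
    by rewrite na.
  by rewrite !dunkl_op0 // del_vecC.
move=> nonneg; have {nonneg}[b bS nb] : exists2 b : 'cV[R]_l.+2, b \in AS & neg b x.
  by case/existsNP: nonneg => b /not_implyP[bS /negP/negbNE nb]; exists b.
have pb := affine_simple_pos rsP simpleF highest bS.
have rb := affine_posW pb; have sG := Gs rb.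
have sbb : s_ b *m b = - b by rewrite mul_mx_of_refl refl_self // (affine_form_neq0 rsP).
have bs : b \in s by apply: Ns.
pose y := act (s_ b) x.
have ssf h : group_op (s_ b) (group_op (s_ b) h) = h.
  by rewrite -group_opM // (affine_reflK rsP) // group_op1.
have ssv z : cplx (s_ b) *m (cplx (s_ b) *m z) = z.
  by rewrite mulmxA -cplxM (affine_reflK rsP) // cplx1 mul1mx.
have cross z h : dunkl_op (cplx (s_ b) *m z) (group_op (s_ b) h) =
    group_op (s_ b) (dunkl_op z h) + (k b * cform b z) *: h.
  by rewrite group_op_dunkl_simple // subrK.
have sv z h : dunkl_op (cplx (s_ b) *m z) h =
    dunkl_op z h - (2%:R / cform b (cplx b) * cform b z) *: dunkl_op (cplx b) h.
  rewrite cplx_mx_of_refl mul_mx_of_refl reflE (hformC z); last first.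
    by apply/matrixP => i j; have /matrixP/(_ i j) := rs_sym rsP; rewrite !mxE => ->.
  by rewrite addrC -scaleNr dunkl_opPl scaleNr addrC.
(* Except for its first term the right side is symmetric in [z] and [w]: the corrections cancel in
   the commutator. *)
have E z w h : dunkl_op (cplx (s_ b) *m z) (dunkl_op (cplx (s_ b) *m w) (group_op (s_ b) h)) =
   group_op (s_ b) (dunkl_op z (dunkl_op w h)) + (k b * cform b z) *: dunkl_op w h
   + (k b * cform b w) *: dunkl_op z h
   - (2%:R / cform b (cplx b) * k b * cform b w * cform b z) *: dunkl_op (cplx b) h.
  rewrite cross dunklD cross dunklZ sv; apply: combine_cross; ring.
suff main u' v' h :
    dunkl_op (cplx (s_ b) *m u') (dunkl_op (cplx (s_ b) *m v') (group_op (s_ b) h)) x =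
    dunkl_op (cplx (s_ b) *m v') (dunkl_op (cplx (s_ b) *m u') (group_op (s_ b) h)) x.
  have := main (cplx (s_ b) *m u) (cplx (s_ b) *m v) (group_op (s_ b) f).
  by rewrite !ssv ssf.
rewrite (E u' v' h) (E v' u' h); clear E sv cross ssv ssf.
apply: combine_swap; last by ring.
apply: (@group_op_congr _ _ _ _ y); first by rewrite (s_inv rb).
(* The positive roots negative at [y] are images of those negative at [x] other than [b], so a
   shorter list contains them. *)
apply: (IHn [seq s_ b *m a | a <- s & a != b]).
  rewrite size_map size_filter; apply: leq_trans sn.
  rewrite -(count_predC (pred1 b) s) -[X in (X < _)%N]add0n ltn_add2r.
  by rewrite -has_count has_pred1.
move=> a [pa na]; have ra := affine_posW pa.
have nsa : neg (s_ b *m a) x.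
  by rewrite -(act_inv x sG) s_inv // (ss_neg ssX).
have ab : a <> b by move=> ab; move: nsa; rewrite ab sbb (ss_negN ssX) // nb.
apply/mapP; exists (s_ b *m a); last by rewrite mulmxA (affine_reflK rsP) // mul1mx.
have psa : AP (s_ b *m a).
  by rewrite mul_mx_of_refl; apply: (affine_simple_refl rsP simpleF highest latY).
rewrite mem_filter; apply/andP; split; last exact: Ns.
apply/negP => /eqP sab; have aNb : a = - b.
  have := congr1 (mulmx (s_ b)) sab.
  by rewrite mulmxA (affine_reflK rsP) // mul1mx sbb.
apply: (affine_pos_opp rsP simpleF pb); rewrite -aNb; exact pa.
Qed.

Theorem dunkl_cherednik_module : cherednik_module dunkl_op group_op.
Proof.
split.
- exact: dunkl_op_linear.
- exact: dunkl_opPl.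
- exact: dunkl_opC.
- exact: group_op_linear.
- exact: group_op1.
- by move=> w w' f; exact: group_opM.
- by move=> b v f; exact: group_op_dunkl_simple.
- by move=> w v f; exact: group_op_dunkl_Omega.
Qed.

End DunklOperators.

(** * Linear extension from monomials *)

Section MpolyLinear.

Variables (C : comNzRingType) (n : nat).

Lemma mpoly_eq_lin (E : lmodType C) (f h : mpoly n C -> E) :
  linear f -> linear h -> (forall m, f (mpolyX C m) = h (mpolyX C m)) -> f =1 h.
Proof.
move=> linf linh fh p.
elim/mpolyind: p => [|c m p _ _ IHp]; first by rewrite !linear_map0.
by rewrite linf linh fh IHp.
Qed.

Definition mpoly_lin (E : lmodType C) (phi : multinom n -> E) (p : mpoly n C) : E :=
  \sum_(m <- msupp p) mcoeff m p *: phi m.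

Variables (E : lmodType C) (phi : multinom n -> E).

(** Summing over a larger list lets two polynomials and their combination be compared over one
    common support. *)
Lemma mpoly_lin_widen s p : uniq s -> {subset msupp p <= s} ->
  mpoly_lin phi p = \sum_(m <- s) mcoeff m p *: phi m.
Proof.
move=> us sub; rewrite [RHS](bigID (mem (msupp p))) /= [X in _ + X]big1 ?addr0.
  rewrite -big_filter; apply: perm_big; apply: uniq_perm.
  - exact: msupp_uniq.
  - exact: filter_uniq.
  by move=> m; rewrite mem_filter; case: (boolP (m \in msupp p)) => // /sub ->.
by move=> m /memN_msupp_eq0 ->; rewrite scale0r.
Qed.

Lemma mpoly_lin_linear : linear (mpoly_lin phi).
Proof.
move=> c p q; pose s := undup (msupp p ++ msupp q ++ msupp (c *: p + q)).
rewrite !(@mpoly_lin_widen s) ?undup_uniq //.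
- rewrite scaler_sumr -big_split; apply: eq_bigr => m _ /=.
  by rewrite linearP /= scalerDl scalerA.
- by move=> m mq; rewrite mem_undup !mem_cat mq !orbT.
- by move=> m mp; rewrite mem_undup !mem_cat mp.
- by move=> m mpq; rewrite mem_undup !mem_cat mpq !orbT.
Qed.

Lemma mpoly_linX m : mpoly_lin phi (mpolyX C m) = phi m.
Proof. by rewrite /mpoly_lin msuppX big_seq1 mcoeffX eqxx scale1r. Qed.

(** Peeling off one variable at a time reduces multiplicative statements on monomials to elements of
    degree one. *)
Lemma multinom_ind (P : multinom n -> Prop) : P (@mnm0 n) ->
  (forall m i, P m -> P (mnm_add (mnm1 i) m)) -> forall m, P m.
Proof.
move=> P0 PS m; have [d md] := ubnP (mdeg m).
elim: d m md => // d IHd m; rewrite ltnS => md.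
have [->//|m0] := eqVneq m (@mnm0 n).
have [i mi] : exists i, m i != 0%N.
  apply: contrapT => h; case/eqP: m0; apply/mnmP => i; rewrite mnm0E.
  by apply/eqP; apply: contrapT => /negP ?; apply: h; exists i.
have E' : mnm_add (mnm1 i) (mnm_sub m (mnm1 i)) = m.
  by rewrite addmC submK // lep1mP.
rewrite -E'; apply/PS/IHd; apply: leq_trans md.
by rewrite -[in X in (_ < X)%N]E' mdegD mdeg1.
Qed.

End MpolyLinear.

(** * Polynomials acting through commuting operators *)

Section PolynomialAction.

Variables (C : comNzRingType) (n : nat) (E : lmodType C) (D : 'I_n -> E -> E).
Hypothesis Dlin : forall i, linear (D i).
Hypothesis DC : forall i j f, D i (D j f) = D j (D i f).

Definition monomial_op (m : multinom n) (f : E) : E :=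
  foldr (fun i h => iter (m i) (D i) h) f (enum 'I_n).

Definition poly_op (p : mpoly n C) (f : E) : E := mpoly_lin (monomial_op^~ f) p.

Lemma poly_opP c p q f : poly_op (c *: p + q) f = c *: poly_op p f + poly_op q f.
Proof. exact: mpoly_lin_linear. Qed.

Let iterC j i k f : D j (iter k (D i) f) = iter k (D i) (D j f).
Proof. by elim: k => //= k <-; rewrite DC. Qed.

Lemma monomial_op0 f : monomial_op (@mnm0 n) f = f.
Proof. by rewrite /monomial_op; elim: (enum 'I_n) => //= i s ->; rewrite mnm0E. Qed.

Lemma monomial_opS i m f : monomial_op (mnm_add (mnm1 i) m) f = D i (monomial_op m f).
Proof.
rewrite /monomial_op.
have H s : uniq s ->
    foldr (fun j h => iter (mnm_add (mnm1 i) m j) (D j) h) f s =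
    let x := foldr (fun j h => iter (m j) (D j) h) f s in
    if i \in s then D i x else x.
  elim: s => //= j s IHs /andP[js us]; rewrite (IHs us) mnmDE mnm1E inE.
  have [ij|ij] /= := eqVneq i j; last by case: ifP => // _; rewrite add0n iterC.
  by subst j; rewrite (negPf js).
by rewrite H ?enum_uniq //= mem_enum.
Qed.

Lemma monomial_op_linear m : linear (monomial_op m).
Proof.
move=> c f h; rewrite /monomial_op; elim: (enum 'I_n) => //= i s ->.
by elim: (m i) => //= k ->; rewrite Dlin.
Qed.

Lemma poly_op_linear p : linear (poly_op p).
Proof.
move=> c f h; rewrite /poly_op /mpoly_lin scaler_sumr -big_split.
apply: eq_bigr => m _ /=; rewrite monomial_op_linear scalerDr !scalerA.
by rewrite mulrC.
Qed.

Lemma poly_opX m f : poly_op (mpolyX C m) f = monomial_op m f.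
Proof. exact: mpoly_linX. Qed.

Lemma poly_op1 f : poly_op 1 f = f.
Proof. by rewrite -mpolyX0 poly_opX monomial_op0. Qed.

Lemma poly_opXi i f : poly_op (mpolyX C (mnm1 i)) f = D i f.
Proof. by rewrite poly_opX -[mnm1 i]addm0 monomial_opS monomial_op0. Qed.

Lemma poly_opM p q f : poly_op (p * q) f = poly_op p (poly_op q f).
Proof.
move: p; apply: mpoly_eq_lin => [c p p'|c p p'|m].
- by rewrite mulrDl -scalerAl poly_opP.
- by rewrite poly_opP.
rewrite poly_opX; elim/multinom_ind: m => [|m i IHm].
  by rewrite mpolyX0 mul1r monomial_op0.
rewrite mpolyXD -mulrA monomial_opS -IHm; set r := _ * q.
move: r; apply: mpoly_eq_lin => [c p p'|c p p'|m'].
- by rewrite mulrDr -scalerAr poly_opP.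
- by rewrite poly_opP Dlin.
by rewrite -mpolyXD !poly_opX monomial_opS.
Qed.

End PolynomialAction.

(** * Words: finite sums of a polynomial times a group element *)

Section Words.

Variables (R : realType) (l : nat) (S : 'M[R]_l) (Phi : set 'cV[R]_l).
Variables (F : seq 'cV[R]_l) (theta : 'cV[R]_l) (Y : set 'cV[R]_l).
Hypothesis rsP : root_system S Phi.
Hypothesis simpleF : simple_roots Phi F.
Hypothesis highest : highest_root Phi F theta.
Hypothesis latY : translation_lattice S Phi Y.
Variable (k : 'cV[R]_l.+2 -> R[i]).

Local Notation G := (ext_weyl S Phi Y).
Local Notation poly := (mpoly l.+2 R[i]).
Local Notation word := (seq (poly * 'M[R]_l.+2)).

(** A list of pairs [(p, w)] stands for the sum of the products [p w]. Group elements may repeat, so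
    sums and products of words need no normal form; [collect] supplies one when coefficients
    matter. *)
Definition group_word (s : word) : Prop := forall x, x \in s -> G x.2.

Lemma group_word_cat s t : group_word s -> group_word t -> group_word (s ++ t).
Proof. by move=> sG tG x; rewrite mem_cat => /orP[/sG|/tG]. Qed.

Lemma sym_vecP c u v : sym_vec (c *: u + v) = c *: sym_vec u + sym_vec v :> poly.
Proof.
rewrite /sym_vec scaler_sumr -big_split; apply: eq_bigr => i _ /=.
by rewrite !mxE scalerDl scalerA.
Qed.

Lemma sym_vec_delta i : sym_vec (delta_mx i 0) = mpolyX R[i] (mnm1 i) :> poly.
Proof.
rewrite /sym_vec (bigD1 i) //= big1 => [|j /negPf ji].
  by rewrite mxE !eqxx scale1r addr0.
by rewrite mxE ji scale0r.
Qed.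

Section Module.

Variables (E : lmodType R[i]) (D : 'cV[R[i]]_l.+2 -> E -> E) (W : 'M[R]_l.+2 -> E -> E).
Hypothesis cm : cherednik_module S Phi F theta Y k D W.

Definition sym_op (p : poly) (f : E) : E := poly_op (fun i => D (delta_mx i 0)) p f.

Let Di_lin i : linear (D (delta_mx i 0)).
Proof. exact: (cm_Dlin cm). Qed.

Let Di_C i j f : D (delta_mx i 0) (D (delta_mx j 0) f) = D (delta_mx j 0) (D (delta_mx i 0) f).
Proof. exact: (cm_DC cm). Qed.

Lemma sym_opP c p q f : sym_op (c *: p + q) f = c *: sym_op p f + sym_op q f.
Proof. exact: poly_opP. Qed.

Lemma sym_op_linear p : linear (sym_op p).
Proof. exact: poly_op_linear. Qed.

Lemma sym_op1 f : sym_op 1 f = f.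
Proof. exact: poly_op1. Qed.

Lemma sym_opM p q f : sym_op (p * q) f = sym_op p (sym_op q f).
Proof. exact: poly_opM. Qed.

Lemma sym_op0l f : sym_op 0 f = 0.
Proof. exact: (linear_map0 (f := sym_op^~ f) (fun c p q => sym_opP c p q f)). Qed.

Lemma sym_opD p q f : sym_op (p + q) f = sym_op p f + sym_op q f.
Proof. exact: (linear_mapD (f := sym_op^~ f) (fun c p q => sym_opP c p q f)). Qed.

Lemma sym_opZ c p f : sym_op (c *: p) f = c *: sym_op p f.
Proof. exact: (linear_mapZ (f := sym_op^~ f) (fun c p q => sym_opP c p q f)). Qed.

Let sym_op0 p : sym_op p 0 = 0.
Proof. exact: (linear_map0 (sym_op_linear p)). Qed.

Let sym_opDr p f h : sym_op p (f + h) = sym_op p f + sym_op p h.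
Proof. exact: (linear_mapD (sym_op_linear p)). Qed.

Lemma sym_op_vec v f : sym_op (sym_vec v) f = D v f.
Proof.
have symD : linear (fun v => sym_op (sym_vec v) f) by move=> c x y; rewrite sym_vecP sym_opP.
have DD : linear (D^~ f) by move=> c x y; exact: (cm_Dvec cm).
rewrite (col_sum_delta v); elim: (index_enum _) => [|i s IHs].
  by rewrite !big_nil (linear_map0 symD) (linear_map0 DD).
rewrite !big_cons symD DD IHs; congr (_ *: _ + _).
by rewrite sym_vec_delta /sym_op poly_opXi.
Qed.

Definition word_op (s : word) (f : E) : E := \sum_(x <- s) sym_op x.1 (W x.2 f).

Definition is_word_op (phi : E -> E) : Prop :=
  exists2 s, group_word s & phi =1 word_op s.

Lemma word_op_cat s t f : word_op (s ++ t) f = word_op s f + word_op t f.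
Proof. exact: big_cat. Qed.

Lemma word_op_scale c s f : word_op [seq (c *: x.1, x.2) | x <- s] f = c *: word_op s f.
Proof.
by rewrite /word_op big_map scaler_sumr; apply: eq_bigr => x _; rewrite sym_opZ.
Qed.

Lemma word_op_sym p s f :
  word_op [seq (p * x.1, x.2) | x <- s] f = sym_op p (word_op s f).
Proof.
rewrite /word_op big_map (big_morph _ (sym_opDr p) (sym_op0 p)).
by apply: eq_bigr => x _; rewrite sym_opM.
Qed.

Lemma is_word_opD phi psi : is_word_op phi -> is_word_op psi ->
  is_word_op (fun f => phi f + psi f).
Proof.
move=> [s sG sE] [t tG tE]; exists (s ++ t); first exact: group_word_cat.
by move=> f; rewrite sE tE word_op_cat.
Qed.

Lemma is_word_opZ c phi : is_word_op phi -> is_word_op (fun f => c *: phi f).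
Proof.
move=> [s sG sE]; exists [seq (c *: x.1, x.2) | x <- s].
  by move=> x /mapP[y /sG yG ->].
by move=> f; rewrite sE word_op_scale.
Qed.

Lemma is_word_op_sym p phi : is_word_op phi -> is_word_op (fun f => sym_op p (phi f)).
Proof.
move=> [s sG sE]; exists [seq (p * x.1, x.2) | x <- s].
  by move=> x /mapP[y /sG yG ->].
by move=> f; rewrite sE word_op_sym.
Qed.

Lemma is_word_op0 : is_word_op (fun=> 0).
Proof. by exists [::] => // f; rewrite /word_op big_nil. Qed.

Lemma is_word_op_ext phi psi : phi =1 psi -> is_word_op phi -> is_word_op psi.
Proof. by move=> E' [s sG sE]; exists s => // f; rewrite -E' sE. Qed.

Lemma cm_W0 w : G w -> W w 0 = 0.
Proof. by move=> wG; exact/linear_map0/(cm_Wlin cm). Qed.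

Lemma cm_WD w f h : G w -> W w (f + h) = W w f + W w h.
Proof. by move=> wG; exact: (linear_mapD (cm_Wlin cm wG)). Qed.

Lemma cm_WZ w c f : G w -> W w (c *: f) = c *: W w f.
Proof. by move=> wG; exact: (linear_mapZ (cm_Wlin cm wG)). Qed.

Lemma is_word_op_group w : G w -> is_word_op (W w).
Proof.
move=> wG; exists [:: (1, w)]; first by move=> x; rewrite inE => /eqP ->.
by move=> f; rewrite /word_op big_seq1 sym_op1.
Qed.

Lemma is_word_op_Wr w phi : G w -> is_word_op phi -> is_word_op (fun f => phi (W w f)).
Proof.
move=> wG [s sG sE]; exists [seq (x.1, x.2 *m w) | x <- s].
  by move=> x /mapP[y ys ->]; apply: (ext_weyl_mul rsP latY) => //; apply: sG.
move=> f; rewrite sE /word_op big_map big_seq [RHS]big_seq; apply: eq_bigr => x xs.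
by rewrite /= (cm_WM cm) //; exact: sG.
Qed.

Lemma is_word_op_sum (I : eqType) (r : seq I) (phi : I -> E -> E) :
  (forall i, i \in r -> is_word_op (phi i)) ->
  is_word_op (fun f => \sum_(i <- r) phi i f).
Proof.
elim: r => [|i r IHr] H.
  by apply: is_word_op_ext is_word_op0 => f; rewrite big_nil.
apply: (@is_word_op_ext (fun f => phi i f + \sum_(j <- r) phi j f)).
  by move=> f; rewrite big_cons.
apply: is_word_opD; first by apply: H; rewrite mem_head.
by apply: IHr => j jr; apply: H; rewrite inE jr orbT.
Qed.

(* Moving a group element to the right of a polynomial: by the cross relations
   for generators, and by composition in general. *)
Lemma is_word_op_Wl w phi : G w -> is_word_op phi -> is_word_op (fun f => W w (phi f)).
Proof.
suff H : G w -> forall p, is_word_op (fun f => W w (sym_op p f)).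
  move=> wG [s sG sE].
  apply: (@is_word_op_ext (fun f => \sum_(x <- s) W w (sym_op x.1 (W x.2 f)))).
    move=> f; rewrite sE /word_op (big_morph (W w) (fun x y => cm_WD x y wG) (cm_W0 wG)).
    by [].
  apply: is_word_op_sum => x xs.
  by apply: (is_word_op_Wr (sG _ xs)) (H wG x.1).
(* Both kinds of generators satisfy this relation, with [c = 0] for [Omega]; induction on the
   monomial moves them past one variable at a time. *)
have gen w' (c : 'cV[R[i]]_l.+2 -> R[i]) : G w' ->
    (forall v f, W w' (D v f) = D (cplx w' *m v) (W w' f) - c v *: f) ->
    forall p, is_word_op (fun f => W w' (sym_op p f)).
  move=> w'G cross; elim/mpolyind => [|a m p _ _ IHp].
    by apply: is_word_op_ext is_word_op0 => f; rewrite sym_op0l cm_W0.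
  apply: (@is_word_op_ext (fun f => a *: W w' (sym_op (mpolyX _ m) f) + W w' (sym_op p f))).
    by move=> f; rewrite sym_opP cm_WD // cm_WZ.
  apply: is_word_opD => //; apply: is_word_opZ.
  elim/multinom_ind: m => [|m i IHm].
    apply: is_word_op_ext (is_word_op_group w'G) => f.
    by rewrite mpolyX0 sym_op1.
  apply: (@is_word_op_ext (fun f =>
    sym_op (sym_vec (cplx w' *m delta_mx i 0)) (W w' (sym_op (mpolyX _ m) f)) +
    (- c (delta_mx i 0)) *: sym_op (mpolyX _ m) f)).
    by move=> f; rewrite mpolyXD sym_opM -sym_vec_delta !sym_op_vec cross scaleNr.
  apply: is_word_opD; first exact: is_word_op_sym.
  apply: is_word_opZ; apply: (@is_word_op_ext (fun f => sym_op (mpolyX _ m) (W 1%:M f))).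
    by move=> f; rewrite (cm_W1 cm).
  by apply: is_word_op_sym; apply: is_word_op_group; exact: (ext_weyl1 latY).
elim/(ext_weyl_generated rsP simpleF highest latY).
- move=> b bS; apply: gen (fun v f => cm_refl cm v f bS).
  exact/(ext_weyl_refl rsP latY)/(affine_simple_root rsP simpleF highest).
- move=> w' w'O; apply: (gen w' (fun=> 0)); first by case: w'O.
  by move=> v f; rewrite (cm_omega cm) // scale0r subr0.
move=> w1 w2 w1G w2G IH1 IH2 p.
have [s sG sE] := IH2 p.
apply: (@is_word_op_ext (fun f => \sum_(x <- s) W w1 (sym_op x.1 (W x.2 f)))).
  move=> f; rewrite (cm_WM cm) // sE /word_op.
  by rewrite (big_morph (W w1) (fun x y => cm_WD x y w1G) (cm_W0 w1G)).
by apply: is_word_op_sum => x xs; apply: (is_word_op_Wr (sG _ xs)) (IH1 x.1).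
Qed.

Lemma is_word_op_comp phi psi : is_word_op phi -> is_word_op psi ->
  is_word_op (fun f => phi (psi f)).
Proof.
move=> [s sG sE] wpsi.
apply: (@is_word_op_ext (fun f => \sum_(x <- s) sym_op x.1 (W x.2 (psi f)))).
  by move=> f; rewrite sE.
apply: is_word_op_sum => x xs; apply: is_word_op_sym.
by apply: is_word_op_Wl => //; exact: sG.
Qed.

Lemma is_word_op_linear phi : is_word_op phi -> linear phi.
Proof.
move=> [s sG sE] c f h; rewrite !sE /word_op scaler_sumr -big_split.
rewrite big_seq [RHS]big_seq; apply: eq_bigr => x /sG xG /=.
by rewrite (cm_Wlin cm) // sym_op_linear.
Qed.

End Module.

Definition collect (s : word) : {fsfun 'M[R]_l.+2 -> poly with 0} :=
  [fsfun w in [fset x.2 | x in s]%fset => \sum_(x <- s | x.2 == w) x.1].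

Lemma collectE s w : collect s w = \sum_(x <- s | x.2 == w) x.1.
Proof.
rewrite fsfunE; case: ifPn => // ws; rewrite big_seq_cond big1 // => x /andP[xs /eqP xw].
by case/negP: ws; apply/imfsetP; exists x.
Qed.

Lemma collect_supp s w : w \in finsupp (collect s) -> exists2 x, x \in s & x.2 = w.
Proof.
rewrite mem_finsupp collectE => nz; apply: contrapT => h; case/eqP: nz.
rewrite big_seq_cond big1 // => x /andP[xs /eqP xw].
by case: h; exists x.
Qed.

(** Grouping by group element is compatible with every [mu] additive in the polynomial. It is
    applied to products in the algebra and to operators on a module, which thus see the same
    coefficients. *)
Lemma sum_collect (V : zmodType) (mu : poly -> 'M[R]_l.+2 -> V) s :
  (forall w p q, mu (p + q) w = mu p w + mu q w) ->
  \sum_(w <- finsupp (collect s)) mu (collect s w) w = \sum_(x <- s) mu x.1 x.2.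
Proof.
move=> muD; have mu0 w : mu 0 w = 0.
  by apply: (addrI (mu 0 w)); rewrite -muD !addr0.
have mu_sum w r (P : pred _) : mu (\sum_(x <- r | P x) x.1) w = \sum_(x <- r | P x) mu x.1 w.
  exact: (big_morph (mu ^~ w) (muD w) (mu0 w)).
pose A : {fset 'M[R]_l.+2} := [fset x.2 | x in s]%fset.
have -> : \sum_(w <- finsupp (collect s)) mu (collect s w) w =
          \sum_(w <- A) mu (collect s w) w.
  apply: big_fset_incl => [|w wA]; last by rewrite memNfinsupp => /eqP ->.
  by apply/fsubsetP => w /collect_supp[x xs <-]; apply/imfsetP; exists x.
transitivity (\sum_(w <- A) \sum_(x <- s | x.2 == w) mu x.1 x.2).
  apply: eq_bigr => w _; rewrite collectE mu_sum.
  by apply: eq_bigr => x /eqP ->.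
rewrite (exchange_big_dep xpredT) //= [LHS]big_seq [RHS]big_seq; apply: eq_bigr => x xs.
rewrite (big_rem x.2) /=; last by apply/imfsetP; exists x.
rewrite eqxx big_seq_cond big1 ?addr0 // => w /andP[+ /eqP xw].
by rewrite -xw mem_rem_uniq ?fset_uniq // inE eqxx.
Qed.

(** * Extending a module over the generators to the algebra *)

Section Extension.

Variables (E : lmodType R[i]) (D : 'cV[R[i]]_l.+2 -> E -> E) (W : 'M[R]_l.+2 -> E -> E).
Hypothesis cm : cherednik_module S Phi F theta Y k D W.

Variables (H : algType R[i]) (iota : {lrmorphism poly -> H}) (delta : 'M[R]_l.+2 -> H).
Hypothesis ca : cherednik_algebra S Phi F theta Y k iota delta.

Let value (s : word) : H := \sum_(x <- s) iota x.1 * delta x.2.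
Local Notation wop := (word_op D W).

Let value_cat s t : value (s ++ t) = value s + value t.
Proof. exact: big_cat. Qed.

Let word_of h : exists s, group_word s /\ h = value s.
Proof.
have [_ _ /(_ h I)[p pG <-]] := ca_pbw ca.
exists [seq (p w, w) | w <- finsupp p]; split; last by rewrite /value big_map.
by move=> x /mapP[w wp ->]; apply: pG.
Qed.

(** By the injectivity half of the PBW property the collected coefficients are zero, and they
    determine the operator of the word. *)
Let value0 s f : group_word s -> value s = 0 -> wop s f = 0.
Proof.
move=> sG s0; have [_ inj _] := ca_pbw ca.
have E1 : mult_map iota delta (collect s) = value s.
  apply: (sum_collect (mu := fun p w => iota p * delta w)) => w p q.
  by rewrite rmorphD mulrDl.
have E2 : mult_map iota delta [fsfun] = 0.
  by rewrite /mult_map finsupp0 big_seq_fset0.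
have c0 : collect s = [fsfun].
  apply: inj; rewrite ?inE /= ?E1 ?E2 //.
    by move=> w /collect_supp[x xs <-]; exact: sG.
  by rewrite finsupp0 => w.
rewrite /word_op -(sum_collect (mu := fun p w => sym_op D p (W w f))) => [|w p q].
  by rewrite c0 finsupp0 big_seq_fset0.
exact: sym_opD.
Qed.

Let value_eq s t f : group_word s -> group_word t ->
  value s = value t -> wop s f = wop t f.
Proof.
move=> sG tG st; apply/eqP; rewrite -subr_eq0 -scaleN1r -word_op_scale -word_op_cat.
apply/eqP/value0.
  apply: group_word_cat => // x /mapP[y /tG yG ->]; exact: yG.
rewrite value_cat st /value big_map -big_split big1 // => x _ /=.
by rewrite scaleN1r rmorphN mulNr subrr.
Qed.

(** Any word of value [h] may be chosen, since words of equal value act in the same way by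
    [value_eq]. *)
Let pihat h f : E := wop (projT1 (cid (word_of h))) f.

Let pihatE s f : group_word s -> pihat (value s) f = wop s f.
Proof.
rewrite /pihat; case: cid => t /= [tG tE] sG.
by apply: value_eq.
Qed.

Let pihatP h : exists2 s, group_word s & h = value s /\ pihat h =1 wop s.
Proof. by have [s [sG ->]] := word_of h; exists s => //; split=> // f; exact: pihatE. Qed.

Let pihat_lin c x y f : pihat (c *: x + y) f = c *: pihat x f + pihat y f.
Proof.
have [s sG [-> ->]] := pihatP x; have [t tG [-> ->]] := pihatP y.
have -> : c *: value s + value t = value ([seq (c *: x.1, x.2) | x <- s] ++ t).
  rewrite value_cat; congr (_ + _); rewrite /value big_map scaler_sumr.
  by apply: eq_bigr => z _; rewrite linearZ /= scalerAl.
rewrite pihatE ?word_op_cat ?word_op_scale //.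
by apply: group_word_cat => // z /mapP[u /sG uG ->].
Qed.

Let pihatD x y f : pihat (x + y) f = pihat x f + pihat y f.
Proof. exact: (linear_mapD (f := pihat^~ f) (fun c x y => pihat_lin c x y f)). Qed.

Let pihat0 f : pihat 0 f = 0.
Proof. exact: (linear_map0 (f := pihat^~ f) (fun c x y => pihat_lin c x y f)). Qed.

Let pihatZ c x f : pihat (c *: x) f = c *: pihat x f.
Proof. exact: (linear_mapZ (f := pihat^~ f) (fun c x y => pihat_lin c x y f)). Qed.

Let pihat_sum (I : Type) (r : seq I) (h : I -> H) f :
  pihat (\sum_(i <- r) h i) f = \sum_(i <- r) pihat (h i) f.
Proof. exact: (big_morph (pihat ^~ f) (fun x y => pihatD x y f) (pihat0 f)). Qed.

Let pihat_term p w f : G w -> pihat (iota p * delta w) f = sym_op D p (W w f).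
Proof.
move=> wG; have -> : iota p * delta w = value [:: (p, w)] by rewrite /value big_seq1.
rewrite pihatE ?/word_op ?big_seq1 // => x.
by rewrite inE => /eqP ->.
Qed.

Let pihat_sym p y f : pihat (iota p * y) f = sym_op D p (pihat y f).
Proof.
have [s sG [-> ->]] := pihatP y.
have -> : iota p * value s = value [seq (p * x.1, x.2) | x <- s].
  rewrite /value big_map mulr_sumr; apply: eq_bigr => x _.
  by rewrite rmorphM mulrA.
rewrite pihatE ?(word_op_sym cm) // => x /mapP[u /sG uG ->]; exact: uG.
Qed.

(** The same [c] appears in the relations of the algebra and of the module, so moving the generator
    past a variable has the same effect on both sides. *)
Let pihat_gen w (c : 'cV[R[i]]_l.+2 -> R[i]) : G w ->
  (forall v, delta w * iota (sym_vec v) =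
             iota (sym_vec (cplx w *m v)) * delta w - (c v)%:A) ->
  (forall v f, W w (D v f) = D (cplx w *m v) (W w f) - c v *: f) ->
  forall y f, pihat (delta w * y) f = W w (pihat y f).
Proof.
move=> wG crossH crossE y f.
suff term p u : G u -> pihat (delta w * (iota p * delta u)) f = W w (sym_op D p (W u f)).
  have [s sG [-> ->]] := pihatP y; rewrite /value mulr_sumr pihat_sum /word_op.
  rewrite (big_morph (W w) (fun x y => cm_WD cm x y wG) (cm_W0 cm wG)).
  by rewrite big_seq [RHS]big_seq; apply: eq_bigr => x /sG; exact: term.
move=> uG; elim/mpolyind: p => [|a m p _ _ IHp].
  rewrite rmorph0 mul0r mulr0 pihat0.
  by rewrite sym_op0l (cm_W0 cm).
rewrite linearP /= mulrDl mulrDr -scalerAl -scalerAr pihat_lin IHp sym_opP (cm_WD cm) // (cm_WZ cm) //.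
congr (_ *: _ + _); elim/multinom_ind: m => [|m i IHm].
  rewrite mpolyX0 rmorph1 mul1r (sym_op1 D) -(ca_mul ca) // -[delta _]mul1r -[1](rmorph1 iota).
  by rewrite pihat_term ?(sym_op1 D) ?(cm_WM cm) //; apply: (ext_weyl_mul rsP latY).
rewrite mpolyXD -sym_vec_delta rmorphM -(mulrA (iota (sym_vec _))) (mulrA (delta w)) crossH.
rewrite mulrBl -mulrA mulr_algl pihatD -scaleNr pihatZ scaleNr.
rewrite pihat_sym IHm pihat_term // (sym_opM cm) !(sym_op_vec cm) crossE.
by [].
Qed.

Let pihat_group w y f : G w -> pihat (delta w * y) f = W w (pihat y f).
Proof.
move=> wG; elim/(ext_weyl_generated rsP simpleF highest latY): wG y f => [b bS y f|w' w'O y f|].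
- apply: (@pihat_gen _ (fun v => k b * hform (cplx S) (cplx b) v)).
  + exact/(ext_weyl_refl rsP latY)/(affine_simple_root rsP simpleF highest).
  + by move=> v; rewrite (ca_refl ca) // cplx_mx_of_refl mul_mx_of_refl.
  + by move=> v h; exact: (cm_refl cm).
- apply: (@pihat_gen _ (fun=> 0)); first by case: w'O.
  + by move=> v; rewrite (ca_omega ca) // scale0r subr0.
  + by move=> v h; rewrite (cm_omega cm) // scale0r subr0.
move=> w1 w2 w1G w2G IH1 IH2 y f.
by rewrite (ca_mul ca) // -mulrA IH1 IH2 (cm_WM cm).
Qed.

Let pihatM x y f : pihat (x * y) f = pihat x (pihat y f).
Proof.
have [s sG [-> ->]] := pihatP x; rewrite /value mulr_suml pihat_sum /word_op.
rewrite big_seq [RHS]big_seq; apply: eq_bigr => z /sG zG.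
by rewrite -mulrA pihat_sym pihat_group.
Qed.

Lemma cherednik_module_extends : exists! pi : H -> E -> E,
  [/\ algebra_morphism_to_End pi,
      forall v f, pi (iota (sym_vec (cplx v))) f = D (cplx v) f &
      forall w f, G w -> pi (delta w) f = W w f].
Proof.
have G1 : G 1%:M := ext_weyl1 latY.
have pi1 f : pihat 1 f = f.
  rewrite -[1]mulr1 -{2}(ca_one ca) -(rmorph1 iota) pihat_term //.
  by rewrite (cm_W1 cm) (sym_op1 D).
exists pihat; split.
  split.
  - split=> //; move=> x c f h.
    have [s sG [_ sE]] := pihatP x.
    by apply: (is_word_op_linear cm); exists s.
  - move=> v f; rewrite -[iota _]mulr1 -(ca_one ca) pihat_term // (sym_op_vec cm).
    by rewrite (cm_W1 cm).
  - move=> w f wG; rewrite -[delta w]mul1r -(rmorph1 iota) pihat_term //.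
    by rewrite (sym_op1 D).
move=> pi [[pilin piP pione piM] piv piw].
have piD x y f : pi (x + y) f = pi x f + pi y f.
  by have := piP 1 x y f; rewrite !scale1r.
have piz f : pi 0 f = 0 by apply: (addrI (pi 0 f)); rewrite -piD !addr0.
have pisym p f : pi (iota p) f = sym_op D p f.
  elim/mpolyind: p f => [|a m p _ _ IHp] f.
    by rewrite sym_op0l rmorph0 piz.
  rewrite linearP /= piP IHp sym_opP; congr (_ *: _ + _).
  elim/multinom_ind: m => [|m i IHm]; first by rewrite mpolyX0 rmorph1 pione (sym_op1 D).
  rewrite mpolyXD rmorphM piM IHm -sym_vec_delta (sym_opM cm) (sym_op_vec cm).
  (* Coordinate vectors are real, so prescribing the morphism on real vectors determines it on all
     polynomials. *)
  by rewrite -cplx_delta piv.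
apply/funext => h; apply/funext => f; have [s sG [-> ->]] := pihatP h.
rewrite /value (big_morph (pi ^~ f) (fun x y => piD x y f) (piz f)) /word_op.
rewrite big_seq [RHS]big_seq; apply: eq_bigr => x /sG xG.
by rewrite piM pisym piw.
Qed.

End Extension.

End Words.

(** * Construction of the algebra on functions from the group to polynomials *)

Section Existence.

Variables (R : realType) (l : nat) (S : 'M[R]_l) (Phi : set 'cV[R]_l).
Variables (F : seq 'cV[R]_l) (theta : 'cV[R]_l) (Y : set 'cV[R]_l).
Hypothesis rsP : root_system S Phi.
Hypothesis simpleF : simple_roots Phi F.
Hypothesis highest : highest_root Phi F theta.
Hypothesis latY : translation_lattice S Phi Y.
Variable (k : 'cV[R]_l.+2 -> R[i]).
Hypothesis kinv : multiplicity S Phi Y k.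

Local Notation G := (ext_weyl S Phi Y).
Local Notation AR := (affine_roots Phi).
Local Notation AP := (affine_pos Phi F theta).
Local Notation AS := (affine_simple F theta).
Local Notation s_ a := (mx_of (refl S a)).
Local Notation poly := (mpoly l.+2 R[i]).
Local Notation word := (seq (poly * 'M[R]_l.+2)).

Let G1 : G 1%:M := ext_weyl1 latY.
Let GM w w' : G w -> G w' -> G (w *m w') := @ext_weyl_mul _ _ _ _ _ rsP latY w w'.
Let GV w : G w -> G (invmx w) := @ext_weyl_inv _ _ _ _ _ rsP latY w.
Let Gu w : G w -> w \in unitmx := @ext_weyl_unit _ _ _ _ _ rsP latY w.
Let GA w a : G w -> AR a -> AR (w *m a) := @ext_weyl_affine _ _ _ _ _ rsP latY w a.

(** The functorial action on the symmetric algebra of the linear map [w]. *)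
Definition subst_poly (w : 'M[R]_l.+2) : poly -> poly :=
  mmap (@mpolyC l.+2 R[i]) (fun j => sym_vec (cplx w *m delta_mx j 0)).

HB.instance Definition _ w := GRing.RMorphism.copy (subst_poly w)
  (mmap (@mpolyC l.+2 R[i]) (fun j => sym_vec (cplx w *m delta_mx j 0))).

Lemma subst_poly_linear w : linear (subst_poly w).
Proof. by move=> c p q; rewrite rmorphD /= /subst_poly mmapZ mul_mpolyC. Qed.

Lemma subst_polyX w j : subst_poly w (mpolyX _ (mnm1 j)) = sym_vec (cplx w *m delta_mx j 0).
Proof. by rewrite /subst_poly mmapX mmap1U. Qed.

Lemma sym_vec_sum v : sym_vec v = \sum_i v i 0 *: mpolyX R[i] (mnm1 i) :> poly.
Proof. by []. Qed.

Lemma subst_poly_vec w v : subst_poly w (sym_vec v) = sym_vec (cplx w *m v).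
Proof.
have Z c p : subst_poly w (c *: p) = c *: subst_poly w p.
  by have := subst_poly_linear w c p 0; rewrite rmorph0 !addr0.
rewrite [in LHS]sym_vec_sum rmorph_sum /= {2}(col_sum_delta v) mulmx_sumr.
have sD (r : seq 'I_l.+2) (h : 'I_l.+2 -> 'cV[R[i]]_l.+2) (c : 'I_l.+2 -> R[i]) :
    sym_vec (\sum_(j <- r) c j *: h j) = \sum_(j <- r) c j *: sym_vec (h j) :> poly.
  elim: r => [|j r IHr].
    by rewrite !big_nil sym_vec_sum big1 // => i _; rewrite mxE scale0r.
  by rewrite !big_cons sym_vecP IHr.
under [in RHS]eq_bigr => j _ do rewrite -scalemxAr.
by rewrite sD; apply: eq_bigr => j _; rewrite Z subst_polyX.
Qed.

Lemma poly_rmorph_eq (f h : {rmorphism poly -> poly}) :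
  linear f -> linear h ->
  (forall j, f (mpolyX _ (mnm1 j)) = h (mpolyX _ (mnm1 j))) -> f =1 h.
Proof.
move=> linf linh fh; apply: mpoly_eq_lin => // m.
elim/multinom_ind: m => [|m i IHm]; first by rewrite mpolyX0 !rmorph1.
by rewrite mpolyXD !rmorphM /= IHm fh.
Qed.

Lemma subst_poly1 p : subst_poly 1%:M p = p.
Proof.
apply: (poly_rmorph_eq (f := subst_poly 1%:M) (h := idfun)) => [|//|j].
  exact: subst_poly_linear.
by rewrite /= subst_polyX cplx1 mul1mx sym_vec_delta.
Qed.

Lemma subst_polyM w w' p : subst_poly (w *m w') p = subst_poly w (subst_poly w' p).
Proof.
apply: (poly_rmorph_eq (f := subst_poly (w *m w')) (h := subst_poly w \o subst_poly w')).
- exact: subst_poly_linear.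
- by move=> c q q' /=; rewrite !subst_poly_linear.
by move=> j /=; rewrite !subst_polyX subst_poly_vec cplxM mulmxA.
Qed.

Definition mulX (j : 'I_l.+2) (p : poly) : poly := mpolyX _ (mnm1 j) * p.

Lemma poly_coefficient_space : coefficient_space S Phi Y subst_poly mulX.
Proof.
split.
- by move=> w _; exact: subst_poly_linear.
- exact: subst_poly1.
- by move=> w w' p _ _; exact: subst_polyM.
- by move=> j c p q; rewrite /mulX mulrDr scalerAr.
- by move=> i j p; rewrite /mulX mulrCA.
move=> w j p _; rewrite /mulX rmorphM /= subst_polyX sym_vec_sum mulr_suml.
apply: eq_bigr => i _; rewrite -scalerAl; congr (_ *: _).
by rewrite -colE !mxE.
Qed.

Definition weyl_elt := {w : 'M[R]_l.+2 | G w}.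

Definition weyl_elt_mul (w : 'M[R]_l.+2) (x : weyl_elt) : weyl_elt :=
  if pselect (G w) is left wG then exist _ (w *m sval x) (GM wG (svalP x)) else x.

(** The sign of [a] on the image under [x] of the fundamental chamber, on which all positive roots
    are positive. *)
Definition weyl_neg (a : 'cV[R]_l.+2) (x : weyl_elt) : bool :=
  `[< AP (- (invmx (sval x) *m a)) >].

Let weyl_elt_mulE w x : G w -> sval (weyl_elt_mul w x) = w *m sval x.
Proof. by rewrite /weyl_elt_mul; case: pselect. Qed.

Let weyl_elt_eq (x y : weyl_elt) : sval x = sval y -> x = y.
Proof. by case: x y => x xG [y yG] /= E; subst y; congr exist; exact: Prop_irrelevance. Qed.

Lemma weyl_sign_space : sign_space S Phi F theta Y weyl_elt_mul weyl_neg.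
Proof.
split.
- by move=> x; apply: weyl_elt_eq; rewrite weyl_elt_mulE // mul1mx.
- move=> w w' x wG w'G; apply: weyl_elt_eq.
  by rewrite !weyl_elt_mulE ?mulmxA //; exact: GM.
- move=> w a x wG ra; rewrite /weyl_neg weyl_elt_mulE //.
  congr (`[< AP (- _) >]); have xG := svalP x.
  rewrite -[in RHS](mulKmx (Gu wG) a) !mulmxA; congr (_ *m _ *m _).
  apply: (can_inj (mulKmx (Gu (GM wG xG)))).
  by rewrite mulmxV ?Gu ?mulmxA -?mulmxA ?mulKVmx ?mulmxV ?Gu //; exact: GM.
- move=> a x ra; rewrite /weyl_neg mulmxN opprK.
  have rb : AR (invmx (sval x) *m a) by apply: GA => //; apply/GV/svalP.
  have [pb|nb] := affine_pos_or_neg rsP simpleF highest rb.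
    rewrite (asboolT pb); apply/esym/negP => /asboolP.
    exact: (affine_pos_opp rsP simpleF pb).
  rewrite (asboolT nb); apply/asboolPn => pb.
  exact: (affine_pos_opp rsP simpleF pb).
- move=> x; apply: sub_finite_set (finite_inversions F theta rsP (GV (svalP x))).
  by move=> a [pa /asboolP].
move=> x nonneg a pa; apply/asboolPn.
apply: (affine_pos_opp rsP simpleF).
apply: (pos_on_simple rsP latY (GV (svalP x))) => // b bS.
have rb : AR (invmx (sval x) *m b).
  by apply: GA; [apply/GV/svalP|exact: (affine_simple_root rsP simpleF highest)].
have [//|nb] := affine_pos_or_neg rsP simpleF highest rb.
by have /asboolPn := nonneg b bS.
Qed.

Definition poly_fun : lmodType R[i] := (weyl_elt -> poly)%type.

Definition poly_dunkl : 'cV[R[i]]_l.+2 -> poly_fun -> poly_fun :=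
  dunkl_op S Phi F theta k weyl_elt_mul weyl_neg subst_poly mulX.

Definition poly_group : 'M[R]_l.+2 -> poly_fun -> poly_fun :=
  group_op weyl_elt_mul subst_poly.

Lemma poly_module : cherednik_module S Phi F theta Y k poly_dunkl poly_group.
Proof.
exact: (dunkl_cherednik_module rsP simpleF highest latY kinv weyl_sign_space poly_coefficient_space).
Qed.

Local Notation wop := (word_op poly_dunkl poly_group).

Definition weyl_one : weyl_elt := exist _ 1%:M G1.

(** The indicator of the inverse of [w]: acting by [w] brings its value 1 to the point [1], and any
    other group element brings 0 there. *)
Definition point_fun (w : 'M[R]_l.+2) : poly_fun :=
  fun x => if sval x == invmx w then 1 else 0.

Let dunkl_at1 v (f : poly_fun) : poly_dunkl v f weyl_one = sym_vec v * f weyl_one.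
Proof.
rewrite /poly_dunkl /dunkl_op.
have -> : neg_roots Phi F theta weyl_neg weyl_one = set0.
  apply/seteqP; split=> // a [pa /asboolP]; rewrite /= invmx1 mul1mx.
  exact: (affine_pos_opp rsP simpleF pa).
rewrite fset_set0 big_seq_fset0 subr0 /del_vec sym_vec_sum mulr_suml.
by apply: eq_bigr => i _; rewrite /mulX scalerAl.
Qed.

Let sym_op_at1 p (f : poly_fun) : sym_op poly_dunkl p f weyl_one = p * f weyl_one.
Proof.
have cm := poly_module.
move: p; apply: (mpoly_eq_lin (f := fun p => sym_op poly_dunkl p f weyl_one)).
- by move=> c p q; rewrite sym_opP.
- by move=> c p q; rewrite mulrDl -scalerAl.
elim/multinom_ind => [|m i IHm]; first by rewrite mpolyX0 sym_op1 mul1r.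
by rewrite mpolyXD (sym_opM cm) -sym_vec_delta (sym_op_vec cm) dunkl_at1 IHm mulrA.
Qed.

(* The component at [1] of the operator of a word applied to [point_fun w] is
   the coefficient of [w]. *)
Lemma word_coefficient s w : group_word S Phi Y s -> G w ->
  wop s (point_fun w) weyl_one = \sum_(x <- s | x.2 == w) x.1.
Proof.
move=> sG wG; rewrite big_mkcond /word_op.
have sumE (r : word) (h : poly * 'M[R]_l.+2 -> poly_fun) :
    (\sum_(x <- r) h x) weyl_one = \sum_(x <- r) h x weyl_one.
  by elim: r => [|x r IHr]; rewrite ?big_nil // !big_cons -IHr.
rewrite sumE big_seq [RHS]big_seq; apply: eq_bigr => x /sG xG.
rewrite sym_op_at1 /poly_group /group_op /point_fun weyl_elt_mulE; last exact: GV.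
rewrite mulmx1 (can_eq (@invmxK _ _)).
by case: eqP => _; rewrite ?rmorph1 ?rmorph0 ?mulr1 ?mulr0.
Qed.

(** The algebra consists of the operators given by words, which are closed under composition because
    group elements can be moved to the right of polynomials. *)
Definition hecke_pred : {pred poly_fun -> poly_fun} :=
  [pred phi | `[< is_word_op S Phi Y poly_dunkl poly_group phi >]].

Lemma hecke_submod : submod_closed hecke_pred.
Proof.
split; first by apply/asboolP/is_word_op0.
move=> c phi psi /asboolP wphi /asboolP wpsi; apply/asboolP.
apply: (is_word_opD (phi := fun f => c *: phi f)) => //.
exact: is_word_opZ.
Qed.

Record hecke := Hecke { hecke_val :> poly_fun -> poly_fun; _ : hecke_val \in hecke_pred }.

HB.instance Definition _ := [isSub of hecke for hecke_val].
HB.instance Definition _ := [Choice of hecke by <:].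
HB.instance Definition _ :=
  GRing.isSubmodClosed.Build R[i] (poly_fun -> poly_fun) hecke_pred hecke_submod.
HB.instance Definition _ := [SubChoice_isSubLmodule of hecke by <:].

Lemma heckeP (x : hecke) : is_word_op S Phi Y poly_dunkl poly_group x.
Proof. by case: x => phi /= /asboolP. Qed.

Lemma hecke_eq (x y : hecke) : x =1 y :> (poly_fun -> poly_fun) -> x = y.
Proof. by move=> xy; apply/val_inj/funext. Qed.

Definition hecke_of phi (w : is_word_op S Phi Y poly_dunkl poly_group phi) : hecke :=
  Hecke (asboolT w : phi \in hecke_pred).

Definition hecke_one : hecke :=
  hecke_of (is_word_op_ext (cm_W1 poly_module) (is_word_op_group poly_dunkl poly_group G1)).

Definition hecke_mul (x y : hecke) : hecke :=
  hecke_of (is_word_op_comp rsP simpleF highest latY poly_module (heckeP x) (heckeP y)).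

Let heckeD (x y : hecke) f : (x + y : hecke) f = x f + y f.
Proof. by []. Qed.

Let heckeZ c (x : hecke) f : (c *: x : hecke) f = c *: x f.
Proof. by []. Qed.

Let hecke_linear (x : hecke) : linear x.
Proof. exact: (is_word_op_linear poly_module (heckeP x)). Qed.

Let hecke_mulA : associative hecke_mul.
Proof. by move=> x y z; apply: hecke_eq. Qed.

Let hecke_mul1 : left_id hecke_one hecke_mul.
Proof. by move=> x; apply: hecke_eq. Qed.

Let hecke_mulr1 : right_id hecke_one hecke_mul.
Proof. by move=> x; apply: hecke_eq. Qed.

Let hecke_mulDl : left_distributive hecke_mul +%R.
Proof. by move=> x y z; apply: hecke_eq. Qed.

Let hecke_mulDr : right_distributive hecke_mul +%R.
Proof.
move=> x y z; apply: hecke_eq => f.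
rewrite -[LHS]/(x (y f + z f)) -[RHS]/(x (y f) + x (z f)).
exact: (linear_mapD (hecke_linear x)).
Qed.

Let hecke_one_neq0 : hecke_one != 0.
Proof.
apply/eqP => /(congr1 (fun x : hecke => x (fun=> 1) weyl_one)) /= /eqP.
by rewrite oner_eq0.
Qed.

HB.instance Definition _ := GRing.Zmodule_isNzRing.Build hecke
  hecke_mulA hecke_mul1 hecke_mulr1 hecke_mulDl hecke_mulDr hecke_one_neq0.

Let hecke_scalerAl c (x y : hecke) : c *: (x * y) = (c *: x) * y.
Proof. exact: hecke_eq. Qed.

HB.instance Definition _ := GRing.Lmodule_isLalgebra.Build R[i] hecke hecke_scalerAl.

Let hecke_scalerAr c (x y : hecke) : c *: (x * y) = x * (c *: y).
Proof. by apply: hecke_eq => f; rewrite heckeZ; exact/esym/(linear_mapZ (hecke_linear x)). Qed.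

HB.instance Definition _ := GRing.Lalgebra_isAlgebra.Build R[i] hecke hecke_scalerAr.

Let sym_op_word p : is_word_op S Phi Y poly_dunkl poly_group (sym_op poly_dunkl p).
Proof.
apply: (is_word_op_ext (phi := fun f => sym_op poly_dunkl p (poly_group 1%:M f))).
  by move=> f; rewrite (cm_W1 poly_module).
exact/(is_word_op_sym poly_module)/is_word_op_group.
Qed.

Definition hecke_sym (p : poly) : hecke := hecke_of (sym_op_word p).

Definition hecke_group (w : 'M[R]_l.+2) : hecke :=
  if pselect (G w) is left wG then hecke_of (is_word_op_group poly_dunkl poly_group wG)
  else 0.

Let hecke_groupE w f : G w -> hecke_group w f = poly_group w f.
Proof. by rewrite /hecke_group; case: pselect. Qed.

Let hecke_symE p f : hecke_sym p f = sym_op poly_dunkl p f.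
Proof. by []. Qed.

Let heckeM (x y : hecke) f : (x * y : hecke) f = x (y f).
Proof. by []. Qed.

Let hecke_sym_linear : linear hecke_sym.
Proof. by move=> c p q; apply: hecke_eq => f; exact: sym_opP. Qed.

HB.instance Definition _ := GRing.isLinear.Build R[i] poly hecke *:%R hecke_sym hecke_sym_linear.

Let hecke_sym_multiplicative : monoid_morphism hecke_sym.
Proof.
split=> [|p q]; apply: hecke_eq => f; first exact: sym_op1.
exact: (sym_opM poly_module).
Qed.

HB.instance Definition _ := GRing.isMonoidMorphism.Build poly hecke hecke_sym hecke_sym_multiplicative.

Let hecke_sum (I : Type) (r : seq I) (h : I -> hecke) f :
  (\sum_(i <- r) h i : hecke) f = \sum_(i <- r) h i f.
Proof. by elim: r => [|i r IHr]; rewrite ?big_nil // !big_cons heckeD IHr. Qed.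

Let value_coefficient s w : group_word S Phi Y s -> G w ->
  (\sum_(x <- s) hecke_sym x.1 * hecke_group x.2 : hecke) (point_fun w) weyl_one =
  \sum_(x <- s | x.2 == w) x.1.
Proof.
move=> sG wG; rewrite -word_coefficient // hecke_sum /word_op big_seq.
apply: (congr1 (fun g : poly_fun => g weyl_one)); rewrite [RHS]big_seq; apply: eq_bigr => x /sG xG.
by rewrite heckeM hecke_groupE.
Qed.

(** The map [h] turns coefficients into polynomials: the identity for the multiplication map,
    constants for the group algebra. One computation of coefficients settles both injectivity
    claims. *)
Let fsfun_word (V : eqType) (z : V) (x : {fsfun 'M[R]_l.+2 -> V with z}) (h : V -> poly) : word :=
  [seq (h (x w), w) | w <- finsupp x].

Let fsfun_word_coefficient (V : eqType) (z : V) (x : {fsfun 'M[R]_l.+2 -> V with z})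
    (h : V -> poly) w : h z = 0 ->
  \sum_(y <- fsfun_word x h | y.2 == w) y.1 = h (x w).
Proof.
move=> hz; rewrite big_map /=; have [wx|wx] := boolP (w \in finsupp x).
  rewrite big_mkcond (big_rem w) //= eqxx big_seq big1 ?addr0 // => u.
  by rewrite mem_rem_uniq ?fset_uniq // inE => /andP[/negPf -> _].
rewrite big_seq_cond big1 => [|u /andP[ux /eqP uw]]; last by rewrite -uw ux in wx.
by move: wx; rewrite memNfinsupp => /eqP ->; rewrite hz.
Qed.

Lemma cherednik_algebra_exists :
  exists (H : algType R[i]) (iota : {lrmorphism poly -> H}) (delta : 'M[R]_l.+2 -> H),
    cherednik_algebra S Phi F theta Y k iota delta.
Proof.
exists hecke, hecke_sym, hecke_group; have cm := poly_module.
have mult_mapE p : mult_map hecke_sym hecke_group p =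
    \sum_(x <- fsfun_word p id) hecke_sym x.1 * hecke_group x.2.
  by rewrite big_map.
have wordG (V : eqType) (z : V) (x : {fsfun 'M[R]_l.+2 -> V with z}) h :
    [set` finsupp x] `<=` G -> group_word S Phi Y (fsfun_word x h).
  by move=> xG _ /mapP[w wx ->]; exact: xG.
have nsupp (V : choiceType) (z : V) (u : {fsfun 'M[R]_l.+2 -> V with z}) w :
    [set` finsupp u] `<=` G -> ~ G w -> u w = z.
  by move=> uG wG; apply/eqP; rewrite -memNfinsupp; apply/negP => /uG.
have simpleG a : a \in AS -> G (s_ a).
  by move=> aS; exact/(ext_weyl_refl rsP latY)/(affine_simple_root rsP simpleF highest).
split.
- move=> p q pq; have G1' : group_word S Phi Y [:: (p, 1%:M)].
    by move=> x; rewrite inE => /eqP ->.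
  (* Evaluated at [1] on the constant function 1, the operator returns the polynomial. *)
  have := congr1 (fun x : hecke => x (fun=> 1) weyl_one) pq.
  by rewrite !hecke_symE !sym_op_at1 !mulr1.
- by apply: hecke_eq => f; rewrite hecke_groupE // (cm_W1 cm).
- move=> w w' wG w'G; apply: hecke_eq => f.
  by rewrite heckeM !hecke_groupE ?(cm_WM cm) //; exact: GM.
- move=> x y; rewrite !inE => xG yG xy; apply/fsfunP => w.
  have groupE (u : {fsfun 'M[R]_l.+2 -> R[i] with 0}) : group_alg_map hecke_group u =
      \sum_(z <- fsfun_word u (@mpolyC l.+2 R[i])) hecke_sym z.1 * hecke_group z.2.
    rewrite big_map; apply: eq_bigr => v _ /=.
    by rewrite -[mpolyC _ _]alg_mpolyC linearZ /= rmorph1 -scalerAl mul1r.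
  have [wG|wG] := pselect (G w); last first.
    by rewrite !nsupp.
  have := congr1 (fun h : hecke => h (point_fun w) weyl_one) xy.
  rewrite !groupE !value_coefficient //; try exact: wordG.
  rewrite !fsfun_word_coefficient ?mpolyC0 //.
  by move=> /(congr1 (mcoeff (@mnm0 _))); rewrite !mpolyCK.
- split; first by [].
    move=> p q; rewrite !inE => pG qG pq; apply/fsfunP => w.
    have [wG|wG] := pselect (G w); last first.
      by rewrite !nsupp.
    have := congr1 (fun h : hecke => h (point_fun w) weyl_one) pq.
    rewrite !mult_mapE !value_coefficient //; try exact: wordG.
    by rewrite !fsfun_word_coefficient.
  (* Surjectivity: the preimage is the collected form of a word that gives the operator [h]. *)
  move=> h _; have [s sG sE] := heckeP h; exists (collect s).
    by move=> w /collect_supp[x xs <-]; exact: sG.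
  rewrite /mult_map (sum_collect (mu := fun p w => hecke_sym p * hecke_group w)).
    apply: hecke_eq => f; rewrite sE hecke_sum /word_op big_seq [RHS]big_seq.
    by apply: eq_bigr => x /sG xG; rewrite heckeM hecke_groupE.
  by move=> w p q; rewrite rmorphD mulrDl.
- move=> a x aS; apply: hecke_eq => f.
  have subE (u : hecke) (c : R[i]) g : (u - c%:A : hecke) g = u g - c *: g by [].
  rewrite subE.
  rewrite !heckeM !(hecke_groupE _ (simpleG a aS)).
  change (poly_group (s_ a) (sym_op poly_dunkl (sym_vec x) f) =
    sym_op poly_dunkl (sym_vec (refl (cplx S) (cplx a) x)) (poly_group (s_ a) f) -
    (k a * hform (cplx S) (cplx a) x) *: f).
  rewrite (sym_op_vec cm x) (sym_op_vec cm (refl (cplx S) (cplx a) x)).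
  rewrite (cm_refl cm x f aS) cplx_mx_of_refl mul_mx_of_refl.
  reflexivity.
move=> w x wO; have wG : G w by case: wO.
apply: hecke_eq => f; rewrite !heckeM !(hecke_groupE _ wG).
change (poly_group w (sym_op poly_dunkl (sym_vec x) f) =
  sym_op poly_dunkl (sym_vec (cplx w *m x)) (poly_group w f)).
rewrite (sym_op_vec cm x) (sym_op_vec cm (cplx w *m x)).
exact (cm_omega cm x f wO).
Qed.

End Existence.

(** * Estimates for homogeneous polynomials *)

Section HomogeneousBounds.

Variables (R : realType) (n : nat).
Implicit Types (p q : mpoly n R) (x y v h : 'cV[R]_n).

Definition homog d p := forall m, mdeg m != d -> mcoeff m p = 0.

Lemma homogP d p : reflect (homog d p) (p \is ishomog1 d (@mdeg n)).
Proof.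
apply: (iffP (@dhomogP _ _ _ _ _)) => [hp m|hp m mp].
  by apply: contra_neq_eq; rewrite -mcoeff_msupp => /hp.
by apply/eqP; apply: contraTT mp => /hp; rewrite mcoeff_msupp => ->; rewrite eqxx.
Qed.

Lemma homog_lin d c p q : homog d p -> homog d q -> homog d (c *: p + q).
Proof. by move=> hp hq m md; rewrite linearP /= hp // hq // mulr0 addr0. Qed.

Lemma homog0 d : homog d 0.
Proof. by move=> m _; rewrite mcoeff0. Qed.

Lemma homogM d e p q : homog d p -> homog e q -> homog (d + e) (p * q).
Proof. by move=> /homogP hp /homogP hq; apply/homogP; exact: dhomogM. Qed.

Lemma homogX m : homog (mdeg m) (mpolyX R m).
Proof. by apply/homogP; rewrite dhomogX. Qed.

Lemma homog_msupp d p m : homog d p -> m \in msupp p -> mdeg m = d.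
Proof. by move=> /homogP /dhomogP; apply. Qed.

(** The l1 norm of the coefficients. With it a bound for a linear map need only be checked on
    monomials, where induction applies. *)
Definition pnorm p : R := \sum_(m <- msupp p) `|mcoeff m p|.

Lemma pnorm_widen s p : uniq s -> {subset msupp p <= s} ->
  pnorm p = \sum_(m <- s) `|mcoeff m p|.
Proof.
move=> us sub; rewrite [RHS](bigID (mem (msupp p))) /= [X in _ + X]big1 ?addr0.
  rewrite -big_filter; apply: perm_big; apply: uniq_perm.
  - exact: msupp_uniq.
  - exact: filter_uniq.
  by move=> m; rewrite mem_filter; case: (boolP (m \in msupp p)) => // /sub ->.
by move=> m /memN_msupp_eq0 ->; rewrite normr0.
Qed.

Lemma pnorm_ge0 p : 0 <= pnorm p.
Proof. by apply: sumr_ge0 => m _. Qed.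

Lemma pnorm0 : pnorm 0 = 0.
Proof. by rewrite (pnorm_widen (s := [::])) ?big_nil // => m; rewrite mcoeff_msupp mcoeff0 eqxx. Qed.

Lemma pnorm_lin c p q : pnorm (c *: p + q) <= `|c| * pnorm p + pnorm q.
Proof.
pose s := undup (msupp p ++ msupp q ++ msupp (c *: p + q)).
rewrite !(@pnorm_widen s) ?undup_uniq //.
- rewrite mulr_sumr -big_split; apply: ler_sum => m _ /=.
  by rewrite linearP /= (le_trans (ler_normD _ _)) // normrM.
- by move=> m mq; rewrite mem_undup !mem_cat mq !orbT.
- by move=> m mp; rewrite mem_undup !mem_cat mp.
- by move=> m mpq; rewrite mem_undup !mem_cat mpq !orbT.
Qed.

Lemma pnormX m : pnorm (mpolyX R m) = 1.
Proof. by rewrite /pnorm msuppX big_seq1 mcoeffX eqxx normr1. Qed.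

Lemma functional_bound (T : mpoly n R -> R) d K p :
  (forall c q q', T (c *: q + q') = c * T q + T q') ->
  homog d p -> (forall m, mdeg m = d -> `|T (mpolyX R m)| <= K) ->
  `|T p| <= pnorm p * K.
Proof.
move=> Tlin hp TX; have T0 : T 0 = 0.
  by have := Tlin (- 1) 0 0; rewrite scaler0 addr0 mulN1r addNr.
rewrite {1}(mpolyE p) /pnorm big_seq [X in _ <= X * _]big_seq mulr_suml.
elim/big_rec2: _ => [|m x q mp IH]; first by rewrite T0 normr0.
rewrite Tlin (le_trans (ler_normD _ _)) // lerD // normrM ler_wpM2l //.
exact/TX/(homog_msupp hp).
Qed.

Lemma operator_bound (T : mpoly n R -> mpoly n R) d K p :
  (forall c q q', T (c *: q + q') = c *: T q + T q') ->
  homog d p -> (forall m, mdeg m = d -> pnorm (T (mpolyX R m)) <= K) ->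
  pnorm (T p) <= pnorm p * K.
Proof.
move=> Tlin hp TX; have T0 : T 0 = 0 := linear_map0 Tlin.
rewrite {1}(mpolyE p) /pnorm -/(pnorm _) big_seq [X in _ <= X * _]big_seq mulr_suml.
elim/big_rec2: _ => [|m x q mp IH]; first by rewrite T0 pnorm0.
rewrite Tlin (le_trans (pnorm_lin _ _ _)) // lerD // ler_wpM2l //.
exact/TX/(homog_msupp hp).
Qed.

Definition ev p y : R := meval (fun i => y i 0) p.

Lemma ev_lin c p q y : ev (c *: p + q) y = c * ev p y + ev q y.
Proof. by rewrite /ev mevalD mevalZ. Qed.

Lemma evD p q y : ev (p + q) y = ev p y + ev q y.
Proof. by rewrite /ev mevalD. Qed.

Lemma evM p q y : ev (p * q) y = ev p y * ev q y.
Proof. by rewrite /ev mevalM. Qed.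

Lemma evXi i y : ev (mpolyX R (mnm1 i)) y = y i 0.
Proof. by rewrite /ev mevalXU. Qed.

Lemma ev1 y : ev 1 y = 1.
Proof. by rewrite /ev meval1. Qed.

Lemma ev_bound d p y s : homog d p -> (forall i, `|y i 0| <= s) ->
  `|ev p y| <= pnorm p * s ^+ d.
Proof.
move=> hp ys; apply: (functional_bound (T := ev ^~ y) _ hp) => [c q q'|m <-].
  exact: ev_lin.
elim/multinom_ind: m => [|m i IHm]; first by rewrite mpolyX0 ev1 normr1 mdeg0 expr0.
rewrite mpolyXD evM evXi normrM mdegD mdeg1 exprS ler_pM //.
Qed.

Definition dirderiv v p : mpoly n R := \sum_i v i 0 *: mderiv i p.

Lemma dirderiv_lin v c p q : dirderiv v (c *: p + q) = c *: dirderiv v p + dirderiv v q.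
Proof.
rewrite /dirderiv scaler_sumr -big_split; apply: eq_bigr => i _ /=.
by rewrite linearP /= scalerDr !scalerA mulrC.
Qed.

Lemma dirderiv_vec c u v p : dirderiv (c *: u + v) p = c *: dirderiv u p + dirderiv v p.
Proof.
rewrite /dirderiv scaler_sumr -big_split; apply: eq_bigr => i _ /=.
by rewrite !mxE scalerDl scalerA.
Qed.

Lemma dirderivM v p q : dirderiv v (p * q) = dirderiv v p * q + p * dirderiv v q.
Proof.
rewrite /dirderiv mulr_suml mulr_sumr -big_split; apply: eq_bigr => i _ /=.
by rewrite mderivM scalerDr scalerAl scalerAr.
Qed.

Lemma ev_dirderivXi v i y : ev (dirderiv v (mpolyX R (mnm1 i))) y = v i 0.
Proof.
rewrite /dirderiv (bigD1 i) //= big1 ?addr0 => [|j ji].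
  rewrite mderivX mnm1E eqxx scale1r /ev mevalZ.
  have -> : mnm_sub (mnm1 i) (mnm1 i) = @mnm0 n by apply/mnmP => j; rewrite mnmBE subnn mnm0E.
  by rewrite mpolyX0 meval1 mulr1.
by rewrite mderivX mnm1E eq_sym (negPf ji) scale0r scaler0.
Qed.

Lemma dirderivC u v p : dirderiv u (dirderiv v p) = dirderiv v (dirderiv u p).
Proof.
have E a b : dirderiv a (dirderiv b p) =
    \sum_i \sum_j (a i 0 * b j 0) *: mderiv i (mderiv j p).
  apply: eq_bigr => i _; rewrite /dirderiv [mderiv i _]raddf_sum scaler_sumr.
  by apply: eq_bigr => j _; rewrite /= mderivZ scalerA.
rewrite !E exchange_big; apply: eq_bigr => i _; apply: eq_bigr => j _ /=.
by rewrite mulrC mderiv_comm.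
Qed.

Lemma homog_dirderiv d v p : homog d.+1 p -> homog d (dirderiv v p).
Proof.
move=> hp m md; rewrite /dirderiv linear_sum big1 // => i _ /=.
rewrite linearZ /= mcoeff_deriv hp ?mul0rn ?mulr0 //.
by rewrite mdegD mdeg1 addn1 eqSS.
Qed.

Lemma dirderiv_homog0 v p : homog 0 p -> dirderiv v p = 0.
Proof.
move=> hp; apply/mpolyP => m; rewrite mcoeff0 /dirderiv linear_sum big1 // => i _ /=.
by rewrite linearZ /= mcoeff_deriv hp ?mul0rn ?mulr0 // mdegD mdeg1 addn1.
Qed.

Definition sum_abs v : R := \sum_i `|v i 0|.

Lemma pnorm_dirderiv d v p : homog d p ->
  pnorm (dirderiv v p) <= pnorm p * (d%:R * sum_abs v).
Proof.
move=> hp; apply: operator_bound hp _ => [c q q'|m md]; first exact: dirderiv_lin.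
rewrite /dirderiv /sum_abs mulr_sumr; elim/big_rec2: _ => [|i b q _ IH].
  by rewrite pnorm0.
rewrite mderivX scalerA (le_trans (pnorm_lin _ _ _)) // lerD // pnormX mulr1.
rewrite normrM mulrC ler_wpM2r // normr_nat ler_nat -md mdegE.
by rewrite (bigD1 i) //= leq_addr.
Qed.

(** A mean value estimate in multiplied form: the factor [s] on the left replaces the exponent
    [d - 1] on the right, which would single out [d = 0]. On monomials it follows by induction from
    the product rule for differences. *)
Lemma ev_diff1 d p y h s del : homog d p -> 0 <= s ->
  (forall i, `|y i 0| <= s) -> (forall i, `|(y + h) i 0| <= s) ->
  (forall i, `|h i 0| <= del) ->
  s * `|ev p (y + h) - ev p y| <= pnorm p * (del * d%:R * s ^+ d).
Proof.
move=> hp s0 ys yhs hdel; rewrite -[s in s * _]ger0_norm // -normrM.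
apply: (functional_bound (T := fun p => s * (ev p (y + h) - ev p y)) _ hp) => [c q q'|m <-].
  by rewrite !ev_lin; ring.
rewrite normrM ger0_norm //; elim/multinom_ind: m => [|m i IHm].
  by rewrite mpolyX0 !ev1 subrr normr0 mulr0 mdeg0 mulr0 mul0r.
rewrite mpolyXD !evM !evXi mdegD mdeg1 add1n.
set a := ev _ (y + h) in IHm *; set b := ev _ y in IHm *.
have -> : (y + h) i 0 * a - y i 0 * b = (y + h) i 0 * (a - b) + h i 0 * b.
  by rewrite mxE; ring.
have bs : `|b| <= s ^+ mdeg m.
  by have := ev_bound (@homogX m) ys; rewrite pnormX mul1r.
have H1 : `|(y + h) i 0 * (a - b)| <= s * `|a - b| by rewrite normrM ler_wpM2r.
have H2 : `|h i 0 * b| <= del * s ^+ mdeg m by rewrite normrM ler_pM.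
apply: (@le_trans _ _ (s * (s * `|a - b| + del * s ^+ mdeg m))).
  by rewrite ler_wpM2l // (le_trans (ler_normD _ _)) // lerD.
rewrite mulrDr (le_trans (lerD (ler_wpM2l s0 IHm) (lexx _))) // -natr1 exprS.
by rewrite le_eqVlt; apply/orP; left; apply/eqP; ring.
Qed.

(** The remainder of the first order Taylor expansion, multiplied by [s ^+ 2] for the same reason.
    Splitting off one variable leaves its increment times a first difference, which [ev_diff1]
    bounds. *)
Lemma ev_diff2 d p y h s del : homog d p -> 0 <= s ->
  (forall i, `|y i 0| <= s) -> (forall i, `|(y + h) i 0| <= s) ->
  (forall i, `|h i 0| <= del) -> 0 <= del ->
  s ^+ 2 * `|ev p (y + h) - ev p y - ev (dirderiv h p) y| <=
    pnorm p * (del ^+ 2 * d%:R ^+ 2 * s ^+ d).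
Proof.
move=> hp s0 ys yhs hdel del0; have s20 : 0 <= s ^+ 2 by rewrite exprn_ge0.
rewrite -[X in X * _](ger0_norm s20) -normrM.
apply: (functional_bound
  (T := fun p => s ^+ 2 * (ev p (y + h) - ev p y - ev (dirderiv h p) y)) _ hp) => [c q q'|m <-].
  by rewrite dirderiv_lin !ev_lin; ring.
rewrite normrM (ger0_norm s20); elim/multinom_ind: m => [|m i IHm].
  rewrite mpolyX0 !ev1 subrr sub0r dirderiv_homog0 => [|m]; last first.
    by rewrite mcoeff1 mdeg_eq0 => /negPf ->.
  by rewrite /ev meval0 oppr0 normr0 mulr0 mdeg0 expr0n mulr0 mul0r.
rewrite mpolyXD dirderivM evD !evM !evXi ev_dirderivXi mdegD mdeg1 add1n.
have D1 := ev_diff1 (@homogX m) s0 ys yhs hdel; rewrite pnormX mul1r in D1.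
set a := ev _ (y + h) in IHm D1 *; set b := ev _ y in IHm D1 *.
set e := ev _ y in IHm *.
have -> : (y + h) i 0 * a - y i 0 * b - (h i 0 * b + y i 0 * e) =
    y i 0 * (a - b - e) + h i 0 * (a - b) by rewrite mxE; ring.
have H1 : `|y i 0 * (a - b - e)| <= s * `|a - b - e| by rewrite normrM ler_wpM2r.
have H2 : `|h i 0 * (a - b)| <= del * `|a - b| by rewrite normrM ler_wpM2r.
apply: (@le_trans _ _ (s * (s ^+ 2 * `|a - b - e|) + del * s * (s * `|a - b|))).
  have -> : s * (s ^+ 2 * `|a - b - e|) + del * s * (s * `|a - b|) =
    s ^+ 2 * (s * `|a - b - e| + del * `|a - b|) by ring.
  by rewrite ler_wpM2l ?exprn_ge0 // (le_trans (ler_normD _ _)) // lerD.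
apply: (@le_trans _ _ (s * (del ^+ 2 * (mdeg m)%:R ^+ 2 * s ^+ mdeg m) +
    del * s * (del * (mdeg m)%:R * s ^+ mdeg m))).
  by rewrite lerD // ler_wpM2l // mulr_ge0.
rewrite -(natr1 (mdeg m)) (exprS s (mdeg m)); set D := (mdeg m)%:R; set T := s ^+ mdeg m.
have T0 : 0 <= T by rewrite exprn_ge0.
have D0 : 0 <= D by [].
rewrite -subr_ge0.
have -> : del ^+ 2 * (D + 1) ^+ 2 * (s * T) -
   (s * (del ^+ 2 * D ^+ 2 * T) + del * s * (del * D * T)) =
   del ^+ 2 * (s * T) * (D + 1) by ring.
by rewrite !mulr_ge0 ?exprn_ge0 ?addr_ge0.
Qed.

End HomogeneousBounds.

(** * Power series as sums of homogeneous polynomials *)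

Section PowerSeries.

Variables (R : realType) (n : nat).
Implicit Types (p q : mpoly n R) (x y v h : 'cV[R]_n) (P : nat -> mpoly n R).

Lemma cV_entry_le x i : `|x i 0| <= `|x|.
Proof. by rewrite [leRHS]mx_normrE (le_bigmax _ (fun ij => `|x ij.1 ij.2|) (i, 0)). Qed.

Lemma cV_norm_le x c : 0 <= c -> (forall i, `|x i 0| <= c) -> `|x| <= c.
Proof.
move=> c0 xc; rewrite [leLHS]mx_normrE; apply: bigmax_le => // -[i j] _ /=.
by rewrite (ord1 j).
Qed.

(** A Cauchy estimate: it forces convergence where [K] times the largest coordinate is less than
    1. *)
Definition bounded_homog P B K := forall d, homog d (P d) /\ pnorm (P d) <= B * K ^+ d.

Definition psum P y (m : nat) : R := \sum_(d < m) ev (P d) y.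

Lemma sqr_le_expn4 d : (d ^ 2 <= 4 ^ d)%N.
Proof.
have : (d <= 2 ^ d)%N by rewrite ltnW // ltn_expl.
by rewrite -leq_sqr -expnM mulnC expnM.
Qed.

Lemma sum_half_le m : \sum_(d < m) (2%:R^-1 : R) ^+ d <= 2%:R.
Proof.
suff -> : \sum_(d < m) (2%:R^-1 : R) ^+ d = 2%:R - 2%:R * 2%:R^-1 ^+ m.
  by rewrite lerBlDr lerDl mulr_ge0 ?exprn_ge0 ?invr_ge0.
elim: m => [|m IHm]; first by rewrite big_ord0 expr0 mulr1 subrr.
by rewrite big_ord_recr /= IHm exprS; field.
Qed.

Lemma bounded_homog_ge0 P B K : bounded_homog P B K -> 0 <= B.
Proof. by move=> /(_ 0%N)[_]; rewrite expr0 mulr1; apply/le_trans/pnorm_ge0. Qed.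

Lemma ev_term_bound P B K y s c : bounded_homog P B K -> 0 <= s -> 0 <= K -> K * s <= c ->
  (forall i, `|y i 0| <= s) -> forall d, `|ev (P d) y| <= B * c ^+ d.
Proof.
move=> bP s0 K0 Kc ys d; have [hP nP] := bP d.
apply: (le_trans (ev_bound hP ys)); have B0 := bounded_homog_ge0 bP.
apply: (le_trans (ler_wpM2r (exprn_ge0 d s0) nP)).
rewrite -mulrA -exprMn ler_wpM2l //.
by apply: lerXn2r; rewrite ?nnegrE ?mulr_ge0 //; apply: le_trans Kc; rewrite mulr_ge0.
Qed.

Lemma psum_cvg P B K y s : bounded_homog P B K -> 0 <= s -> 0 <= K ->
  K * s <= 2%:R^-1 -> (forall i, `|y i 0| <= s) -> cvgn (psum P y).
Proof.
move=> bP s0 K0 Ks ys; have B0 := bounded_homog_ge0 bP.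
have -> : psum P y = series (fun d => ev (P d) y).
  by apply/funext => m; rewrite /series /= big_mkord.
apply: normed_cvg; apply: (@series_le_cvg _ _ (geometric B 2%:R^-1)).
- by move=> d /=.
- by move=> d; rewrite /geometric /= mulr_ge0 // exprn_ge0 // invr_ge0.
- by move=> d; exact: (ev_term_bound bP s0 K0 Ks ys).
by apply: is_cvg_geometric_series; rewrite ger0_norm ?invr_ge0 // invf_lt1 // ltr1n.
Qed.

(** The bound is independent of [m], so it survives in the limit. *)
Lemma psum_diff2 P B K y h s del m : bounded_homog P B K -> 0 <= s -> 0 <= K ->
  K * s <= 8%:R^-1 -> 0 <= del ->
  (forall i, `|y i 0| <= s) -> (forall i, `|(y + h) i 0| <= s) ->
  (forall i, `|h i 0| <= del) ->
  s ^+ 2 * `|psum P (y + h) m - psum P y m - psum (fun d => dirderiv h (P d)) y m| <=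
    2%:R * B * del ^+ 2.
Proof.
move=> bP s0 K0 Ks del0 ys yhs hdel; have B0 := bounded_homog_ge0 bP.
rewrite /psum -!sumrB.
(* The factor [d ^ 2] of [ev_diff2] is at most [4 ^ d]; with [K * s] at most 1/8 the terms are
   dominated by a geometric series of ratio 1/2, whose sums are at most 2. *)
apply: (@le_trans _ _ (\sum_(d < m) B * del ^+ 2 * 2%:R^-1 ^+ d)); last first.
  have -> : 2%:R * B * del ^+ 2 = B * del ^+ 2 * 2%:R by ring.
  rewrite -mulr_sumr.
  by rewrite ler_wpM2l ?sum_half_le // mulr_ge0 // exprn_ge0.
apply: (@le_trans _ _ (\sum_(d < m) s ^+ 2 *
    `|ev (P d) (y + h) - ev (P d) y - ev (dirderiv h (P d)) y|)).
  by rewrite -mulr_sumr ler_wpM2l ?exprn_ge0 // ler_norm_sum.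
apply: ler_sum => d _; have [hP nP] := bP d.
apply: (le_trans (ev_diff2 hP s0 ys yhs hdel del0)).
apply: (@le_trans _ _ (B * K ^+ d * (del ^+ 2 * d%:R ^+ 2 * s ^+ d))).
  by rewrite ler_wpM2r // !mulr_ge0 ?exprn_ge0.
have -> : B * K ^+ d * (del ^+ 2 * d%:R ^+ 2 * s ^+ d) =
    B * del ^+ 2 * (d%:R ^+ 2 * (K * s) ^+ d) by rewrite exprMn; ring.
rewrite ler_wpM2l ?mulr_ge0 ?exprn_ge0 //.
apply: (@le_trans _ _ (4%:R ^+ d * 8%:R^-1 ^+ d)).
  apply: ler_pM; rewrite ?exprn_ge0 ?mulr_ge0 //.
    by rewrite -!natrX ler_nat sqr_le_expn4.
  by apply: lerXn2r; rewrite ?nnegrE ?mulr_ge0 // invr_ge0.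
rewrite -exprMn; have -> : 4%:R * 8%:R^-1 = 2%:R^-1 :> R by field.
by [].
Qed.

(** The factor [d + 1] produced by differentiation is at most [2 ^ d] and is absorbed by doubling
    [K]; the shift of degree costs one more [K]. *)
Lemma bounded_homog_dirderiv v P B K : bounded_homog P B K -> 0 <= K ->
  bounded_homog (fun d => dirderiv v (P d.+1)) (B * K * sum_abs v) (2%:R * K).
Proof.
move=> bP K0 d; have [hP nP] := bP d.+1; have B0 := bounded_homog_ge0 bP.
split; first exact: homog_dirderiv.
have V0 : 0 <= sum_abs v by apply: sumr_ge0.
apply: (le_trans (pnorm_dirderiv v hP)).
apply: (@le_trans _ _ (B * K ^+ d.+1 * (2%:R ^+ d * sum_abs v))).
  apply: ler_pM => //; rewrite ?pnorm_ge0 ?mulr_ge0 // ler_wpM2r //.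
  by rewrite -natrX ler_nat ltn_expl.
by rewrite exprS exprMn le_eqVlt; apply/orP; left; apply/eqP; ring.
Qed.

Lemma dirderivZv t v p : dirderiv (t *: v) p = t *: dirderiv v p.
Proof.
have d0 : dirderiv 0 p = 0 by rewrite /dirderiv big1 // => i _; rewrite mxE scale0r.
by have := dirderiv_vec t v 0 p; rewrite !addr0 d0 addr0.
Qed.

Lemma psum_dirderivZ t v P y m : psum (fun d => dirderiv (t *: v) (P d)) y m =
  t * psum (fun d => dirderiv v (P d)) y m.
Proof.
rewrite /psum mulr_sumr; apply: eq_bigr => d _.
by rewrite dirderivZv /ev mevalZ.
Qed.

Lemma psum_dirderivS v P B K y m : bounded_homog P B K ->
  psum (fun d => dirderiv v (P d)) y m.+1 = psum (fun d => dirderiv v (P d.+1)) y m.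
Proof.
move=> bP; rewrite /psum big_ord_recl dirderiv_homog0; last by case: (bP 0%N).
by rewrite /ev meval0 add0r.
Qed.

(** Bounds and radius are existential, since differentiation and linear substitution change them. *)
Definition expands (f : 'cV[R]_n -> R) (p : 'cV[R]_n) P := exists B K r,
  [/\ 0 < K, 0 < r, bounded_homog P B K &
      forall x, `|x - p| < r -> psum P (x - p) m @[m --> \oo] --> f x].

(** Termwise differentiation: the quadratic estimate is uniform in the partial sums, so in the limit
    the difference quotient differs from the sum of the derived series by at most a constant times
    the absolute value of the increment. *)
Lemma expands_derive f (p v : 'cV[R]_n) P : expands f p P ->
  (\forall x \near p, derivable f x v) /\
  expands ('D_v f) p (fun d => dirderiv v (P d.+1)).
Proof.
move=> [B [K [r [K0 r0 bP fP]]]]; have B0 := bounded_homog_ge0 bP.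
(* Small enough for [psum_diff2], which asks for [K * s] at most 1/8, and less than [r], so that the
   expansion holds in the ball of radius [s]. *)
pose s := Num.min (8%:R * K)^-1 (r / 2%:R).
have s0 : 0 < s by rewrite lt_min invr_gt0 mulr_gt0 // divr_gt0.
have Ks : K * s <= 8%:R^-1.
  apply: (@le_trans _ _ (K * (8%:R * K)^-1)).
    by rewrite ler_wpM2l ?(ltW K0) // /s ge_min lexx.
  by rewrite invfM mulrCA divff ?mulr1 // gt_eqF.
have sr : s < r by rewrite (@le_lt_trans _ _ (r / 2%:R)) ?ge_min ?lexx ?orbT // ltr_pdivrMr // ltr_pMr // ltr1n.
have bD := bounded_homog_dirderiv v bP (ltW K0).
have DKs : 2%:R * K * s <= 2%:R^-1.
  rewrite -mulrA (@le_trans _ _ (2%:R * 8%:R^-1)) ?ler_wpM2l //.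
  have -> : 2%:R * 8%:R^-1 = 4%:R^-1 :> R by field.
  by rewrite lef_pV2 ?posrE // ler_nat.
(* Base points stay within [s / 2] of [p], which leaves room for an increment of size [s / 2]. *)
have main x : `|x - p| < s / 2%:R -> derivable f x v /\
    psum (fun d => dirderiv v (P d.+1)) (x - p) m @[m --> \oo] --> 'D_v f x.
  move=> xp; set y := x - p; have s2 : s / 2%:R <= s by rewrite ler_pdivrMr // ler_pMr // ler1n.
  have ys i : `|y i 0| <= s.
    by rewrite (le_trans (cV_entry_le y i)) // (le_trans (ltW xp)).
  have K2 : 0 <= 2%:R * K by rewrite mulr_ge0 ?ltW.
  have /cvg_ex[G cG] := psum_cvg bD (ltW s0) K2 DKs ys.
  suff cD : h^-1 *: ((f \o shift x) (h *: v) - f x) @[h --> 0^'] --> G.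
    split; first by apply/cvg_ex; exists G.
    by rewrite /derive (cvg_lim _ cD).
  (* The term of degree zero has derivative zero, whence the shift of the index. *)
  have cGt t : psum (fun d => dirderiv (t *: v) (P d)) y m @[m --> \oo] --> t * G.
    rewrite -(cvg_shiftS (fun m => psum (fun d => dirderiv (t *: v) (P d)) y m)).
    rewrite [X in X @ _ --> _](_ : _ = fun m =>
        t * psum (fun d => dirderiv v (P d.+1)) y m).
      by apply: cvgMr.
    by apply/funext => m; rewrite /= (psum_dirderivZ t v P y m.+1) (psum_dirderivS _ _ _ bP).
  have v0 : 0 <= `|v| by [].
  pose C := 2%:R * B * `|v| ^+ 2 / s ^+ 2.
  have quad t : `|t| * `|v| <= s / 2%:R ->
      `|f (x + t *: v) - f x - t * G| <= C * `|t| ^+ 2.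
    move=> tv; have tvn : `|t *: v| <= s / 2%:R by rewrite normrZ.
    have ytn : `|y + t *: v| < s.
      rewrite (le_lt_trans (ler_normD _ _)) //.
      have -> : s = s / 2%:R + s / 2%:R by field.
      exact: ltr_leD.
    have yts i : `|(y + t *: v) i 0| <= s by rewrite (le_trans (cV_entry_le _ i)) // ltW.
    have tdel i : `|(t *: v) i 0| <= `|t| * `|v| by rewrite -normrZ cV_entry_le.
    have c1 : psum P (y + t *: v) m @[m --> \oo] --> f (x + t *: v).
      have -> : y + t *: v = (x + t *: v) - p by rewrite /y addrAC.
      by apply: fP; rewrite addrAC (lt_trans ytn).
    have c2 : psum P y m @[m --> \oo] --> f x by apply: fP; rewrite (lt_trans (lt_le_trans xp s2)).
    have c3 : (psum P (y + t *: v) m - psum P y m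
        - psum (fun d => dirderiv (t *: v) (P d)) y m) @[m --> \oo]
        --> f (x + t *: v) - f x - t * G.
      by apply: cvgB; [exact: cvgB|exact: cGt].
    apply: (cvgr_to_le (cvg_norm c3)); apply: nearW => m /=.
    have td0 : 0 <= `|t| * `|v| by rewrite mulr_ge0.
    have := psum_diff2 m bP (ltW s0) (ltW K0) Ks td0 ys yts tdel.
    rewrite mulrC -ler_pdivlMr ?exprn_gt0 // => /le_trans; apply.
    by rewrite /C le_eqVlt; apply/orP; left; apply/eqP; field; rewrite gt_eqF.
  apply/subr_cvg0.
  apply: (@cvg_to_0_linear _ _ C (s / 2%:R / (`|v| + 1))).
    by rewrite !divr_gt0 // ltr_wpDl.
  move=> t /andP[t0 tk].
  have tv : `|t| * `|v| <= s / 2%:R.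
    apply: (@le_trans _ _ (`|t| * (`|v| + 1))); first by rewrite ler_wpM2l // lerDl.
    by rewrite -ler_pdivlMr ?ltr_wpDl // ltW.
  have := quad t tv; rewrite /= [x + _]addrC => q.
  have t00 : t != 0 by rewrite -normr_gt0.
  have -> : t^-1 *: (f (t *: v + x) - f x) - G = t^-1 * (f (t *: v + x) - f x - t * G).
    by rewrite [RHS]mulrBr mulKf.
  rewrite normrM normfV ler_pdivrMl // (le_trans q) //.
  by rewrite le_eqVlt; apply/orP; left; apply/eqP; ring.
split.
  apply/nbhs_ballP; exists (s / 2%:R); first by rewrite /= divr_gt0.
  move=> x; rewrite -ball_normE /= distrC => /main[].
  by [].
exists (B * K * sum_abs v), (2%:R * K), (s / 2%:R); split.
- by rewrite mulr_gt0.
- by rewrite divr_gt0.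
- exact: bD.
by move=> x /main[].
Qed.

Lemma ev_homog0 d p : homog d p -> d != 0%N -> ev p 0 = 0.
Proof.
move=> hp d0; have z0 i : `|(0 : 'cV[R]_n) i 0| <= (0 : R) by rewrite mxE normr0.
have := ev_bound hp z0; rewrite expr0n (negPf d0) mulr0.
by rewrite normr_le0 => /eqP.
Qed.

Lemma expands_value f (p : 'cV[R]_n) P : expands f p P -> f p = ev (P 0%N) 0.
Proof.
move=> [B [K [r [K0 r0 bP fP]]]]; have := fP p; rewrite subrr normr0 => /(_ r0) fp.
apply: (@cvg_unique _ _ (psum P 0 m @[m --> \oo])) => //.
apply/cvg_ballP => e e0; near=> m; rewrite -ball_normE /=.
rewrite (_ : psum P 0 m = ev (P 0%N) 0) ?subrr ?normr0 //.
have m0 : (0 < m)%N by near: m; exact: nbhs_infty_gt.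
rewrite -(prednK m0) /psum big_ord_recl big1 ?addr0 // => i _.
by have [hP _] := bP (lift ord0 i); apply: (ev_homog0 hP).
Unshelve. all: by end_near. Qed.

(** Derivatives at [p] are read off the linear term, so rules for them reduce to identities between
    polynomials. *)
Lemma derive_value f (p v : 'cV[R]_n) P : expands f p P ->
  'D_v f p = ev (dirderiv v (P 1%N)) 0.
Proof. by move=> /(expands_derive v)[_ /expands_value]. Qed.

Lemma derive_vec f (p : 'cV[R]_n) c u v P : expands f p P ->
  'D_(c *: u + v) f p = c * 'D_u f p + 'D_v f p.
Proof. by move=> fP; rewrite !(derive_value _ fP) dirderiv_vec ev_lin. Qed.

Lemma expands_eq f g (p : 'cV[R]_n) P :
  (\forall x \near p, f x = g x) -> expands f p P -> expands g p P.
Proof.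
move=> /nbhs_ballP[e /= e0 fg] [B [K [r [K0 r0 bP fP]]]].
exists B, K, (Num.min e r); split=> //; first by rewrite lt_min e0.
move=> x; rewrite lt_min => /andP[xe xr]; rewrite -fg; first exact: fP.
by rewrite -ball_normE /= distrC.
Qed.

Lemma expands_lin f g (p : 'cV[R]_n) P Q c : expands f p P -> expands g p Q ->
  expands (fun x => c * f x + g x) p (fun d => c *: P d + Q d).
Proof.
move=> [B [K [r [K0 r0 bP fP]]]] [B' [K' [r' [K0' r0' bQ gQ]]]].
have B0 := bounded_homog_ge0 bP; have B0' := bounded_homog_ge0 bQ.
exists (`|c| * B + B'), (Num.max K K'), (Num.min r r'); split.
- by rewrite lt_max K0.
- by rewrite lt_min r0.
- move=> d; have [hP nP] := bP d; have [hQ nQ] := bQ d.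
  split; first exact: homog_lin.
  have Kd : K ^+ d <= Num.max K K' ^+ d.
    by apply: lerXn2r; rewrite ?nnegrE ?le_max ?(ltW K0) ?lexx.
  have Kd' : K' ^+ d <= Num.max K K' ^+ d.
    by apply: lerXn2r; rewrite ?nnegrE ?le_max ?(ltW K0') ?lexx ?orbT.
  apply: (le_trans (pnorm_lin _ _ _)); rewrite mulrDl; apply: lerD.
    by rewrite -mulrA ler_wpM2l // (le_trans nP) // ler_wpM2l.
  by rewrite (le_trans nQ) // ler_wpM2l.
move=> x; rewrite lt_min => /andP[/fP fx /gQ gx].
rewrite [X in X @ _ --> _](_ : _ = fun m => c * psum P (x - p) m + psum Q (x - p) m).
  by apply: cvgD => //; apply: cvgMr.
apply/funext => m; rewrite /psum mulr_sumr -big_split; apply: eq_bigr => d _ /=.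
exact: ev_lin.
Qed.

Definition subst_mx (A : 'M[R]_n) : mpoly n R -> mpoly n R :=
  mmap (@mpolyC n R) (fun i => \sum_j A i j *: mpolyX R (mnm1 j)).

Lemma subst_mx_lin A c p q : subst_mx A (c *: p + q) = c *: subst_mx A p + subst_mx A q.
Proof. by rewrite /subst_mx mmapD mmapZ mul_mpolyC. Qed.

Lemma subst_mxS A i m : subst_mx A (mpolyX R (mnm_add (mnm1 i) m)) =
  \sum_j A i j *: (mpolyX R (mnm1 j) * subst_mx A (mpolyX R m)).
Proof.
rewrite mpolyXD /subst_mx rmorphM /= {1}mmapX mmap1U mulr_suml.
by apply: eq_bigr => j _; rewrite scalerAl.
Qed.

Lemma ev_subst_mx A p y : ev (subst_mx A p) y = ev p (A *m y).
Proof.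
have evZ c q : ev (c *: q) y = c * ev q y by rewrite /ev mevalZ.
have : (ev (subst_mx A p) y : R^o) = (ev p (A *m y) : R^o); last by [].
move: p; apply: mpoly_eq_lin => [c p q|c p q|m].
- by rewrite subst_mx_lin ev_lin.
- by rewrite ev_lin.
elim/multinom_ind: m => [|m i IHm].
  by rewrite /subst_mx mpolyX0 rmorph1 !ev1.
rewrite subst_mxS mpolyXD evM evXi -IHm mxE mulr_suml.
rewrite (big_morph (fun q => ev q y) (fun a b => evD a b y) (_ : ev 0 y = 0)) ?/ev ?meval0 //.
by apply: eq_bigr => j _; rewrite -/(ev _ _) evZ evM evXi mulrA.
Qed.

Definition mx_sum_abs (A : 'M[R]_n) : R := \sum_i \sum_j `|A i j|.

Lemma subst_mx_homog A m : homog (mdeg m) (subst_mx A (mpolyX R m)) /\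
  pnorm (subst_mx A (mpolyX R m)) <= mx_sum_abs A ^+ mdeg m.
Proof.
elim/multinom_ind: m => [|m i [hm nm]].
  rewrite mpolyX0 /subst_mx rmorph1 mdeg0 expr0; split.
    by rewrite -mpolyX0; have := @homogX R n (@mnm0 n); rewrite mdeg0.
  by rewrite -mpolyX0 pnormX.
rewrite subst_mxS mdegD mdeg1; split.
  elim/big_rec: _ => [|j q _ hq]; first exact: homog0.
  by apply: homog_lin => //; apply: homogM => //; rewrite -(mdeg1 j); exact: homogX.
have XM j : pnorm (mpolyX R (mnm1 j) * subst_mx A (mpolyX R m)) <=
    pnorm (subst_mx A (mpolyX R m)).
  rewrite -[leRHS]mulr1.
  apply: (operator_bound (T := fun q => mpolyX R (mnm1 j) * q) _ hm) => [c q q'|m' _].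
    by rewrite mulrDr -scalerAr.
  by rewrite -mpolyXD pnormX.
have L0 : 0 <= mx_sum_abs A by apply: sumr_ge0 => ? _; apply: sumr_ge0.
apply: (@le_trans _ _ (\sum_j `|A i j| * mx_sum_abs A ^+ mdeg m)).
  elim/big_rec2: _ => [|j b q _ IH]; first by rewrite pnorm0.
  rewrite (le_trans (pnorm_lin _ _ _)) // lerD // ler_wpM2l //.
  exact: le_trans (XM j) nm.
rewrite -mulr_suml exprS ler_wpM2r ?exprn_ge0 // [leRHS](bigD1 i) //= lerDl.
by apply: sumr_ge0 => ? _; apply: sumr_ge0.
Qed.

Lemma expands_subst f A (p : 'cV[R]_n) P : expands f (A *m p) P ->
  expands (fun x => f (A *m x)) p (fun d => subst_mx A (P d)).
Proof.
move=> [B [K [r [K0 r0 bP fP]]]]; have B0 := bounded_homog_ge0 bP.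
have L0 : 0 <= mx_sum_abs A by apply: sumr_ge0 => ? _; apply: sumr_ge0.
(* Adding 1 keeps the divisor of the radius positive when [A] is zero. *)
have L1 : 0 < mx_sum_abs A + 1 by rewrite ltr_wpDl.
exists B, (K * (mx_sum_abs A + 1)), (r / (mx_sum_abs A + 1)); split.
- by rewrite mulr_gt0.
- by rewrite divr_gt0.
- move=> d; have [hP nP] := bP d; split.
    rewrite (mpolyE (P d)) big_seq.
    elim/big_rec: _ => [|m q mP hq]; first by rewrite /subst_mx mmap0; exact: homog0.
    rewrite subst_mx_lin; apply: homog_lin => //.
    by rewrite -(homog_msupp hP mP); case: (subst_mx_homog A m).
  rewrite exprMn mulrA.
  have H : pnorm (subst_mx A (P d)) <= pnorm (P d) * (mx_sum_abs A + 1) ^+ d.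
    apply: (operator_bound (T := subst_mx A) _ hP) => [c q q'|m md].
      exact: subst_mx_lin.
    have [_ /le_trans->//] := subst_mx_homog A m; rewrite md.
    by apply: lerXn2r; rewrite ?nnegrE ?lerDl // ltW.
  by rewrite (le_trans H) // ler_wpM2r // exprn_ge0 // ltW.
move=> x xp; rewrite [X in X @ _ --> _](_ : _ = psum P (A *m x - A *m p)).
  apply: fP; rewrite -mulmxBr; apply: (@le_lt_trans _ _ (mx_sum_abs A * `|x - p|)).
    apply: cV_norm_le => [|i]; first by rewrite mulr_ge0.
    rewrite mxE (le_trans (ler_norm_sum _ _ _)) // /mx_sum_abs mulr_suml [leRHS](bigD1 i) //=.
    rewrite ler_wpDr //; first by apply: sumr_ge0 => ? _; rewrite mulr_ge0 // sumr_ge0.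
    rewrite mulr_suml; apply: ler_sum => j _.
    by rewrite normrM ler_wpM2l // cV_entry_le.
  rewrite ltr_pdivlMr // mulrC in xp; apply: le_lt_trans xp.
  by rewrite ler_wpM2r // lerDl.
by apply/funext => m; apply: eq_bigr => d _; rewrite ev_subst_mx mulmxBr.
Qed.

End PowerSeries.

(** * Real analytic functions and homogeneous expansions *)

Section AnalyticExpansion.

Variables (R : realType) (n : nat).

Definition deg_lt m : seq (multinom n) := [seq val al | al <- enum {: bmultinom n m}].

Definition deg_eq d : seq (multinom n) := [seq al <- deg_lt d.+1 | mdeg al == d].

Lemma mem_deg_lt m al : (al \in deg_lt m) = (mdeg al < m)%N.
Proof.
apply/mapP/idP => [[be _ ->]|alm]; first by case: be.
by exists (BMultinom alm); rewrite ?mem_enum.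
Qed.

Lemma mem_deg_eq d al : (al \in deg_eq d) = (mdeg al == d).
Proof. by rewrite mem_filter mem_deg_lt andb_idr // => /eqP ->. Qed.

Lemma deg_lt_uniq m : uniq (deg_lt m).
Proof. by rewrite map_inj_uniq ?enum_uniq //; exact: val_inj. Qed.

Lemma deg_eq_uniq d : uniq (deg_eq d).
Proof. exact/filter_uniq/deg_lt_uniq. Qed.

Lemma sum_bmultinom (V : nmodType) m (c : multinom n -> V) :
  \sum_(al : bmultinom n m) c al = \sum_(d < m) \sum_(al <- deg_eq d) c al.
Proof.
transitivity (\sum_(al <- deg_lt m) c al); first by rewrite big_map big_enum.
elim: m => [|m IHm].
  rewrite big_ord0 big_seq big1 // => al; by rewrite mem_deg_lt.
rewrite big_ord_recr /= -IHm -big_cat; apply: perm_big; apply: uniq_perm.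
- exact: deg_lt_uniq.
- rewrite cat_uniq deg_lt_uniq deg_eq_uniq andbT /=; apply/hasPn => al.
  by rewrite mem_deg_eq mem_deg_lt => /eqP ->; rewrite ltnn.
by move=> al; rewrite mem_cat mem_deg_eq !mem_deg_lt ltnS leq_eqVlt orbC.
Qed.

Lemma homog_sub_deg_eq d (p : mpoly n R) : homog d p -> {subset msupp p <= deg_eq d}.
Proof. by move=> hp al /(homog_msupp hp) ald; rewrite mem_deg_eq ald. Qed.

Lemma monomialE al (y : 'cV[R]_n) : monomial al y = ev (mpolyX R al) y.
Proof. by rewrite /ev mevalX. Qed.

Lemma ev_homog_sum d (p : mpoly n R) y : homog d p ->
  ev p y = \sum_(al <- deg_eq d) mcoeff al p * monomial al y.
Proof.
move=> hp; have lin c p' q y' : (ev (c *: p' + q) y' : R^o) = c *: (ev p' y' : R^o) + ev q y'.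
  exact: ev_lin.
have -> : ev p y = \sum_(al <- msupp p) mcoeff al p * monomial al y.
  by rewrite /ev mevalE.
have := mpoly_lin_widen (fun al => monomial al y : R^o) (deg_eq_uniq d) (homog_sub_deg_eq hp).
by [].
Qed.

Variable U : set 'cV[R]_n.
Hypothesis openU : forall p, U p -> exists2 r : R, 0 < r & forall x, `|x - p| < r -> U x.

(** Derivatives are taken of functions on the whole space. As [U] is open, extending by zero does
    not affect behaviour near points of [U]. *)
Definition ext0 (V : zmodType) (f : U -> V) (x : 'cV[R]_n) : V :=
  if insub x is Some x' then f x' else 0.

Lemma ext0E (V : zmodType) (f : U -> V) (x : U) : ext0 f (val x) = f x.
Proof. by rewrite /ext0 valK. Qed.

(** Absolute convergence at one point suffices: at the displacement with all coordinates [rho],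
    every monomial of degree [d] equals [rho ^+ d], so the bound on absolute sums becomes a bound on
    coefficient norms with [K = rho^-1]. *)
Lemma real_analytic_expands (f : U -> R) : real_analytic f ->
  forall p, U p -> exists P, expands (ext0 f) p P.
Proof.
move=> af p Up; pose p' : U := Sub p (mem_set Up).
have [r r0 [c cP]] := af p'; have [r1 r10 Ur1] := openU Up.
pose rho := Num.min r r1 / 2%:R.
have m0 : 0 < Num.min r r1 by rewrite lt_min r0.
have rho0 : 0 < rho by rewrite divr_gt0.
have rhom : rho < Num.min r r1 by rewrite ltr_pdivrMr // ltr_pMr // ltr1n.
have rhor : rho < r by rewrite (lt_le_trans rhom) // ge_min lexx.
have rhor1 : rho < r1 by rewrite (lt_le_trans rhom) // ge_min lexx orbT.
pose o : 'cV[R]_n := const_mx rho.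
have o_rho : `|o| <= rho.
  by apply: cV_norm_le => [|i]; rewrite ?(ltW rho0) // mxE ger0_norm // (ltW rho0).
have Ux0 : U (p + o) by apply: Ur1; rewrite addrAC subrr add0r (le_lt_trans o_rho).
have := cP (Sub (p + o) (mem_set Ux0)); rewrite /= addrAC subrr add0r.
move=> /(_ (le_lt_trans o_rho rhor))[[B BP] _].
pose P d : mpoly n R := \sum_(al <- deg_eq d) c al *: mpolyX R al.
have Pcoef d al : mcoeff al (P d) = if mdeg al == d then c al else 0.
  rewrite /P raddf_sum /=; have [ald|ald] := boolP (mdeg al == d).
    rewrite (big_rem al) ?mem_deg_eq //= mcoeffZ mcoeffX eqxx mulr1.
    rewrite big_seq big1 ?addr0 // => be; rewrite mem_rem_uniq ?deg_eq_uniq // inE.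
    by move=> /andP[/negPf ba _]; rewrite mcoeffZ mcoeffX ba mulr0.
  rewrite big_seq big1 // => be; rewrite mem_deg_eq => bed.
  rewrite mcoeffZ mcoeffX; case: eqP => [ba|_]; last by rewrite mulr0.
  by move: ald; rewrite -ba bed.
have hP d : homog d (P d) by move=> al /negPf ald; rewrite Pcoef ald.
exists P, B, rho^-1, (Num.min r r1); split=> //.
- by rewrite invr_gt0.
- move=> d; split=> //; rewrite exprVn ler_pdivlMr ?exprn_gt0 //.
  rewrite (pnorm_widen (deg_eq_uniq d)); last exact: homog_sub_deg_eq.
  apply: le_trans (BP d.+1); rewrite (sum_bmultinom _ (fun al => `|c al * monomial al o|)).
  rewrite big_ord_recr /= ler_wpDl //; first by do 2 (apply: sumr_ge0 => ? _).
  rewrite mulr_suml big_seq [leRHS]big_seq; apply: ler_sum => al.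
  rewrite mem_deg_eq => ald; rewrite Pcoef ald normrM ler_wpM2l //.
  rewrite /monomial; under eq_bigr => i _ do rewrite mxE.
  by rewrite -expr_sum -mdegE (eqP ald) ger0_norm // exprn_ge0 // ltW.
move=> x; rewrite lt_min => /andP[xr xr1]; have Ux := Ur1 x xr1.
have := cP (Sub x (mem_set Ux)); rewrite /= => /(_ xr)[_].
have -> : f (Sub x (mem_set Ux)) = ext0 f x by rewrite -ext0E.
apply: cvg_trans; apply: near_eq_cvg; apply: nearW => m /=.
rewrite (sum_bmultinom _ (fun al => c al * monomial al (x - p))).
apply: eq_bigr => d _; rewrite (ev_homog_sum _ (hP d)).
rewrite big_seq [RHS]big_seq; apply: eq_bigr => al.
by rewrite mem_deg_eq Pcoef => ->.
Qed.

Lemma expands_real_analytic (f : U -> R) :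
  (forall p, U p -> exists P, expands (ext0 f) p P) -> real_analytic f.
Proof.
move=> ef p; have [P [B [K [r [K0 r0 bP fP]]]]] := ef (val p) (set_valP p).
(* With this radius [K * s] is 1/2, and the absolute sums are at most [2 B]. *)
pose s := (2%:R * K)^-1; have s0 : 0 < s by rewrite invr_gt0 mulr_gt0.
exists (Num.min r s); first by rewrite lt_min r0.
exists (fun al => mcoeff al (P (mdeg al))) => x; rewrite lt_min => /andP[xr xs].
have hP d : homog d (P d) by case: (bP d).
split.
  exists (B * 2%:R) => m.
  rewrite (sum_bmultinom _ (fun al => `|mcoeff al (P (mdeg al)) * monomial al (\val x - \val p)|)).
  have B0 := bounded_homog_ge0 bP.
  apply: (@le_trans _ _ (\sum_(d < m) B * 2%:R^-1 ^+ d)); last first.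
    by rewrite -mulr_sumr ler_wpM2l // sum_half_le.
  apply: ler_sum => d _; have [_ nP] := bP d.
  apply: (@le_trans _ _ (pnorm (P d) * s ^+ d)).
    rewrite (pnorm_widen (deg_eq_uniq d)); last exact: homog_sub_deg_eq.
    rewrite mulr_suml big_seq [leRHS]big_seq; apply: ler_sum => al.
    rewrite mem_deg_eq => /eqP ald; rewrite ald normrM ler_wpM2l // monomialE.
    have := ev_bound (@homogX R n al) (_ : forall i, `|(\val x - \val p) i 0| <= s).
    rewrite pnormX mul1r ald; apply=> i.
    by rewrite (le_trans (cV_entry_le _ i)) // ltW.
  apply: (le_trans (ler_wpM2r (exprn_ge0 d (ltW s0)) nP)).
  rewrite -mulrA -exprMn /s invfM mulrCA divff ?mulr1 ?gt_eqF //.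
rewrite -(ext0E f x); apply: cvg_trans (fP _ xr); apply: near_eq_cvg; apply: nearW => m /=.
rewrite (sum_bmultinom _ (fun al => mcoeff al (P (mdeg al)) * monomial al (\val x - \val p))).
apply: eq_bigr => d _; rewrite (ev_homog_sum _ (hP d)).
rewrite big_seq [RHS]big_seq; apply: eq_bigr => al.
by rewrite mem_deg_eq => /eqP ->.
Qed.

End AnalyticExpansion.

(** * Expansions and derivatives of sums; linear changes of variable *)

Section ExpansionSums.

Variables (R : realType) (n : nat).

Lemma expands0 (p : 'cV[R]_n) : expands (fun=> 0) p (fun=> 0).
Proof.
exists 0, 1, 1; split=> // [d|x _]; first by rewrite mul0r pnorm0; split=> //; exact: homog0.
apply: cvg_near_cst; apply: nearW => m; rewrite /psum big1 // => d _.
by rewrite /ev meval0.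
Qed.

Lemma derive_lin f g (p v : 'cV[R]_n) P Q c : expands f p P -> expands g p Q ->
  'D_v (fun x => c * f x + g x) p = c * 'D_v f p + 'D_v g p.
Proof.
move=> fP gQ; rewrite (derive_value _ (expands_lin c fP gQ)) dirderiv_lin ev_lin.
by rewrite (derive_value _ fP) (derive_value _ gQ).
Qed.

Lemma expands_sum (I : Type) (r : seq I) (c : I -> R) (g : I -> 'cV[R]_n -> R) (p : 'cV[R]_n) :
  (forall i, exists P, expands (g i) p P) ->
  (exists P, expands (fun x => \sum_(i <- r) c i * g i x) p P) /\
  forall v, 'D_v (fun x => \sum_(i <- r) c i * g i x) p = \sum_(i <- r) c i * 'D_v (g i) p.
Proof.
move=> gP; elim: r => [|i r [[P rP] rD]].
  have E : (fun x : 'cV[R]_n => \sum_(i <- [::]) c i * g i x) = fun=> 0.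
    by apply/funext => x; rewrite big_nil.
  rewrite E; split=> [|v]; first by exists (fun=> 0); exact: expands0.
  rewrite big_nil (derive_value _ (expands0 p)).
  by rewrite dirderiv_homog0 ?/ev ?meval0 //; exact: homog0.
have E : (fun x : 'cV[R]_n => \sum_(j <- i :: r) c j * g j x) =
    fun x => c i * g i x + \sum_(j <- r) c j * g j x.
  by apply/funext => x; rewrite big_cons.
have [Q iQ] := gP i; rewrite E; split=> [|v].
  by exists (fun d => c i *: Q d + P d); exact: expands_lin.
by rewrite big_cons (derive_lin _ _ iQ rP) rD.
Qed.

Lemma derive_comp_mx (g : 'cV[R]_n -> R) (A : 'M[R]_n) (p v : 'cV[R]_n) :
  'D_v (fun x => g (A *m x)) p = 'D_(A *m v) g (A *m p).
Proof.
rewrite /derive; congr (lim _); apply: (congr1 (fun h => h @ 0^')).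
by apply/funext => h /=; rewrite mulmxDr -scalemxAr.
Qed.

End ExpansionSums.

(** * Real coordinates of vector valued functions *)

Section RealCoordinates.

Variables (R : realType) (M : vectType R[i]).
Local Notation idx := ('I_(\dim {:M}) * bool)%type.

(** The boolean selects the imaginary or the real part. With a single real index set a complex
    endomorphism becomes a real matrix, and scalar expansions apply to each coordinate. *)
Definition real_coord (s : idx) (u : M) : R :=
  if s.2 then im_coord s.1 u else re_coord s.1 u.

Lemma real_coordD s u v : real_coord s (u + v) = real_coord s u + real_coord s v.
Proof. by rewrite /real_coord /re_coord /im_coord linearD; case: s.2; rewrite raddfD. Qed.

Lemma real_coordZ s (c : R) u : real_coord s (c%:C *: u) = c * real_coord s u.
Proof.
rewrite /real_coord /re_coord /im_coord linearZ; case: s.2 => /=;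
  case: (coord _ _ u) => a b /=; ring.
Qed.

Lemma real_coord0 s : real_coord s 0 = 0.
Proof. by apply: (addrI (real_coord s 0)); rewrite -real_coordD !addr0. Qed.

Lemma real_coord_inj u v : (forall s, real_coord s u = real_coord s v) -> u = v.
Proof.
move=> uv; rewrite (coord_vbasis (memvf u)) (coord_vbasis (memvf v)).
apply: eq_bigr => i _; congr (_ *: _).
have := uv (i, false); have := uv (i, true); rewrite /real_coord /re_coord /im_coord /=.
by case: (coord _ i u) (coord _ i v) => [a b] [c d] /= -> ->.
Qed.

Lemma real_coord_linear (phi : 'End(M)) : exists m : idx -> idx -> R,
  forall s u, real_coord s (phi u) = \sum_t m s t * real_coord t u.
Proof.
pose c (i j : 'I_(\dim {:M})) : R[i] := coord (vbasis fullv) i (phi (vbasis {:M})`_j).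
pose m (s t : idx) := if s.2 then (if t.2 then complex.Re (c s.1 t.1) else complex.Im (c s.1 t.1))
  else (if t.2 then - complex.Im (c s.1 t.1) else complex.Re (c s.1 t.1)).
exists m => s u.
have E : coord (vbasis fullv) s.1 (phi u) =
    \sum_j coord (vbasis fullv) j u * c s.1 j.
  rewrite {1}(coord_vbasis (memvf u)) !linear_sum; apply: eq_bigr => j _ /=.
  by rewrite !linearZ.
have ReM (x y : R[i]) : complex.Re (x * y) =
    complex.Re x * complex.Re y - complex.Im x * complex.Im y.
  by case: x y => [? ?] [? ?].
have ImM (x y : R[i]) : complex.Im (x * y) =
    complex.Re x * complex.Im y + complex.Im x * complex.Re y.
  by case: x y => [? ?] [? ?].
rewrite -(pair_big xpredT xpredT (fun i b => m s (i, b) * real_coord (i, b) u)) /=.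
rewrite /m /real_coord /re_coord /im_coord E /=.
case: s.2; rewrite raddf_sum /=; apply: eq_bigr => j _; rewrite big_bool /=.
  by rewrite ImM; ring.
by rewrite ReM; ring.
Qed.

Lemma real_coord_dir n (v : 'cV[R]_n) (f : 'cV[R]_n -> M) x s :
  real_coord s (dir_derivative v f x) = 'D_v (real_coord s \o f) x.
Proof.
have freeM := basis_free (vbasisP {:M}).
have E i : coord (vbasis fullv) i (dir_derivative v f x) =
   'D_v (re_coord i \o f) x +i* 'D_v (im_coord i \o f) x.
  exact: (coord_sum_free _ _ freeM).
by case: s => i [] /=; rewrite /real_coord /= /re_coord /im_coord E.
Qed.

End RealCoordinates.

(** * Analytic functions as a coefficient space *)

Section AnalyticSpace.

Variables (R : realType) (l : nat) (S : 'M[R]_l) (Phi : set 'cV[R]_l).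
Variables (F : seq 'cV[R]_l) (theta : 'cV[R]_l) (Y : set 'cV[R]_l).
Hypothesis rsP : root_system S Phi.
Hypothesis latY : translation_lattice S Phi Y.
Variables (M : vectType R[i]) (piM : 'M[R]_l.+2 -> 'End(M)).
Hypothesis modM : ext_weyl_module S Phi Y piM.

Local Notation G := (ext_weyl S Phi Y).
Local Notation U := (Vplus R l).
Local Notation afun := (analytic_fun U M).

Lemma Vplus_open p : U p -> exists2 r : R, 0 < r & forall x, `|x - p| < r -> U x.
Proof.
move=> p0; exists (dpart p) => // x xp; rewrite /Vplus /=.
pose i0 : 'I_l.+2 := rshift 1 (lshift l (ord0 : 'I_1)).
have dE (y : 'cV[R]_l.+2) : dpart y = y i0 0 by rewrite /dpart !mxE.
have := le_lt_trans (cV_entry_le (x - p) i0) xp.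
rewrite !mxE -!dE ltr_norml => /andP[+ _].
by rewrite ltrBrDl subrr.
Qed.

Lemma Vplus_near p : U p -> \forall x \near p, U x.
Proof.
move=> /Vplus_open[r r0 Ur]; apply/nbhs_ballP; exists r => //= x.
by rewrite -ball_normE /= distrC => /Ur.
Qed.

Lemma ext0_in (V : zmodType) (f : U -> V) x (Ux : U x) : ext0 f x = f (Sub x (mem_set Ux)).
Proof. by rewrite -ext0E. Qed.

Lemma ext0_real_coord (f : U -> M) s :
  real_coord s \o ext0 f = ext0 (fun x => real_coord s (f x)).
Proof.
by apply/funext => x; rewrite /ext0 /=; case: insubP => // _; rewrite real_coord0.
Qed.

Lemma analyticE (f : U -> M) : f \in @analytic R l.+2 U M <->
  forall s p, U p -> exists P, expands (real_coord s \o ext0 f) p P.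
Proof.
split=> [/asboolP af [i b] p Up|ef].
  rewrite ext0_real_coord; apply: real_analytic_expands Up; first exact: Vplus_open.
  by case: b; case: (af i).
apply/asboolP => i; split; apply: expands_real_analytic => p Up.
- by have := ef (i, false) p Up; rewrite ext0_real_coord.
- by have := ef (i, true) p Up; rewrite ext0_real_coord.
Qed.

Lemma afun_expands (f : afun) s p : U p -> exists P, expands (real_coord s \o ext0 f) p P.
Proof. by move: s p; apply/analyticE/(valP f). Qed.

Lemma afun_eq (f h : afun) : (forall x : U, f x = h x) -> f = h.
Proof. by move=> fh; apply/val_inj/funext. Qed.

Lemma dir_analytic v (f : afun) :
  (fun x : U => dir_derivative v (ext0 f) (val x)) \in @analytic R l.+2 U M.
Proof.
apply/analyticE => s p Up; have [P fP] := afun_expands f s Up.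
exists (fun d => dirderiv v (P d.+1)).
apply: expands_eq (expands_derive v fP).2.
by apply: filterS (Vplus_near Up) => x Ux; rewrite /= ext0_in /= real_coord_dir.
Qed.

Definition adir v (f : afun) : afun := AnalyticFun (dir_analytic v f).

Let m_of (phi : 'End(M)) : {m | forall s u, real_coord s (phi u) = \sum_t m s t * real_coord t u}.
Proof. exact/cid/real_coord_linear. Qed.

Lemma dir_derivative_comp (phi : 'End(M)) (A : 'M[R]_l.+2) (f : 'cV[R]_l.+2 -> M) p v :
  (forall s, exists P, expands (real_coord s \o f) (A *m p) P) ->
  (forall s, exists P, expands (real_coord s \o (fun x => phi (f (A *m x)))) p P) /\
  dir_derivative v (fun x => phi (f (A *m x))) p = phi (dir_derivative (A *m v) f (A *m p)).
Proof.
move=> fP; have [m mP] := m_of phi.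
have E s : real_coord s \o (fun x => phi (f (A *m x))) =
    fun x => \sum_t m s t * (real_coord t \o f) (A *m x).
  by apply/funext => x; rewrite /= mP.
have gP t : exists P, expands (fun x => (real_coord t \o f) (A *m x)) p P.
  by have [P tP] := fP t; exists (fun d => subst_mx A (P d)); exact: expands_subst.
have sums s := expands_sum (index_enum _) (m s) gP.
split=> [s|]; first by rewrite E; case: (sums s).
apply: real_coord_inj => s; rewrite real_coord_dir E (sums s).2 mP.
apply: eq_bigr => t _; rewrite real_coord_dir.
by rewrite (derive_comp_mx (real_coord t \o f)).
Qed.

Lemma dir_derivative_near (f h : 'cV[R]_l.+2 -> M) p v :
  (\forall x \near p, f x = h x) ->
  (forall s, exists P, expands (real_coord s \o f) p P) ->
  dir_derivative v f p = dir_derivative v h p.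
Proof.
move=> fh fP; apply: real_coord_inj => s; rewrite !real_coord_dir.
have [P sP] := fP s; rewrite (derive_value _ sP).
have hP : expands (real_coord s \o h) p P.
  by apply: expands_eq sP; apply: filterS fh => x /= ->.
by rewrite (derive_value _ hP).
Qed.

Lemma dir_derivativeD (f h : 'cV[R]_l.+2 -> M) p v :
  (forall s, exists P, expands (real_coord s \o f) p P) ->
  (forall s, exists P, expands (real_coord s \o h) p P) ->
  dir_derivative v (fun x => f x + h x) p = dir_derivative v f p + dir_derivative v h p.
Proof.
move=> fP hP; apply: real_coord_inj => s; rewrite real_coordD !real_coord_dir.
have [P sP] := fP s; have [Q sQ] := hP s.
have -> : real_coord s \o (fun x => f x + h x) =
    fun x => 1 * (real_coord s \o f) x + (real_coord s \o h) x.
  by apply/funext => x /=; rewrite real_coordD mul1r.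
by rewrite (derive_lin v 1 sP sQ) mul1r.
Qed.

Lemma dir_derivative_vec (f : 'cV[R]_l.+2 -> M) p (c : R) u v :
  (forall s, exists P, expands (real_coord s \o f) p P) ->
  dir_derivative (c *: u + v) f p = c%:C *: dir_derivative u f p + dir_derivative v f p.
Proof.
move=> fP; apply: real_coord_inj => s; rewrite real_coordD (real_coordZ s c (dir_derivative u f p)).
rewrite (real_coord_dir (c *: u + v)) (real_coord_dir u) (real_coord_dir v).
by have [P sP] := fP s; exact: (derive_vec _ _ _ sP).
Qed.

(** On polynomials directional derivatives commute. Agreement with [fu] and [fv] is asked near [p]
    only, because derivatives of analytic functions are extended by zero outside the domain. *)
Lemma dir_derivativeC (f fu fv : 'cV[R]_l.+2 -> M) p u v :
  (forall s, exists P, expands (real_coord s \o f) p P) ->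
  (\forall x \near p, dir_derivative u f x = fu x) ->
  (\forall x \near p, dir_derivative v f x = fv x) ->
  dir_derivative u fv p = dir_derivative v fu p.
Proof.
move=> fP fuE fvE; apply: real_coord_inj => s; rewrite !real_coord_dir.
have [P sP] := fP s.
have dE z fz : (\forall x \near p, dir_derivative z f x = fz x) ->
    expands (real_coord s \o fz) p (fun d => dirderiv z (P d.+1)).
  move=> fzE; apply: expands_eq (expands_derive z sP).2.
  by apply: filterS fzE => x /= <-; rewrite real_coord_dir.
by rewrite (derive_value _ (dE _ _ fvE)) (derive_value _ (dE _ _ fuE)) dirderivC.
Qed.

Lemma Vplus_group w x : G w -> U x -> U (w *m x).
Proof. by move=> wG; rewrite /Vplus /= (ext_weyl_dpart latY). Qed.

Let GV w : G w -> G (invmx w) := @ext_weyl_inv _ _ _ _ _ rsP latY w.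

Lemma act_analytic w (f : afun) : G w ->
  (fun x : U => piM w (ext0 f (invmx w *m val x))) \in @analytic R l.+2 U M.
Proof.
move=> wG; apply/analyticE => s p Up.
have Up' : U (invmx w *m p) by apply: Vplus_group => //; exact: GV.
(* The direction 0 is a placeholder: the half about expansions is wanted. *)
have [H _] := dir_derivative_comp (piM w) 0 (fun t => afun_expands f t Up').
have [P sP] := H s; exists P; apply: expands_eq sP.
by apply: filterS (Vplus_near Up) => x Ux; rewrite /= (ext0_in _ Ux).
Qed.

Definition aact (w : 'M[R]_l.+2) (f : afun) : afun :=
  if pselect (G w) is left wG then AnalyticFun (act_analytic f wG) else f.

Lemma aactE w f (x : U) : G w -> aact w f x = piM w (ext0 f (invmx w *m val x)).
Proof. by rewrite /aact; case: pselect. Qed.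

Lemma ext0_aact w f x : G w -> U x -> ext0 (aact w f) x = piM w (ext0 f (invmx w *m x)).
Proof. by move=> wG Ux; rewrite (ext0_in _ Ux) aactE. Qed.

Lemma ext0_lin c (f h : afun) x : ext0 (c *: f + h : afun) x = c *: ext0 f x + ext0 h x.
Proof. by rewrite /ext0; case: insubP => [x' _ _|_]; rewrite ?scaler0 ?addr0. Qed.

Lemma adir_vec c u v f : adir (c *: u + v) f = c%:C *: adir u f + adir v f.
Proof.
apply: afun_eq => x; apply: dir_derivative_vec => s.
exact/afun_expands/(set_valP x).
Qed.

Lemma adir_sum v f : adir v f = \sum_i (v i 0)%:C *: adir (delta_mx i 0) f.
Proof.
have a0 : adir 0 f = 0.
  have := adir_vec (- 1) 0 0 f.
  by rewrite scaler0 addr0 rmorphN rmorph1 scaleN1r addNr.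
rewrite {1}(col_sum_delta v); elim: (index_enum _) => [|i r IHr]; first by rewrite !big_nil.
by rewrite !big_cons adir_vec IHr.
Qed.

Lemma analytic_coefficient_space :
  coefficient_space S Phi Y aact (fun j => adir (delta_mx j 0)).
Proof.
have [pi1 piMM] := modM.
split.
- move=> w wG c f h; apply: afun_eq => x.
  have -> : (c *: aact w f + aact w h : afun) x = c *: aact w f x + aact w h x by [].
  by rewrite !aactE // ext0_lin linearP.
- move=> f; apply: afun_eq => x; rewrite aactE ?pi1 ?id_lfunE ?invmx1 ?mul1mx ?ext0E //.
  exact: (ext_weyl1 latY).
- move=> w w' f wG w'G; apply: afun_eq => x.
  rewrite !aactE //; last exact: (ext_weyl_mul rsP latY).
  have Ux := set_valP x; have Ux' : U (invmx w *m val x) by apply: Vplus_group => //; exact: GV.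
  rewrite (ext0_aact f w'G Ux') (piMM _ _ wG w'G) comp_lfunE mulmxA.
  by rewrite (ext_weyl_invM rsP latY wG w'G).
- move=> j c f h; apply: afun_eq => x; have Ux := set_valP x.
  have -> : (c *: adir (delta_mx j 0) f + adir (delta_mx j 0) h : afun) x =
    c *: dir_derivative (delta_mx j 0) (ext0 f) (val x) +
    dir_derivative (delta_mx j 0) (ext0 h) (val x) by [].
  rewrite -[LHS]/(dir_derivative _ _ _).
  (* Scaling by [c] is an endomorphism of [M], so the chain rule with the identity substitution
     covers it. *)
  pose phi : 'End(M) := (c *: \1)%VF.
  have Ux1 : U (1%:M *m val x) by rewrite mul1mx.
  have [H HD] := dir_derivative_comp phi (delta_mx j 0) (fun t => afun_expands f t Ux1).
  have -> : ext0 (c *: f + h : afun) = fun y => phi (ext0 f (1%:M *m y)) + ext0 h y.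
    by apply/funext => y; rewrite ext0_lin mul1mx scale_lfunE id_lfunE.
  rewrite dir_derivativeD; last 2 first.
  + exact: H.
  + by move=> s; exact: afun_expands.
  by rewrite HD !mul1mx scale_lfunE id_lfunE.
- move=> i j f; apply: afun_eq => x; have Ux := set_valP x.
  apply: (dir_derivativeC (fun s => afun_expands f s Ux));
    by apply: filterS (Vplus_near Ux) => y Uy; rewrite (ext0_in _ Uy).
move=> w j f wG.
have -> : \sum_i (w i j)%:C *: adir (delta_mx i 0) (aact w f) = adir (w *m delta_mx j 0) (aact w f).
  by rewrite [RHS]adir_sum; apply: eq_bigr => i _; rewrite -colE mxE.
apply: afun_eq => x; have Ux := set_valP x; rewrite aactE //.
have Ux' : U (invmx w *m val x) by apply: Vplus_group => //; exact: GV.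
have [H HD] := dir_derivative_comp (piM w) (w *m delta_mx j 0) (fun t => afun_expands f t Ux').
have near_eq : \forall y \near val x, piM w (ext0 f (invmx w *m y)) = ext0 (aact w f) y.
  by apply: filterS (Vplus_near Ux) => y Uy; rewrite ext0_aact.
have E : ext0 (adir (delta_mx j 0) f) (invmx w *m val x) =
    dir_derivative (delta_mx j 0) (ext0 f) (invmx w *m val x) by rewrite (ext0_in _ Ux').
rewrite E; refine (etrans _ (dir_derivative_near (w *m delta_mx j 0) near_eq H)).
refine (etrans _ (esym HD)).
exact (congr1 (fun e => piM w (dir_derivative e (ext0 f) (invmx w *m val x)))
  (esym (mulKmx (ext_weyl_unit rsP latY wG) (delta_mx j 0)))).
Qed.

End AnalyticSpace.

(** * Chambers and the realization on analytic functions *)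

Section Chambers.

Variables (R : realType) (l : nat) (S : 'M[R]_l) (Phi : set 'cV[R]_l).
Variables (F : seq 'cV[R]_l) (theta : 'cV[R]_l) (Y : set 'cV[R]_l).
Hypothesis rsP : root_system S Phi.
Hypothesis simpleF : simple_roots Phi F.
Hypothesis highest : highest_root Phi F theta.
Hypothesis latY : translation_lattice S Phi Y.

Local Notation G := (ext_weyl S Phi Y).
Local Notation AR := (affine_roots Phi).
Local Notation reg := (regular S Phi F theta).
Local Notation Ch := (chambers S Phi F theta).

Lemma continuous_functional n (c : 'I_n -> R) :
  continuous (fun x : 'cV[R]_n => \sum_j c j * x j 0).
Proof.
move=> p A /nbhs_ballP[e /= e0 eA].
pose C := 1 + \sum_j `|c j|.
have C0 : 0 < C by rewrite ltr_pwDl // sumr_ge0.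
apply/(@nbhs_ballP R 'cV[R]_n); exists (e / C) => [|x]; first exact: divr_gt0.
rewrite -(ball_normE (V := 'cV[R]_n)) /= ltr_pdivlMr // => xe; apply: eA.
rewrite -ball_normE /=; apply: le_lt_trans xe.
rewrite -sumrB; apply: le_trans (ler_norm_sum _ _ _) _.
rewrite mulrDr mulr1 mulr_sumr ler_wpDl //; apply: ler_sum => j _.
rewrite -mulrBr normrM mulrC ler_wpM2r //.
by have := cV_entry_le (p - x) j; rewrite !mxE.
Qed.

Lemma continuous_mulmx m n (w : 'M[R]_(m, n)) : continuous (fun x : 'cV[R]_n => w *m x).
Proof.
move=> p A /(@nbhs_ballP R 'cV[R]_m)[e /= e0 eA].
have near_i i : nbhs (p : 'cV[R]_n) [set x | `|(w *m p) i 0 - (w *m x) i 0| < e].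
  have fc := @continuous_functional n (w i) p _ (nbhsx_ballx _ _ e0).
  refine (@filterS _ _ (@nbhs_filter 'cV[R]_n p) _ _ _ fc) => x.
  by rewrite /= -ball_normE /= !mxE.
have := @filter_forall _ _ _ _ (@nbhs_filter 'cV[R]_n p) near_i.
apply: (@filterS _ _ (@nbhs_filter 'cV[R]_n p)) => x xe; apply: eA.
rewrite -(ball_normE (V := 'cV[R]_m)) /= [ltLHS]mx_normrE; apply: bigmax_lt => // -[i j] _ /=.
by rewrite (ord1 j) [X in `|X|]mxE [X in _ + X]mxE; exact: (xe i).
Qed.

Lemma continuous_hform a : continuous (hform S a).
Proof.
have -> : hform S a = fun x => \sum_j hform S a (delta_mx j 0) * x j 0.
  apply/funext => x; rewrite {1}(col_sum_delta x).
  rewrite (big_morph (hform S a) (fun y z => hformDr S y z a) (hform0r S a)).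
  by apply: eq_bigr => j _; rewrite hformZr mulrC.
exact: continuous_functional.
Qed.

Let GV w : G w -> G (invmx w) := @ext_weyl_inv _ _ _ _ _ rsP latY w.

Lemma regular_hform a x : reg x -> AR a -> hform S a x != 0.
Proof.
move=> [_ rx] /(affine_pos_or_neg rsP simpleF highest)[/rx //|/rx].
by rewrite hformNl oppr_eq0.
Qed.

Lemma regular_group w x : G w -> reg x -> reg (w *m x).
Proof.
move=> wG xr; split; first by apply: (Vplus_group latY wG); case: xr.
move=> a /affine_posW ra.
rewrite -(mulKVmx (ext_weyl_unit rsP latY wG) a) (ext_weyl_hform rsP latY _ _ wG).
by apply: regular_hform => //; apply: (ext_weyl_affine rsP latY) => //; exact: GV.
Qed.

Lemma chamberP (C : Ch) : exists2 x, reg x & val C = connected_component reg x.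
Proof. by have [x rx <-] := set_valP C; exists x. Qed.

Lemma chamber_regular (C : Ch) x : val C x -> reg x.
Proof. by have [y _ ->] := chamberP C; exact: connected_component_sub. Qed.

Lemma chamber_inhabited (C : Ch) : exists x, val C x.
Proof. by have [y yr ->] := chamberP C; exists y; exact: connected_component_refl. Qed.

(** The image of a chamber under the continuous function [hform S a] is connected; with values of
    both signs it would contain zero, against regularity. *)
Lemma chamber_sign (C : Ch) a x y : AR a -> val C x -> val C y ->
  hform S a x < 0 -> hform S a y < 0.
Proof.
move=> ra Cx Cy ax; rewrite ltNge; apply/negP => ay.
have cC : connected (hform S a @` val C).
  apply: connected_continuous_connected.
    by have [z _ ->] := chamberP C; exact: component_connected.
  by apply: continuous_subspaceT; exact: continuous_hform.
have /connected_intervalP/(_ (hform S a x) (hform S a y)) := cC.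
move=> /(_ (ex_intro2 _ _ x Cx erefl) (ex_intro2 _ _ y Cy erefl) 0).
rewrite (ltW ax) ay => /(_ isT)[z Cz az].
by have := regular_hform (chamber_regular Cz) ra; rewrite az eqxx.
Qed.

Definition chamber_neg (a : 'cV[R]_l.+2) (C : Ch) : bool :=
  `[< val C `<=` [set x | hform S a x < 0] >].

Lemma chamber_negE a (C : Ch) x : AR a -> val C x -> chamber_neg a C = (hform S a x < 0).
Proof.
move=> ra Cx; apply/asboolP/idP => [/(_ x Cx) //|ax y Cy].
exact: (chamber_sign ra Cx Cy ax).
Qed.

(** The image is a connected set of regular points through [w *m x]. The same inclusion for the
    inverse of [w] will give equality. *)
Lemma image_component w x : G w -> reg x ->
  [set w *m y | y in connected_component reg x] `<=` connected_component reg (w *m x).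
Proof.
move=> wG xr; apply: connected_component_max.
- by exists x => //; exact: connected_component_refl.
- move=> _ [y /connected_component_sub ry <-]; exact: regular_group.
apply: connected_continuous_connected; first exact: component_connected.
by apply: continuous_subspaceT; exact: continuous_mulmx.
Qed.

Lemma chamber_image w (C : Ch) : G w -> Ch [set w *m y | y in val C].
Proof.
move=> wG; have [x xr ->] := chamberP C.
exists (w *m x); first exact: regular_group.
apply/seteqP; split; last exact: image_component.
move=> y; have wu := ext_weyl_unit rsP latY wG; rewrite -(mulKVmx wu y) => wy.
exists (invmx w *m y) => //.
have := image_component (GV wG) (regular_group wG xr); rewrite (mulKmx wu); apply.
by exists (w *m (invmx w *m y)) => //; rewrite (mulKmx wu).
Qed.

Definition chamber_act (w : 'M[R]_l.+2) (C : Ch) : Ch :=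
  if pselect (G w) is left wG then
    Sub [set w *m y | y in val C] (mem_set (chamber_image C wG)) else C.

Lemma chamber_actE w (C : Ch) : G w -> val (chamber_act w C) = [set w *m y | y in val C].
Proof. by rewrite /chamber_act; case: pselect. Qed.

(** Signs are read at an arbitrary point of the chamber. Finiteness comes from its positive
    coefficient of [d], and nonnegativity on simple roots spreads to their nonnegative
    combinations. *)
Lemma chamber_sign_space : sign_space S Phi F theta Y chamber_act chamber_neg.
Proof.
split.
- move=> C; apply: val_inj; rewrite (chamber_actE C (ext_weyl1 latY)).
  by apply/seteqP; split=> [_ [y Cy <-]|y Cy]; [|exists y]; rewrite ?mul1mx.
- move=> w w' C wG w'G; apply: val_inj.
  rewrite (chamber_actE _ wG) (chamber_actE _ w'G) (chamber_actE _ (ext_weyl_mul rsP latY wG w'G)).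
  apply/seteqP; split=> [_ [y Cy <-]|_ [_ [y Cy <-] <-]].
    by exists (w' *m y); [exists y|rewrite mulmxA].
  by exists y; rewrite ?mulmxA.
- move=> w a C wG ra; have [x Cx] := chamber_inhabited C.
  have Cwx : val (chamber_act w C) (w *m x) by rewrite chamber_actE //; exists x.
  rewrite (chamber_negE (ext_weyl_affine rsP latY wG ra) Cwx) (chamber_negE ra Cx).
  by rewrite (ext_weyl_hform rsP latY _ _ wG).
- move=> a C ra; have [x Cx] := chamber_inhabited C.
  rewrite (chamber_negE (affine_opp rsP ra) Cx) (chamber_negE ra Cx) hformNl oppr_lt0.
  by rewrite lt0r (regular_hform (chamber_regular Cx) ra) leNgt.
- move=> C; have [x Cx] := chamber_inhabited C.
  have [Ux _] := chamber_regular Cx.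
  apply: sub_finite_set (finite_negative F theta rsP Ux) => a [pa na]; split=> //.
  by rewrite -(chamber_negE (affine_posW pa) Cx).
move=> C Cpos a [ra pa]; have [x Cx] := chamber_inhabited C.
rewrite (chamber_negE ra Cx) -leNgt; elim/nonneg_comb_ind: pa => [|y z hy hz|b bS].
- by rewrite hform0l.
- by rewrite hformDl addr_ge0.
have := Cpos b bS; rewrite (chamber_negE _ Cx) -?leNgt //.
exact: (affine_simple_root rsP simpleF highest).
Qed.

Section Realization.

Variable k : 'cV[R]_l.+2 -> R[i].
Variables (M : vectType R[i]) (piM : 'M[R]_l.+2 -> 'End(M)).

Local Notation E := (FM S Phi F theta M).
Local Notation rho := (aact rsP latY piM).
Local Notation del := (fun j : 'I_l.+2 => adir (delta_mx j 0)).
Local Notation dunklE := (dunkl_op S Phi F theta k chamber_act chamber_neg rho del).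

Lemma eval_val (f : E) (C : Ch) : Defs.eval f (val C) = ext0 (f C).
Proof. by apply/funext => x; rewrite /Defs.eval valK. Qed.

Lemma group_op_eval w (f : E) (C : Ch) (x : Vplus R l) : G w ->
  group_op chamber_act rho w f C x = weyl_act piM w f (val C) (val x).
Proof.
move=> wG; have wVG := ext_weyl_inv rsP latY wG.
rewrite /group_op aactE // /weyl_act.
by rewrite -(chamber_actE C wVG) eval_val.
Qed.

Lemma afun_sum (T : Type) (r : seq T) (h : T -> analytic_fun (Vplus R l) M) (x : Vplus R l) :
  (\sum_(a <- r) h a) x = \sum_(a <- r) h a x.
Proof. exact: (big_morph (fun f : analytic_fun (Vplus R l) M => f x)). Qed.

Lemma dunkl_op_eval v (f : E) (C : Ch) (x : Vplus R l) :
  dunklE (cplx v) f C x = dunkl k piM v f (val C) (val x).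
Proof.
have finN : finite_set (neg_roots Phi F theta chamber_neg C).
  exact: (ss_fin chamber_sign_space).
have subE (p q : analytic_fun (Vplus R l) M) : (p - q) x = p x - q x by [].
have scaleE c (p : analytic_fun (Vplus R l) M) : (c *: p) x = c *: p x by [].
rewrite /dunkl_op subE /dunkl eval_val; congr (_ - _).
  have -> : del_vec del (cplx v) (f C) = adir v (f C).
    by rewrite adir_sum; apply: eq_bigr => i _; rewrite mxE.
  reflexivity.
(* In [dunkl] the sum runs over all positive roots; [chi] vanishes off the finite set of those
   negative on [C]. *)
rewrite -(fsbig_widen (neg_roots Phi F theta chamber_neg C)); last 2 first.
- by move=> a [].
- move=> a [pa na]; rewrite /= /chi ifF ?mulr0 ?scale0r //.
  by apply/negP => nC; apply: na.
rewrite (fsbig_finite _ _ finN) afun_sum big_seq [RHS]big_seq; apply: eq_bigr => a.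
rewrite in_fset_set // inE => -[pa na].
rewrite scaleE group_op_eval; last exact: (ext_weyl_refl rsP latY (affine_posW pa)).
rewrite cplx_hform (_ : chi S a (val C) = 1) ?mulr1 //.
by rewrite /chi -/(chamber_neg a C) na.
Qed.

End Realization.

End Chambers.

Theorem proposition2p5 (R : realType)
    (g : vectType R[i]) (br : g -> g -> g) (hs : {vspace g}) (V' : set g)
    (l : nat) (b : l.-tuple g) (S : 'M[R]_l)
    (F : seq 'cV[R]_l) (theta : 'cV[R]_l) (Y : set 'cV[R]_l)
    (k : 'cV[R]_l.+2 -> R[i])
    (M : vectType R[i]) (piM : 'M[R]_l.+2 -> 'End(M)) :
  let Phi := finite_roots br hs b in
  root_datum br hs V' b S ->
  simple_roots Phi F ->
  highest_root Phi F theta ->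
  translation_lattice S Phi Y ->
  multiplicity S Phi Y k ->
  ext_weyl_module S Phi Y piM ->
  (exists (H : algType R[i]) (iota : {lrmorphism mpoly l.+2 R[i] -> H})
          (delta : 'M[R]_l.+2 -> H),
     cherednik_algebra S Phi F theta Y k iota delta) /\
  (forall (H : algType R[i]) (iota : {lrmorphism mpoly l.+2 R[i] -> H})
          (delta : 'M[R]_l.+2 -> H),
     cherednik_algebra S Phi F theta Y k iota delta ->
     exists! pihat : H -> FM S Phi F theta M -> FM S Phi F theta M,
       [/\ algebra_morphism_to_End pihat,
           forall (v : 'cV[R]_l.+2) (f : FM S Phi F theta M)
                  (C : chambers S Phi F theta) (x : Vplus R l),
             pihat (iota (sym_vec (cplx v))) f C x =
               dunkl k piM v f (\val C) (\val x) &
           forall (w : 'M[R]_l.+2) (f : FM S Phi F theta M)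
                  (C : chambers S Phi F theta) (x : Vplus R l),
             ext_weyl S Phi Y w ->
             pihat (delta w) f C x = weyl_act piM w f (\val C) (\val x)]).
Proof.
move=> Phi rd simpleF highest latY kinv modM.
have rsP : root_system S Phi := finite_roots_system rd.
split; first exact: (cherednik_algebra_exists rsP simpleF highest latY kinv).
move=> H iota delta ca.
have cm := dunkl_cherednik_module rsP simpleF highest latY kinv
  (chamber_sign_space rsP simpleF highest latY) (analytic_coefficient_space rsP latY modM).
have [pi [[piH piD piW] pi_unique]] := cherednik_module_extends rsP simpleF highest latY cm ca.
exists pi; split.
  split=> // [v f C x|w f C x wG].
    by rewrite piD; exact: (dunkl_op_eval rsP simpleF highest latY k piM v f C x).
  by rewrite (piW _ _ wG); exact: (group_op_eval rsP simpleF highest latY piM f C x wG).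
(* Pointwise values on chambers and vectors determine elements of the function space, so the
   uniqueness already proved for operators applies. *)
move=> pi' [pi'H pi'D pi'W]; apply: pi_unique; split=> // [v f|w f wG].
  apply/funext => C; apply: afun_eq => x; rewrite pi'D.
  by rewrite (dunkl_op_eval rsP simpleF highest latY k piM v f C x).
apply/funext => C; apply: afun_eq => x; rewrite (pi'W _ _ _ _ wG).
by rewrite (group_op_eval rsP simpleF highest latY piM f C x wG).
Qed.
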